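(* For every $n\ge 1$, the natural map from $\mathcal{UR}_n$ to the covering space $\mathcal R_n^+$ of $\mathcal R_n$ consisting of configurations of oriented rings induces an isomorphism $\pi_1\,\mathcal{UR}_n\to\pi_1\mathcal R_n^+$.
   Context: A ring is a Euclidean (round) circle in $\mathbb R^3$. $\mathcal R_n$ is the space of unordered configurations of $n$ disjoint, pairwise unlinked (unoriented) rings in $\mathbb R^3$, topologized by the centers, radii and planes of the rings. $\mathcal{UR}_n\subset\mathcal R_n$ is the subspace of configurations of rings lying in planes parallel to the $yz$-plane. $\mathcal R^+_n$ is the $2^n$-sheeted covering space of $\mathcal R_n$ whose points are configurations in $\mathcal R_n$ together with a choice of orientation of each ring. The natural map $\mathcal{UR}_n\to\mathcal R_n^+$ gives all rings of a configuration the parallel orientation, e.g. the one corresponding by the right-hand rule to the normal direction $(1,0,0)$. *)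

(* Defs.v *)
From HB Require Import structures.
From mathcomp Require Import all_boot all_order all_algebra generic_quotient.
From mathcomp Require Import perm.
From mathcomp Require Import all_classical all_reals topology normedtype.
From mathcomp Require Import homotopy.
From mathcomp Require Import ring lra.

Set Implicit Arguments.
Unset Strict Implicit.
Unset Printing Implicit Defensive.

Import Order.TTheory GRing.Theory Num.Theory.
Import numFieldNormedType.Exports.

Local Open Scope classical_set_scope.
Local Open Scope ring_scope.
Local Open Scope quotient_scope.

Section unit_interval.
Context {R : realType}.

Definition unit_itv : Type := [set x : R | 0 <= x <= 1].

HB.instance Definition _ :=
  Topological.copy unit_itv [set x : R | 0 <= x <= 1].

Definition uval (t : unit_itv) : R := set_val t.

Lemma uval_ge0 t : 0 <= uval t.
Proof. by have /andP[] := set_valP t. Qed.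

Lemma uval_le1 t : uval t <= 1.
Proof. by have /andP[] := set_valP t. Qed.

Lemma uval_inj : injective uval.
Proof. exact: val_inj. Qed.

Lemma uval_continuous : continuous uval.
Proof. exact: initial_continuous. Qed.

Lemma clamp_subproof (x : R) :
  Num.max 0 (Num.min x 1) \in [set y : R | 0 <= y <= 1].
Proof. by rewrite inE /= le_max lexx /= ge_max ler01 ge_min lexx orbT. Qed.

Definition clamp (x : R) : unit_itv := SigSub (clamp_subproof x).

Lemma clampK (x : R) : 0 <= x <= 1 -> uval (clamp x) = x.
Proof.
by move=> /andP[x0 x1]; rewrite /uval /set_val /= min_l // max_r.
Qed.

Lemma uvalK : cancel uval clamp.
Proof. by move=> t; apply: uval_inj; rewrite clampK // uval_ge0 uval_le1. Qed.

Lemma clamp_continuous : continuous clamp.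
Proof.
apply: continuous_comp_initial => x.
apply: (@continuous_max R R (fun=> 0) (fun x => Num.min x 1)).
  exact: cvg_cst.
by apply: (@continuous_min R R id (fun=> 1)); [exact: cvg_id|exact: cvg_cst].
Qed.

Lemma clamp01 : clamp 0 != clamp 1.
Proof.
apply/eqP => /(congr1 uval); rewrite !clampK ?lexx ?ler01 // => /eqP.
by rewrite eq_sym oner_eq0.
Qed.

HB.instance Definition _ := isBiPointed.Build unit_itv clamp01.

Lemma uval_zero : uval zero = 0.
Proof. by rewrite clampK // lexx ler01. Qed.

Lemma uval_one : uval one = 1.
Proof. by rewrite clampK // lexx ler01. Qed.

Lemma clamp_le0 (x : R) : x <= 0 -> clamp x = zero.
Proof.
move=> x0; apply: uval_inj; rewrite uval_zero /uval /set_val /= max_l //.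
by rewrite ge_min x0.
Qed.

Lemma clamp_ge1 (x : R) : 1 <= x -> clamp x = one.
Proof.
move=> x1; apply: uval_inj; rewrite uval_one /uval /set_val /= min_r //.
by rewrite max_r // ler01.
Qed.

End unit_interval.
Arguments unit_itv : clear implicits.

Section pasting.
Context {R : realType} {X Y : topologicalType}.

Lemma paste_continuous (phi : X -> R) (c : R) (a b : X -> Y) :
  continuous phi -> continuous a -> continuous b ->
  (forall x, phi x = c -> a x = b x) ->
  continuous (fun x => if phi x <= c then a x else b x).
Proof.
move=> cphi ca cb ab x U /=.
suff : nbhs (if phi x <= c then a x else b x) U ->
  nbhs x (fun z => U (if phi z <= c then a z else b z)) by [].
have ca' : nbhs (a x) U -> nbhs x (fun z => U (a z)) by exact: ca.
have cb' : nbhs (b x) U -> nbhs x (fun z => U (b z)) by exact: cb.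
case: (ltgtP (phi x) c) => [xc|cx|/ab axbx] nU.
- have xn : nbhs x (fun z => phi z < c) by exact: (cphi x _ (lt_nbhsl xc)).
  by apply: filterS (filterI (ca' nU) xn) => z [/= Uz /ltW ->].
- have xn : nbhs x (fun z => c < phi z) by exact: (cphi x _ (lt_nbhsr cx)).
  apply: filterS (filterI (cb' nU) xn) => z [/= Uz].
  by rewrite ltNge => /negbTE ->.
- have na := ca' nU; rewrite axbx in nU.
  by apply: filterS (filterI na (cb' nU)) => z [/= az bz]; case: ifP.
Qed.

End pasting.

Lemma continuous_compose {X Y Z : topologicalType} (f : X -> Y) (g : Y -> Z) :
  continuous f -> continuous g -> continuous (fun x => g (f x)).
Proof. by move=> cf cg x; apply: continuous_comp; [exact: cf|exact: cg]. Qed.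

Lemma continuous_pairing {X Y Z : topologicalType} (f : X -> Y) (g : X -> Z) :
  continuous f -> continuous g -> continuous (fun x => (f x, g x)).
Proof. by move=> cf cg x; apply: cvg_pair; [exact: cf|exact: cg]. Qed.

Section path_operations.
Context {R : realType} {T : topologicalType}.
Local Notation I := (unit_itv R).

Definition path_concat (p q : I -> T) : I -> T := fun t =>
  if uval t <= 2^-1 then p (clamp (2 * uval t)) else q (clamp (2 * uval t - 1)).

Definition path_reverse (p : I -> T) : I -> T :=
  fun t => p (clamp (1 - uval t)).

Lemma affine_continuous {X : topologicalType} (a b : R) (f : X -> R) :
  continuous f -> continuous (fun x => a * f x + b).
Proof.
move=> cf x; apply: cvgD; last exact: cvg_cst.
by apply: cvgM; [exact: cvg_cst|exact: cf].
Qed.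

Lemma clamp_affine_continuous (a b : R) :
  continuous (fun t : I => clamp (a * uval t + b)).
Proof.
apply: continuous_compose clamp_continuous.
by apply: affine_continuous; exact: uval_continuous.
Qed.

Lemma path_concat_continuous (p q : I -> T) : continuous p -> continuous q ->
  p one = q zero -> continuous (path_concat p q).
Proof.
move=> cp cq pq; apply: paste_continuous; first exact: uval_continuous.
- have -> : (fun t : I => p (clamp (2 * uval t))) =
            (fun t : I => p (clamp (2 * uval t + 0))).
    by apply/funext => t; rewrite addr0.
  by apply: continuous_compose cp; exact: clamp_affine_continuous.
- by apply: continuous_compose cq; exact: clamp_affine_continuous.
- by move=> t ->; rewrite divff ?subrr // pnatr_eq0.
Qed.

Lemma path_reverse_continuous (p : I -> T) :
  continuous p -> continuous (path_reverse p).
Proof.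
move=> cp; have -> : path_reverse p = (fun t => p (clamp (-1 * uval t + 1))).
  by apply/funext => t; rewrite /path_reverse mulN1r addrC.
by apply: continuous_compose cp; exact: clamp_affine_continuous.
Qed.

Lemma path_concat_zero (p q : I -> T) : path_concat p q zero = p zero.
Proof. by rewrite /path_concat uval_zero invr_ge0 ler0n mulr0. Qed.

Lemma path_concat_one (p q : I -> T) : path_concat p q one = q one.
Proof.
rewrite /path_concat uval_one ifF; first by congr (q (clamp _)); lra.
by apply/negbTE; rewrite -ltNge; lra.
Qed.

Lemma path_reverse_zero (p : I -> T) : path_reverse p zero = p one.
Proof. by rewrite /path_reverse uval_zero subr0. Qed.

Lemma path_reverse_one (p : I -> T) : path_reverse p one = p zero.
Proof. by rewrite /path_reverse uval_one subrr. Qed.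

End path_operations.

Section loops.
Context {R : realType} {T : topologicalType} (x y z : T).
Local Notation I := (unit_itv R).
Context (p : {path I from x to y}) (q : {path I from y to z}).

Let pq_continuous : continuous (path_concat p q).
Proof.
apply: path_concat_continuous; [exact: cts_fun|exact: cts_fun|].
by rewrite path_one path_zero.
Qed.
Let pq_zero : path_concat p q zero = x.
Proof. by rewrite path_concat_zero path_zero. Qed.
Let pq_one : path_concat p q one = z.
Proof. by rewrite path_concat_one path_one. Qed.

HB.instance Definition _ :=
  isContinuous.Build I T (path_concat p q) pq_continuous.
HB.instance Definition _ :=
  @isPath.Build I T x z (path_concat p q) pq_zero pq_one.

Let pV_continuous : continuous (path_reverse p).
Proof. by apply: path_reverse_continuous; exact: cts_fun. Qed.
Let pV_zero : path_reverse p zero = y.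
Proof. by rewrite path_reverse_zero path_one. Qed.
Let pV_one : path_reverse p one = x.
Proof. by rewrite path_reverse_one path_zero. Qed.

HB.instance Definition _ :=
  isContinuous.Build I T (path_reverse p) pV_continuous.
HB.instance Definition _ :=
  @isPath.Build I T y x (path_reverse p) pV_zero pV_one.

End loops.

Section path_homotopy.
Context {R : realType} {T : topologicalType}.
Local Notation I := (unit_itv R).

(* Homotopy relative to the endpoints *)
Definition path_homotopic (p q : I -> T) : Prop :=
  exists H : I * I -> T, [/\ continuous H,
    forall s, H (s, zero) = p s,
    forall s, H (s, one) = q s,
    forall t, H (zero, t) = p zero &
    forall t, H (one, t) = p one].

Lemma path_homotopic_refl (p : I -> T) : continuous p -> path_homotopic p p.
Proof.
move=> cp; exists (fun z => p z.1); split => // z.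
by apply: continuous_comp; [exact: cvg_fst|exact: cp].
Qed.

Lemma path_homotopic_ends (p q : I -> T) : path_homotopic p q ->
  p zero = q zero /\ p one = q one.
Proof. by case=> H [_ _ H1 Hz Ho]; rewrite -!H1 Hz Ho. Qed.

Lemma path_homotopic_sym (p q : I -> T) :
  path_homotopic p q -> path_homotopic q p.
Proof.
move=> pq; have [pq0 pq1] := path_homotopic_ends pq.
case: pq => H [cH H0 H1 Hz Ho].
exists (fun z => H (z.1, path_reverse idfun z.2)); split => /=.
- apply: continuous_compose cH; apply: continuous_pairing.
    by move=> ?; exact: cvg_fst.
  apply: (@continuous_compose _ _ _ snd); first by move=> ?; exact: cvg_snd.
  by apply: path_reverse_continuous => ?; exact: cvg_id.
- by move=> s; rewrite path_reverse_zero H1.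
- by move=> s; rewrite path_reverse_one H0.
- by move=> t; rewrite Hz.
- by move=> t; rewrite Ho.
Qed.

Lemma path_homotopic_trans (p q r : I -> T) :
  path_homotopic p q -> path_homotopic q r -> path_homotopic p r.
Proof.
move=> pq; have [pq0 pq1] := path_homotopic_ends pq.
case: pq => H [cH H0 H1 Hz Ho] [K [cK K0 K1 Kz Ko]].
exists (fun z => path_concat (fun t => H (z.1, t)) (fun t => K (z.1, t)) z.2).
split => /=.
- have c1 : continuous (@fst I I) by move=> ?; exact: cvg_fst.
  have c2 : continuous (fun z : I * I => uval z.2).
    by apply: continuous_compose uval_continuous => ?; exact: cvg_snd.
  apply: (paste_continuous c2) => [||z ->].
  + apply: continuous_compose cH; apply: (continuous_pairing c1).
    apply: continuous_compose clamp_continuous => z.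
    by apply: cvgM; [exact: cvg_cst|exact: c2].
  + apply: continuous_compose cK; apply: (continuous_pairing c1).
    apply: continuous_compose clamp_continuous.
    exact: affine_continuous.
  + by rewrite divff ?subrr ?pnatr_eq0 // H1 K0.
- by move=> s; rewrite path_concat_zero.
- by move=> s; rewrite path_concat_one.
- by move=> t; rewrite /path_concat; case: ifP; rewrite ?Hz ?Kz.
- by move=> t; rewrite /path_concat; case: ifP; rewrite ?Ho ?Ko.
Qed.

Lemma path_homotopic_concat (p p' q q' : I -> T) : p one = q zero ->
  path_homotopic p p' -> path_homotopic q q' ->
  path_homotopic (path_concat p q) (path_concat p' q').
Proof.
move=> pq [H [cH H0 H1 Hz Ho]] [K [cK K0 K1 Kz Ko]].
exists (fun z => path_concat (fun s => H (s, z.2)) (fun s => K (s, z.2)) z.1).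
have c1 : continuous (fun z : I * I => uval z.1).
  by apply: continuous_compose uval_continuous => ?; exact: cvg_fst.
have c2 : continuous (@snd I I) by move=> ?; exact: cvg_snd.
split => /=.
- apply: (paste_continuous c1) => [||z ->].
  + apply: continuous_compose cH; apply: (continuous_pairing _ c2).
    apply: continuous_compose clamp_continuous => z.
    by apply: cvgM; [exact: cvg_cst|exact: c1].
  + apply: continuous_compose cK; apply: (continuous_pairing _ c2).
    apply: continuous_compose clamp_continuous.
    exact: affine_continuous.
  + by rewrite divff ?subrr ?pnatr_eq0 // Ho Kz.
- by move=> s; rewrite /path_concat H0 K0.
- by move=> s; rewrite /path_concat H1 K1.
- by move=> t; rewrite !path_concat_zero Hz.
- by move=> t; rewrite !path_concat_one Ko.
Qed.

Lemma path_homotopic_reverse (p p' : I -> T) :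
  path_homotopic p p' -> path_homotopic (path_reverse p) (path_reverse p').
Proof.
move=> [H [cH H0 H1 Hz Ho]].
exists (fun z => H (path_reverse idfun z.1, z.2)); split => /=.
- apply: continuous_compose cH; apply: continuous_pairing.
    apply: (@continuous_compose _ _ _ fst); first by move=> ?; exact: cvg_fst.
    by apply: path_reverse_continuous => ?; exact: cvg_id.
  by move=> ?; exact: cvg_snd.
- by move=> s; rewrite H0.
- by move=> s; rewrite H1.
- by move=> t; rewrite !path_reverse_zero Ho.
- by move=> t; rewrite !path_reverse_one Hz.
Qed.

Lemma path_homotopic_reparam (p : I -> T) (phi psi : I -> I) :
  continuous p -> continuous phi -> continuous psi ->
  phi zero = psi zero -> phi one = psi one ->
  path_homotopic (fun t => p (phi t)) (fun t => p (psi t)).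
Proof.
move=> cp cphi cpsi e0 e1.
pose K (z : I * I) : I :=
  clamp ((1 - uval z.2) * uval (phi z.1) + uval z.2 * uval (psi z.1)).
exists (fun z => p (K z)).
have c1 f : continuous f -> continuous (fun z : I * I => uval (f z.1)).
  move=> cf; apply: continuous_compose uval_continuous.
  by apply: (@continuous_compose _ _ _ fst) => // ?; exact: cvg_fst.
have c2 : continuous (fun z : I * I => uval z.2).
  by apply: continuous_compose uval_continuous => ?; exact: cvg_snd.
split => /=.
- apply: continuous_compose cp; apply: continuous_compose clamp_continuous => z.
  apply: cvgD; apply: cvgM; last exact: c1.
  + by apply: cvgB; [exact: cvg_cst|exact: c2].
  + exact: c1.
  + exact: c2.
- by move=> s; rewrite /K /= uval_zero subr0 mul1r mul0r addr0 uvalK.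
- by move=> s; rewrite /K /= uval_one subrr mul1r mul0r add0r uvalK.
- by move=> t; rewrite /K /= e0 -mulrDl subrK mul1r uvalK.
- by move=> t; rewrite /K /= e1 -mulrDl subrK mul1r uvalK.
Qed.

Lemma path_homotopic_assoc (p q r : I -> T) :
  continuous p -> continuous q -> continuous r ->
  p one = q zero -> q one = r zero ->
  path_homotopic (path_concat p (path_concat q r))
                 (path_concat (path_concat p q) r).
Proof.
move=> cp cq cr pq qr; apply: path_homotopic_sym.
pose w := path_concat p (path_concat q r).
have cw : continuous w.
  apply: path_concat_continuous => //; last by rewrite path_concat_zero.
  exact: path_concat_continuous.
pose phi (t : I) : I := clamp (Num.min (Num.min (2 * uval t + 0)
  (1 * uval t + 4^-1)) (2^-1 * uval t + 2^-1)).
have -> : path_concat (path_concat p q) r = (fun t => w (phi t)).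
  apply/funext => t; have := uval_ge0 t; have := uval_le1 t.
  rewrite /w /phi /path_concat; move: (uval t) => u u1 u0.
  have [u4|u4] := leP u 4^-1.
    have -> : Num.min (Num.min (2 * u + 0) (1 * u + 4^-1)) (2^-1 * u + 2^-1)
      = 2 * u by rewrite !min_l //; lra.
    have u2 : u <= 2^-1 by lra.
    have v2 : 2 * u <= 2^-1 by lra.
    by rewrite u2 clampK ?v2 //; lra.
  have [u2|u2] := leP u 2^-1.
    have -> : Num.min (Num.min (2 * u + 0) (1 * u + 4^-1)) (2^-1 * u + 2^-1)
      = u + 4^-1 by rewrite (@min_r _ _ (2 * u + 0)) ?min_l ?mul1r //; lra.
    have v2 : (2 * u <= 2^-1) = false by apply/negbTE; rewrite -ltNge; lra.
    have w2 : (u + 4^-1 <= 2^-1) = false by apply/negbTE; rewrite -ltNge; lra.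
    have z2 : 2 * (u + 4^-1) - 1 <= 2^-1 by lra.
    rewrite clampK; last lra.
    rewrite v2 clampK; last lra.
    rewrite w2 clampK; last lra.
    rewrite z2.
    by congr (q (clamp _)); lra.
  have -> : Num.min (Num.min (2 * u + 0) (1 * u + 4^-1)) (2^-1 * u + 2^-1)
      = 2^-1 * u + 2^-1 by rewrite min_r // le_min; lra.
  have w2 : (2^-1 * u + 2^-1 <= 2^-1) = false.
    by apply/negbTE; rewrite -ltNge; lra.
  have z2 : (2 * (2^-1 * u + 2^-1) - 1 <= 2^-1) = false.
    by apply/negbTE; rewrite -ltNge; lra.
  rewrite clampK; last lra.
  rewrite w2 clampK; last lra.
  rewrite z2.
  by congr (r (clamp _)); lra.
apply: (path_homotopic_reparam (psi := idfun)) => //.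
- apply: continuous_compose clamp_continuous => t.
  apply: (@continuous_min R I
      (fun t => Num.min (2 * uval t + 0) (1 * uval t + 4^-1))).
    apply: (@continuous_min R I (fun t => 2 * uval t + 0)).
      by apply: affine_continuous; exact: uval_continuous.
    by apply: affine_continuous; exact: uval_continuous.
  by apply: affine_continuous; exact: uval_continuous.
- by move=> ?; exact: cvg_id.
- apply: uval_inj; rewrite /phi uval_zero !mulr0 addr0 !add0r.
  by rewrite !min_l ?clampK //; lra.
- apply: uval_inj; rewrite /phi uval_one.
  by rewrite min_r ?le_min ?clampK; lra.
Qed.

Lemma path_homotopic_concat1p (p : I -> T) : continuous p ->
  path_homotopic (path_concat (cst (p zero)) p) p.
Proof.
move=> cp.
have -> : path_concat (cst (p zero)) p = fun t => p (clamp (2 * uval t - 1)).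
  apply/funext => t; rewrite /path_concat; case: ifP => // t2.
  rewrite /cst; by have /clamp_le0 -> : 2 * uval t - 1 <= 0 by lra.
apply: (path_homotopic_reparam (psi := idfun)) => //.
- exact: clamp_affine_continuous.
- by move=> ?; exact: cvg_id.
- by rewrite clamp_le0 // uval_zero; lra.
- by rewrite uval_one; congr clamp; lra.
Qed.

Lemma path_homotopic_concatp1 (p : I -> T) : continuous p ->
  path_homotopic (path_concat p (cst (p one))) p.
Proof.
move=> cp.
have -> : path_concat p (cst (p one)) = fun t => p (clamp (2 * uval t + 0)).
  apply/funext => t; rewrite /path_concat addr0; case: ifP => //= /negbT.
  rewrite -ltNge => t2.
  by have /clamp_ge1 -> : 1 <= 2 * uval t by lra.
apply: (path_homotopic_reparam (psi := idfun)) => //.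
- exact: clamp_affine_continuous.
- by move=> ?; exact: cvg_id.
- by rewrite uval_zero; congr clamp; lra.
- by rewrite clamp_ge1 // uval_one; lra.
Qed.

Lemma path_homotopic_concatpV (p : I -> T) : continuous p ->
  path_homotopic (path_concat p (path_reverse p)) (cst (p zero)).
Proof.
move=> cp.
pose phi := path_concat idfun (path_reverse (@idfun I)).
have -> : path_concat p (path_reverse p) = fun t => p (phi t).
  by apply/funext => t; rewrite /phi /path_concat; case: ifP.
apply: (path_homotopic_reparam (psi := cst zero)) => //.
- have cid : continuous (@idfun I) by move=> ?; exact: cvg_id.
  apply: path_concat_continuous => //; last by rewrite path_reverse_zero.
  exact: path_reverse_continuous.
- exact: (@cst_continuous I I zero).
- by rewrite /phi path_concat_zero.
- by rewrite /phi path_concat_one path_reverse_one.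
Qed.

Lemma path_homotopic_concatVp (p : I -> T) : continuous p ->
  path_homotopic (path_concat (path_reverse p) p) (cst (p one)).
Proof.
move=> cp.
pose phi := path_concat (path_reverse (@idfun I)) idfun.
have -> : path_concat (path_reverse p) p = fun t => p (phi t).
  by apply/funext => t; rewrite /phi /path_concat; case: ifP.
apply: (path_homotopic_reparam (psi := cst one)) => //.
- have cid : continuous (@idfun I) by move=> ?; exact: cvg_id.
  apply: path_concat_continuous => //; last by rewrite path_reverse_one.
  exact: path_reverse_continuous.
- exact: (@cst_continuous I I one).
- by rewrite /phi path_concat_zero path_reverse_zero.
- by rewrite /phi path_concat_one.
Qed.

End path_homotopy.

Section fundamental_group.
Context {R : realType} {T : topologicalType} (x : T).
Local Notation I := (unit_itv R).
Local Notation loop := {path I from x to x}.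

Definition loop_equiv (p q : loop) : bool := `[< path_homotopic p q >].

Let loop_equiv_refl : reflexive loop_equiv.
Proof. by move=> p; apply/asboolP/path_homotopic_refl; exact: cts_fun. Qed.
Let loop_equiv_sym : symmetric loop_equiv.
Proof.
by move=> p q; apply/asboolP/asboolP; exact: path_homotopic_sym.
Qed.
Let loop_equiv_trans : transitive loop_equiv.
Proof.
move=> q p r /asboolP pq /asboolP qr; apply/asboolP.
exact: path_homotopic_trans qr.
Qed.

Canonical loop_equiv_rel :=
  EquivRel loop_equiv loop_equiv_refl loop_equiv_sym loop_equiv_trans.

Definition pi1 : Type := {eq_quot loop_equiv}.
HB.instance Definition _ := Choice.on pi1.
HB.instance Definition _ := Quotient.on pi1.

Definition loop_class (p : loop) : pi1 := \pi_pi1 p.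

Lemma loop_classP (p q : loop) :
  loop_class p = loop_class q <-> path_homotopic p q.
Proof.
split => [/eqmodP/asboolP//|pq]; exact/eqmodP/asboolP.
Qed.

Lemma loop_class_surj (a : pi1) : exists p, a = loop_class p.
Proof. by exists (repr a); rewrite /loop_class reprK. Qed.

Lemma repr_loop_class (p : loop) : path_homotopic (repr (loop_class p)) p.
Proof. by apply/loop_classP; rewrite /loop_class reprK. Qed.

Definition pi1_mul (a b : pi1) : pi1 :=
  loop_class (path_concat (repr a) (repr b)).
Definition pi1_one : pi1 := loop_class (cst x).
Definition pi1_inv (a : pi1) : pi1 := loop_class (path_reverse (repr a)).

Lemma pi1_mulE (p q : loop) :
  pi1_mul (loop_class p) (loop_class q) = loop_class (path_concat p q).
Proof.
apply/loop_classP; apply: path_homotopic_concat; try exact: repr_loop_class.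
by rewrite path_one path_zero.
Qed.

Lemma pi1_invE (p : loop) :
  pi1_inv (loop_class p) = loop_class (path_reverse p).
Proof. by apply/loop_classP/path_homotopic_reverse; exact: repr_loop_class. Qed.

Let pi1_mulA : associative pi1_mul.
Proof.
move=> a b c; have [p ->] := loop_class_surj a.
have [q ->] := loop_class_surj b.
have [r ->] := loop_class_surj c; rewrite !pi1_mulE; apply/loop_classP.
by apply: path_homotopic_assoc; rewrite ?path_one ?path_zero //; exact: cts_fun.
Qed.

Let pi1_mul1 : left_id pi1_one pi1_mul.
Proof.
move=> a; have [p ->] := loop_class_surj a; rewrite pi1_mulE; apply/loop_classP.
have := @path_homotopic_concat1p _ _ p (@cts_fun _ _ p); by rewrite path_zero.
Qed.

Let pi1_mulr1 : right_id pi1_one pi1_mul.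
Proof.
move=> a; have [p ->] := loop_class_surj a; rewrite pi1_mulE; apply/loop_classP.
have := @path_homotopic_concatp1 _ _ p (@cts_fun _ _ p); by rewrite path_one.
Qed.

Let pi1_mulV : left_inverse pi1_one pi1_inv pi1_mul.
Proof.
move=> a; have [p ->] := loop_class_surj a; rewrite pi1_invE pi1_mulE.
apply/loop_classP.
have := @path_homotopic_concatVp _ _ p (@cts_fun _ _ p); by rewrite path_one.
Qed.

Let pi1_mulrV : right_inverse pi1_one pi1_inv pi1_mul.
Proof.
move=> a; have [p ->] := loop_class_surj a; rewrite pi1_invE pi1_mulE.
apply/loop_classP.
have := @path_homotopic_concatpV _ _ p (@cts_fun _ _ p); by rewrite path_zero.
Qed.

HB.instance Definition _ :=
  isGroup.Build pi1 pi1_mulA pi1_mul1 pi1_mulr1 pi1_mulV pi1_mulrV.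

End fundamental_group.
Arguments pi1 R {T} x.

Section induced_map.
Context {R : realType} {T U : topologicalType} (f : continuousType T U) (x : T).

Definition pi1_map (a : pi1 R x) : pi1 R (f x) := loop_class (f \o repr a).

Lemma pi1_mapE (p : {path unit_itv R from x to x}) :
  pi1_map (loop_class p) = loop_class (f \o p).
Proof.
apply/loop_classP; have [H [cH H0 H1 Hz Ho]] := repr_loop_class p.
exists (f \o H); split => /= [|s|s|t|t]; rewrite ?H0 ?H1 ?Hz ?Ho //.
by apply: continuous_compose cH _; exact: cts_fun.
Qed.

Let pi1_mapM : {morph pi1_map : a b / (a * b)%g}.
Proof.
move=> a b; have [p ->] := loop_class_surj a; have [q ->] := loop_class_surj b.
rewrite -[(_ * _)%g]/(pi1_mul _ _) -[RHS]/(pi1_mul _ _).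
rewrite pi1_mulE !pi1_mapE pi1_mulE.
congr loop_class; apply/path_eqP => t /=.
by rewrite /path_concat /=; case: ifP.
Qed.

HB.instance Definition _ := isMultiplicative.Build _ _ pi1_map pi1_mapM.

End induced_map.
Arguments pi1_map R {T U} f x a.

Definition group_isomorphism (G H : groupType) (f : G -> H) : Prop :=
  {morph f : a b / (a * b)%g} /\ bijective f.

Section subspace_map.
Context {T U : topologicalType} (A : set T) (B : set U).
Context (f : continuousType T U) (fAB : {homo f : t / A t >-> B t}).

Definition subspace_map (t : A) : B := SigSub (mem_set (fAB (set_valP t))).

Lemma subspace_mapE t : set_val (subspace_map t) = f (set_val t).
Proof. by []. Qed.

Let subspace_map_continuous : continuous subspace_map.
Proof.
apply: continuous_comp_initial.
apply: (@continuous_compose _ _ _ (@set_val T A) f).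
  exact: initial_continuous.
exact: cts_fun.
Qed.

HB.instance Definition _ :=
  isContinuous.Build A B subspace_map subspace_map_continuous.

End subspace_map.

(* [unordered n T] is the quotient of T ^ n by 'S_n; configuration spaces are
   subspaces of it, which is the same as taking the quotient of the space of
   ordered configurations because T ^ n -> T ^ n / 'S_n is an open map *)
Section unordered_tuples.
Context (n : nat).

Section def.
Context (T : topologicalType).
Local Notation tuples := {ptws 'I_n -> T}.

Definition reordering (s t : tuples) : bool :=
  `[< exists g : 'S_n, t = s \o g >].

Let reordering_refl : reflexive reordering.
Proof.
by move=> s; apply/asboolP; exists 1%g; apply/funext => i /=; rewrite perm1.
Qed.
Let reordering_sym : symmetric reordering.
Proof.
have H s t : reordering s t -> reordering t s.
  move=> /asboolP[g ->]; apply/asboolP; exists g^-1%g.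
  by apply/funext => i /=; rewrite permKV.
by move=> s t; apply/idP/idP; exact: H.
Qed.
Let reordering_trans : transitive reordering.
Proof.
move=> t s r /asboolP[g ->] /asboolP[h ->]; apply/asboolP; exists (h * g)%g.
by apply/funext => i /=; rewrite permM.
Qed.

Canonical reordering_equiv :=
  EquivRel reordering reordering_refl reordering_sym reordering_trans.

Definition unordered : Type := {eq_quot reordering}.
HB.instance Definition _ := Quotient.on unordered.
HB.instance Definition _ :=
  Topological.copy unordered (quotient_topology {eq_quot reordering}).

Definition unorder (s : 'I_n -> T) : unordered := \pi_unordered s.

Lemma unorderP (s t : 'I_n -> T) :
  unorder s = unorder t <-> exists g : 'S_n, t = s \o g.
Proof. by split => [/eqmodP/asboolP//|st]; exact/eqmodP/asboolP. Qed.

Lemma unorder_repr z : unorder (repr z) = z.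
Proof. exact: reprK. Qed.

Lemma unorder_continuous : continuous (unorder : tuples -> unordered).
Proof. exact: pi_continuous. Qed.

End def.

Section map.
Context {T U : topologicalType} (f : continuousType T U).

Definition unordered_map (z : unordered T) : unordered U :=
  unorder (f \o repr z).

Lemma unordered_mapE s : unordered_map (unorder s) = unorder (f \o s).
Proof.
apply/unorderP; have [g sE] : exists g : 'S_n, s = repr (unorder s) \o g.
  by apply/unorderP; rewrite unorder_repr.
by exists g; rewrite {1}sE.
Qed.

Let unordered_map_continuous : continuous unordered_map.
Proof.
apply/(@quotient_continuous _ {eq_quot (@reordering T)}).
have -> : unordered_map \o \pi_{eq_quot (@reordering T)} =
          @unorder U \o (fun s : 'I_n -> T => f \o s).
  by apply/funext => s; exact: unordered_mapE.
apply: (@continuous_compose {ptws 'I_n -> T} {ptws 'I_n -> U} (unordered U)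
  (fun s => f \o s) (@unorder U)); last exact: unorder_continuous.
move=> s.
have FF : Filter (fmap (fun s : {ptws 'I_n -> T} => (f \o s : {ptws 'I_n -> U}))
    (nbhs s)) by apply: fmap_filter; exact: nbhs_filter.
apply/cvg_sup => i.
pose ev := fun u : 'I_n -> U => u i.
have ci : continuous (fun s : {ptws 'I_n -> T} => f (s i)).
  apply: (@continuous_compose {ptws 'I_n -> T} T U (fun s => s i) f).
    exact: (@proj_continuous _ (fun=> T) i).
  exact: cts_fun.
have c : continuous (fun s : {ptws 'I_n -> T} => f \o s : initial_topology ev).
  exact: (@continuous_comp_initial _ {ptws 'I_n -> T} U ev
    (fun s => f \o s) ci).
exact: c.
Qed.

HB.instance Definition _ :=
  isContinuous.Build (unordered T) (unordered U) unordered_map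
    unordered_map_continuous.

End map.
End unordered_tuples.

Section rings.
Context {R : realType}.

(* The norm of the library on 'rV_n is the sup norm, hence the explicit
   Euclidean inner product *)
Definition dotp n (u v : 'rV[R]_n) : R := (u *m v^T) 0 0.

Lemma dotpE n (u v : 'rV[R]_n) : dotp u v = \sum_i u 0 i * v 0 i.
Proof. by rewrite /dotp mxE; apply: eq_bigr => i _; rewrite mxE. Qed.

Lemma dotpC n (u v : 'rV[R]_n) : dotp u v = dotp v u.
Proof. by rewrite !dotpE; apply: eq_bigr => i _; rewrite mulrC. Qed.

Lemma dotpDl n (u v w : 'rV[R]_n) : dotp (u + v) w = dotp u w + dotp v w.
Proof. by rewrite /dotp mulmxDl mxE. Qed.
Lemma dotpZl n (a : R) (u w : 'rV[R]_n) : dotp (a *: u) w = a * dotp u w.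
Proof. by rewrite /dotp -scalemxAl mxE. Qed.
Lemma dotpDr n (u v w : 'rV[R]_n) : dotp w (u + v) = dotp w u + dotp w v.
Proof. by rewrite dotpC dotpDl !(dotpC w). Qed.
Lemma dotpZr n (a : R) (u w : 'rV[R]_n) : dotp w (a *: u) = a * dotp w u.
Proof. by rewrite dotpC dotpZl dotpC. Qed.
Lemma dotpNl n (u w : 'rV[R]_n) : dotp (- u) w = - dotp u w.
Proof. by rewrite -scaleN1r dotpZl mulN1r. Qed.
Lemma dotpNr n (u w : 'rV[R]_n) : dotp w (- u) = - dotp w u.
Proof. by rewrite dotpC dotpNl dotpC. Qed.

Lemma dotp_ge0 n (u : 'rV[R]_n) : 0 <= dotp u u.
Proof. by rewrite dotpE sumr_ge0 // => i _; rewrite -expr2 sqr_ge0. Qed.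

Lemma dotp_eq0 n (u : 'rV[R]_n) : dotp u u = 0 -> u = 0.
Proof.
rewrite dotpE => /eqP.
rewrite psumr_eq0 => [|i _]; last by rewrite -expr2 sqr_ge0.
move=> /allP u0; apply/rowP => i; rewrite mxE; apply/eqP.
by have := u0 i (mem_index_enum _); rewrite mulf_eq0 orbb.
Qed.

(* (c, r, u) stands for the circle of center c and radius r in the plane through
   c normal to the unit vector u, oriented from u by the right-hand rule; this
   is a bijection onto oriented circles *)
Definition oriented_ring_data : set ('rV[R]_3 * R * 'rV[R]_3) :=
  [set d | 0 < d.1.2 /\ dotp d.2 d.2 = 1].

Definition oriented_ring : Type := oriented_ring_data.
HB.instance Definition _ := Topological.copy oriented_ring oriented_ring_data.

Definition ring_center (C : oriented_ring) : 'rV[R]_3 := (set_val C).1.1.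
Definition ring_radius (C : oriented_ring) : R := (set_val C).1.2.
Definition ring_normal (C : oriented_ring) : 'rV[R]_3 := (set_val C).2.

Lemma ring_radius_gt0 C : 0 < ring_radius C.
Proof. by have [] := set_valP C. Qed.

Lemma ring_normal_unit C : dotp (ring_normal C) (ring_normal C) = 1.
Proof. by have [] := set_valP C. Qed.

Definition oplane (C : oriented_ring) : set 'rV[R]_3 :=
  [set x | dotp (x - ring_center C) (ring_normal C) = 0].

Definition ocarrier (C : oriented_ring) : set 'rV[R]_3 :=
  [set x | dotp (x - ring_center C) (x - ring_center C) =
           ring_radius C ^+ 2] `&` oplane C.

Lemma orthogonal_neq0 (u : 'rV[R]_3) :
  exists2 v : 'rV[R]_3, v != 0 & dotp v u = 0.
Proof.
pose i0 : 'I_3 := 0; pose i1 : 'I_3 := lift ord0 0.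
have [u0|u0] := eqVneq (u 0 i0) 0.
  exists (delta_mx 0 i0); last first.
    by rewrite /dotp -rowE !mxE.
  by apply/eqP => /matrixP/(_ 0 i0)/eqP; rewrite !mxE !eqxx oner_eq0.
exists (u 0 i1 *: delta_mx 0 i0 - u 0 i0 *: delta_mx 0 i1).
  apply/eqP => /matrixP/(_ 0 i1)/eqP; rewrite !mxE /= mulr0 add0r mulr1.
  rewrite oppr_eq0.
  exact/negP.
rewrite dotpDl dotpNl !dotpZl /dotp -!rowE !mxE; ring.
Qed.

Lemma eq_ocarrier_half (C D : oriented_ring) : ocarrier C = ocarrier D ->
  let d := ring_center C - ring_center D in
  dotp d d + ring_radius C ^+ 2 = ring_radius D ^+ 2 /\
  forall v, dotp v (ring_normal C) = 0 -> dotp v (ring_normal D) = 0.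
Proof.
move=> CD d; have r0 := ring_radius_gt0 C.
have onD w : dotp w w = 1 -> dotp w (ring_normal C) = 0 ->
    dotp (d + ring_radius C *: w) (d + ring_radius C *: w) =
      ring_radius D ^+ 2 /\
    dotp (d + ring_radius C *: w) (ring_normal D) = 0.
  move=> w1 wn; have : ocarrier C (ring_center C + ring_radius C *: w).
    rewrite /ocarrier /oplane /= addrC addKr.
    by rewrite !dotpZl dotpZr w1 wn mulr0 mulr1 expr2.
  by rewrite CD /ocarrier /oplane /= /d addrAC => -[].
clearbody d.
have onD2 w : dotp w w = 1 -> dotp w (ring_normal C) = 0 ->
    dotp d d + ring_radius C ^+ 2 = ring_radius D ^+ 2 /\
    dotp w (ring_normal D) = 0.
  move=> w1 wn; have [e1 n1] := onD w w1 wn.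
  have [||e2 n2] := onD (- w); rewrite ?dotpNl ?dotpNr ?opprK ?wn ?oppr0 //.
  move: e1 e2 n1 n2; rewrite !scalerN.
  rewrite !(dotpDl, dotpDr, dotpNl, dotpNr, dotpZl, dotpZr) w1.
  rewrite (dotpC w d) => e1 e2 n1 n2; split; first by lra.
  have : ring_radius C * dotp w (ring_normal D) = 0 by lra.
  by move/eqP; rewrite mulf_eq0 gt_eqF //= => /eqP.
have unit_of (v : 'rV[R]_3) : v != 0 ->
    exists2 k, k != 0 & dotp (k *: v) (k *: v) = 1.
  move=> v0; have vv : 0 < dotp v v.
    rewrite lt_def dotp_ge0 andbT; apply: contra v0 => /eqP/dotp_eq0 ->.
    exact: eqxx.
  exists (Num.sqrt (dotp v v))^-1; first by rewrite invr_eq0 sqrtr_eq0 -ltNge.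
  rewrite dotpZl dotpZr mulrA -invfM -expr2 sqr_sqrtr ?mulVf ?gt_eqF //.
  exact: ltW.
split.
  have [v v0 vn] := orthogonal_neq0 (ring_normal C).
  have [k k0 kv] := unit_of v v0.
  by have [|] := onD2 (k *: v) kv; rewrite ?dotpZl ?vn ?mulr0.
move=> v vn; have [->|v0] := eqVneq v 0.
  by rewrite -(scale0r 0) dotpZl mul0r.
have [k k0 kv] := unit_of v v0.
have [|_] := onD2 (k *: v) kv; first by rewrite dotpZl vn mulr0.
by move/eqP; rewrite dotpZl mulf_eq0 (negbTE k0) => /eqP.
Qed.

Lemma eq_ocarrier (C D : oriented_ring) : ocarrier C = ocarrier D ->
  [/\ ring_center C = ring_center D, ring_radius C = ring_radius D &
      oplane C = oplane D].
Proof.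
move=> CD; have [e1 n1] := eq_ocarrier_half CD.
have [e2 n2] := eq_ocarrier_half (esym CD).
have d0 : ring_center C - ring_center D = 0.
  apply: dotp_eq0; move: e2; rewrite -opprB dotpNl dotpNr opprK => e2.
  by move: e1 e2; lra.
have cc : ring_center C = ring_center D by apply/eqP; rewrite -subr_eq0 d0.
split => //.
  move: e1; rewrite d0 -(scale0r 0) dotpZl mul0r add0r => /eqP.
  by rewrite eqrXn2 ?ltW ?ring_radius_gt0 // => /eqP.
rewrite /oplane cc; apply/seteqP; split => x /=; [exact: n1|exact: n2].
Qed.

(* A ring is a circle as a set of points. By [eq_ocarrier] this identifies
   exactly the triples with the same center, radius and plane, i.e. (c, r, u)
   and (c, r, - u), so the quotient topology on [round_ring] is the one given by
   centers, radii and planes *)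
Definition same_ring (C D : oriented_ring) : bool :=
  `[< ocarrier C = ocarrier D >].

Let same_ring_refl : reflexive same_ring.
Proof. by move=> C; apply/asboolP. Qed.
Let same_ring_sym : symmetric same_ring.
Proof. by move=> C D; apply/asboolP/asboolP => ->. Qed.
Let same_ring_trans : transitive same_ring.
Proof. by move=> C D E /asboolP CD /asboolP DE; apply/asboolP; rewrite CD. Qed.

Canonical same_ring_equiv :=
  EquivRel same_ring same_ring_refl same_ring_sym same_ring_trans.

Definition round_ring : Type := {eq_quot same_ring}.
HB.instance Definition _ := Quotient.on round_ring.
HB.instance Definition _ :=
  Topological.copy round_ring (quotient_topology {eq_quot same_ring}).

Definition forget_orientation (C : oriented_ring) : round_ring :=
  \pi_round_ring C.

Let forget_orientation_continuous : continuous forget_orientation.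
Proof. exact: pi_continuous. Qed.
HB.instance Definition _ :=
  isContinuous.Build oriented_ring round_ring forget_orientation
    forget_orientation_continuous.

Lemma forget_orientationP (C D : oriented_ring) :
  forget_orientation C = forget_orientation D <-> ocarrier C = ocarrier D.
Proof. by split => [/eqmodP/asboolP//|CD]; exact/eqmodP/asboolP. Qed.

Definition carrier (C : round_ring) : set 'rV[R]_3 := ocarrier (repr C).

Definition plane (C : round_ring) : set 'rV[R]_3 := oplane (repr C).

Lemma carrierE (C : oriented_ring) :
  carrier (forget_orientation C) = ocarrier C.
Proof. by apply/forget_orientationP; exact: reprK. Qed.

Lemma planeE (C : oriented_ring) : plane (forget_orientation C) = oplane C.
Proof. by have [] := eq_ocarrier (carrierE C). Qed.

Lemma carrier_inj : injective carrier.
Proof.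
by move=> C D CD; rewrite -[C]reprK -[D]reprK; exact/forget_orientationP.
Qed.

Definition unit_disk : set 'rV[R]_2 := [set v | dotp v v <= 1].
Definition unit_circle : set 'rV[R]_2 := [set v | dotp v v = 1].

(* D is an embedded closed disk with boundary A: a continuous injection on a
   compact space is an embedding *)
Definition bounds_disk (A D : set 'rV[R]_3) : Prop :=
  exists f : 'rV[R]_2 -> 'rV[R]_3,
    [/\ {within unit_disk, continuous f}, set_inj unit_disk f,
        f @` unit_disk = D & f @` unit_circle = A].

(* A and B are the components of a trivial link *)
Definition unlinked (A B : set 'rV[R]_3) : Prop :=
  exists D E, [/\ bounds_disk A D, bounds_disk B E & D `&` E = set0].

Definition disjoint_unlinked n (C : 'I_n -> round_ring) : Prop :=
  forall i j, i != j ->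
    carrier (C i) `&` carrier (C j) = set0 /\
    unlinked (carrier (C i)) (carrier (C j)).

Definition parallel_yz (C : round_ring) : Prop :=
  exists a, plane C = [set x | x 0 0 = a].

(* The rings of a member of [ring_configs n] are disjoint and nonempty, hence
   pairwise distinct *)
Definition ring_configs n : set (unordered n round_ring) :=
  [set z | exists2 C, z = unorder C & disjoint_unlinked C].
Arguments ring_configs n _ : clear implicits.

Definition parallel_ring_configs n : set (unordered n round_ring) :=
  ring_configs n `&`
  [set z | exists2 C, z = unorder C & forall i, parallel_yz (C i)].
Arguments parallel_ring_configs n _ : clear implicits.

(* Configurations of [ring_configs n] with an orientation of each ring *)
Definition oriented_ring_configs n : set (unordered n oriented_ring) :=
  unordered_map forget_orientation @^-1` ring_configs n.
Arguments oriented_ring_configs n _ : clear implicits.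

Definition e_x : 'rV[R]_3 := delta_mx 0 0.

Lemma e_x_unit : dotp e_x e_x = 1.
Proof. by rewrite /dotp -rowE !mxE !eqxx. Qed.

Lemma orient_x_subproof (C : oriented_ring) :
  oriented_ring_data (ring_center C, ring_radius C, e_x).
Proof. by split; [exact: ring_radius_gt0|exact: e_x_unit]. Qed.

Definition orient_ox (C : oriented_ring) : oriented_ring :=
  SigSub (mem_set (orient_x_subproof C)).

Definition orient_x (C : round_ring) : oriented_ring := orient_ox (repr C).

Lemma orient_xE C : orient_x (forget_orientation C) = orient_ox C.
Proof.
have [cc rr _] := eq_ocarrier (carrierE C).
by apply: val_inj; rewrite /= cc rr.
Qed.

Let orient_x_continuous : continuous orient_x.
Proof.
apply/(@quotient_continuous _ {eq_quot same_ring}).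
have -> : orient_x \o \pi_{eq_quot same_ring} = orient_ox.
  by apply/funext => C; exact: orient_xE.
apply: continuous_comp_initial.
have c : continuous (set_val : oriented_ring -> _) by exact: initial_continuous.
apply: (@continuous_pairing _ _ _
  (fun C => (ring_center C, ring_radius C)) (fun=> e_x)).
  apply: continuous_pairing.
    apply: (@continuous_compose _ _ _
      (fun C : oriented_ring => (set_val C).1) fst).
      apply: (@continuous_compose _ _ _ (set_val : oriented_ring -> _) fst c).
      by move=> ?; exact: cvg_fst.
    by move=> ?; exact: cvg_fst.
  apply: (@continuous_compose _ _ _
    (fun C : oriented_ring => (set_val C).1) snd).
    apply: (@continuous_compose _ _ _ (set_val : oriented_ring -> _) fst c).
    by move=> ?; exact: cvg_fst.
  by move=> ?; exact: cvg_snd.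
exact: cst_continuous.
Qed.
HB.instance Definition _ :=
  isContinuous.Build round_ring oriented_ring orient_x orient_x_continuous.

Lemma orient_xK C : parallel_yz C -> forget_orientation (orient_x C) = C.
Proof.
move=> [a Ca]; rewrite -{2}[C]reprK; apply/forget_orientationP.
move: Ca; rewrite /plane /orient_x; set D := repr C => Da.
suff E : oplane (orient_ox D) = oplane D by rewrite /ocarrier E.
rewrite Da; apply/seteqP.
have ac : ring_center D 0 0 = a.
  suff : oplane D (ring_center D) by rewrite Da.
  by rewrite /oplane /= subrr -(scale0r 0) dotpZl mul0r.
have xE x : dotp (x - ring_center D) e_x = x 0 0 - a.
  by rewrite dotpC /dotp -rowE !mxE ac.
split => x; rewrite /oplane /= xE; last by move->; rewrite subrr.
by move/eqP; rewrite subr_eq0 => /eqP.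
Qed.

Lemma forget_orient_x_unordered n z : parallel_ring_configs n z ->
  unordered_map forget_orientation (unordered_map orient_x z) = z.
Proof.
move=> [_ [C zC Cyz]]; rewrite zC !unordered_mapE; congr unorder.
by apply/funext => i /=; exact: orient_xK.
Qed.

Lemma parallel_orientation_subproof n :
  {homo unordered_map orient_x : z /
    parallel_ring_configs n z >-> oriented_ring_configs n z}.
Proof.
move=> z zP; rewrite /oriented_ring_configs /=.
by rewrite forget_orient_x_unordered //; case: zP.
Qed.

Definition parallel_orientation n :
    parallel_ring_configs n -> oriented_ring_configs n :=
  subspace_map (@parallel_orientation_subproof n).

HB.instance Definition _ n := Continuous.on (@parallel_orientation n).

Definition forget_orientations n :
    oriented_ring_configs n -> ring_configs n :=
  @subspace_map _ _ (oriented_ring_configs n) (ring_configs n)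
    (unordered_map forget_orientation) (fun _ => id).

HB.instance Definition _ n := Continuous.on (@forget_orientations n).

Lemma forget_parallel_orientation n (z : parallel_ring_configs n) :
  set_val (forget_orientations (parallel_orientation z)) = set_val z.
Proof. exact: forget_orient_x_unordered (set_valP z). Qed.

End rings.
Arguments ring_configs R n _ : clear implicits.
Arguments parallel_ring_configs R n _ : clear implicits.
Arguments oriented_ring_configs R n _ : clear implicits.
Arguments parallel_orientation R n _ : clear implicits.

(* Main.v *)
From HB Require Import structures.
Require Import Defs.
From mathcomp Require Import all_boot all_order all_algebra generic_quotient.
From mathcomp Require Import perm.
From mathcomp Require Import all_classical all_reals topology normedtype.
From mathcomp Require Import homotopy realfun derive.
From mathcomp Require Import ring lra.

Set Implicit Arguments.
Unset Strict Implicit.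
Unset Printing Implicit Defensive.

Import Order.TTheory GRing.Theory Num.Theory.
Import numFieldNormedType.Exports.

Local Open Scope classical_set_scope.
Local Open Scope ring_scope.

(* A ring is encoded by its center, the square of its radius and a unit normal,
   and spans a hemisphere in the upper half-space of dimension 4. Two rings are
   disjoint and unlinked if and only if their hemispheres are disjoint. If the
   hemispheres are disjoint, the flat disk of one ring and a hemisphere in the
   3-space on the other are disjoint. Conversely, if they meet over x, then a disk
   that is bounded by one ring and misses the other would yield a continuous square
   root of the identity of the circle. Disjointness of hemispheres makes sense for
   points (rings of radius zero), is an open condition and persists when all
   squared radii decrease by the same amount.

   Let A be the condition that all normals are e_x. By induction on the number of
   rings, the inclusion of the configurations in A into all configurations is an
   equivalence of fundamental groupoids. The smallest ring can be shrunk to a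
   point, so the configurations are covered by open sets whose finite
   intersections retract to configurations in which some rings have become points;
   subdividing paths and squares as in the van Kampen theorem reduces the claim to
   these. They are built from configurations of fewer rings by adding points with a
   normal: the normal moves in a simply connected sphere, and the position moves in
   the complement of the other rings and points, a fiber that similarities
   transport along paths and squares of configurations and that is the same with
   and without A. A loop or a homotopy of unordered configurations lifts to ordered
   ones, and one whose boundary is parallel can thus be made parallel. *)

(** * Continuity *)

(** Adding a point behaves like a fibration whose fiber is a sphere times the complement of the
    other rings and points, and the claim for it is a five lemma comparing the versions with and
    without [A]. This needs the group of the fiber to inject into that of the total space; the
    obstacle is the connecting map from the second homotopy group of the base. It vanishes because
    there is a section, a point placed beyond all rings, [far_point].

    Groupoids replace groups because the intersections of the cover come with neither connectedness
    nor base points. Everything is phrased as filling of squares, so that only paths and squares of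
    configurations are ever transported and no local triviality is required.

    Squared radii are the natural coordinate: in the plane of a ring, the squared height of its
    hemisphere over a point is minus the power of that point, so lowering all squared radii by the
    same amount cuts all hemispheres at a common height. A point keeps a unit normal so that all
    strata share the same coordinates; the sphere of normals, being simply connected, adds nothing
    to the groupoid. *)

Section continuity.
Context {R : realType}.

Lemma cont_id {X : topologicalType} : continuous (fun x : X => x).
Proof. by move=> x; exact: cvg_id. Qed.

Lemma cont_fst {X Y Z : topologicalType} (f : Z -> X * Y) :
  continuous f -> continuous (fun z => (f z).1).
Proof. by move=> cf; apply: (continuous_compose cf) => ?; exact: cvg_fst. Qed.

Lemma cont_snd {X Y Z : topologicalType} (f : Z -> X * Y) :
  continuous f -> continuous (fun z => (f z).2).
Proof. by move=> cf; apply: (continuous_compose cf) => ?; exact: cvg_snd. Qed.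

Lemma cont_add {X : topologicalType} {V : normedModType R} (f g : X -> V) :
  continuous f -> continuous g -> continuous (fun x => f x + g x).
Proof. by move=> cf cg x; apply: cvgD; [exact: cf|exact: cg]. Qed.

Lemma cont_opp {X : topologicalType} {V : normedModType R} (f : X -> V) :
  continuous f -> continuous (fun x => - f x).
Proof. by move=> cf x; apply: cvgN; exact: cf. Qed.

Lemma cont_scale {X : topologicalType} {V : normedModType R} (f : X -> R)
    (g : X -> V) :
  continuous f -> continuous g -> continuous (fun x => f x *: g x).
Proof. by move=> cf cg x; apply: cvgZ; [exact: cf|exact: cg]. Qed.

Lemma cont_mul {X : topologicalType} (f g : X -> R) :
  continuous f -> continuous g -> continuous (fun x => f x * g x).
Proof. by move=> cf cg x; apply: cvgM; [exact: cf|exact: cg]. Qed.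

Lemma cont_exp {X : topologicalType} (f : X -> R) k :
  continuous f -> continuous (fun x => f x ^+ k).
Proof.
move=> cf; elim: k => [|k ih].
  by under eq_fun do rewrite expr0; exact: cst_continuous.
by under eq_fun do rewrite exprS; exact: cont_mul.
Qed.

Lemma cont_inv {X : topologicalType} (f : X -> R) :
  (forall x, f x != 0) -> continuous f -> continuous (fun x => (f x)^-1).
Proof. by move=> f0 cf x; apply: cvgV => //; exact: cf. Qed.

Lemma cont_max {X : topologicalType} (f g : X -> R) :
  continuous f -> continuous g -> continuous (fun x => Num.max (f x) (g x)).
Proof. by move=> cf cg; move=> x; apply: continuous_max; [exact: cf|exact: cg]. Qed.

Lemma cont_min {X : topologicalType} (f g : X -> R) :
  continuous f -> continuous g -> continuous (fun x => Num.min (f x) (g x)).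
Proof. by move=> cf cg; move=> x; apply: continuous_min; [exact: cf|exact: cg]. Qed.

Lemma cont_norm {X : topologicalType} {V : normedModType R} (f : X -> V) :
  continuous f -> continuous (fun x => `|f x|).
Proof. by move=> cf x; apply: cvg_norm; exact: cf. Qed.

Lemma cont_sqrt {X : topologicalType} (f : X -> R) :
  continuous f -> continuous (fun x => Num.sqrt (f x)).
Proof. by move=> cf; apply: (continuous_compose cf); exact: sqrt_continuous. Qed.

Lemma cont_sum {X : topologicalType} {V : normedModType R} (J : Type)
    (r : seq J) (P : pred J) (f : J -> X -> V) :
  (forall j, continuous (f j)) -> continuous (fun x => \sum_(j <- r | P j) f j x).
Proof.
move=> cf; elim: r => [|j r ih].
  by under eq_fun do rewrite big_nil; exact: cst_continuous.
case Pj: (P j).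
  by under eq_fun do rewrite big_cons Pj; apply: cont_add.
by under eq_fun do rewrite big_cons Pj.
Qed.

(** Paths and squares below are maps on all of [R] and [R * R] that are constrained only on the unit
    interval and the unit square. Composing with this retraction makes the constraints hold
    everywhere. *)
Definition unitclamp (x : R) : R := Num.max 0 (Num.min x 1).

Lemma cont_clamp {X : topologicalType} (f : X -> R) :
  continuous f -> continuous (fun x => unitclamp (f x)).
Proof.
move=> cf; apply: cont_max; first exact: cst_continuous.
by apply: cont_min => //; exact: cst_continuous.
Qed.

Lemma unitclamp01 (x : R) : 0 <= unitclamp x <= 1.
Proof. by rewrite /unitclamp le_max lexx /= ge_max ler01 ge_min lexx orbT. Qed.

Lemma unit0 : 0 <= (0 : R) <= 1. Proof. by lra. Qed.
Lemma unit1 : 0 <= (1 : R) <= 1. Proof. by lra. Qed.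

Lemma unitclamp_id (x : R) : 0 <= x <= 1 -> unitclamp x = x.
Proof. by move=> /andP[x0 x1]; rewrite /unitclamp min_l // max_r. Qed.

Lemma unitclamp_le0 (x : R) : x <= 0 -> unitclamp x = 0.
Proof.
by move=> x0; rewrite /unitclamp max_l // ge_min x0.
Qed.

Lemma unitclamp_ge1 (x : R) : 1 <= x -> unitclamp x = 1.
Proof. by move=> x1; rewrite /unitclamp min_r // max_r. Qed.

Lemma unitclampK (x : R) : unitclamp (unitclamp x) = unitclamp x.
Proof. by rewrite unitclamp_id // unitclamp01. Qed.

(** Pasting over a finite closed cover: a piece that misses [x] also misses a neighborhood of
    [x]. *)
Lemma glue_continuous {X Y : topologicalType} (N : nat) (F : nat -> set X)
    (g : nat -> X -> Y) (f : X -> Y) :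
  (forall i, closed (F i)) -> (forall i, continuous (g i)) ->
  (forall x, exists2 i, (i < N)%N & F i x) ->
  (forall i x, F i x -> f x = g i x) -> continuous f.
Proof.
move=> cF cg cov fE x U nU.
have : \forall y \near x, forall i : 'I_N, F i y -> U (f y).
  apply: filter_forall => i; have [Fx|nFx] := pselect (F i x).
    have nx : nbhs x (fun y => U (g i y)).
      by apply: cg; move: nU; rewrite /= (fE i x Fx).
    by apply: filterS nx => y Ugy Fy; rewrite (fE i y Fy).
  have : nbhs x (~` F i).
    by apply: open_nbhs_nbhs; split => //; exact: closed_openC.
  by apply: filterS => y nFy /nFy.
apply: filterS => y Hy; have [i iN Fy] := cov y; exact: (Hy (Ordinal iN) Fy).
Qed.

Lemma glue_exists {X Y : topologicalType} (y0 : Y) (N : nat) (F : nat -> set X)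
    (g : nat -> X -> Y) :
  (forall i, closed (F i)) -> (forall i, continuous (g i)) ->
  (forall x, exists2 i, (i < N)%N & F i x) ->
  (forall i j x, (i < j)%N -> F i x -> F j x -> g i x = g j x) ->
  exists f, continuous f /\ forall i x, F i x -> f x = g i x.
Proof.
move=> cF cg cov ov.
have /choice[k kP] : forall x, exists i, F i x.
  by move=> x; have [i _ ?] := cov x; exists i.
have fE i x : F i x -> g (k x) x = g i x.
  move=> Fx; case: (ltngtP (k x) i) => [ki|ik|-> //]; first exact: ov.
  by apply/esym; apply: ov.
exists (fun x => g (k x) x); split => //.
exact: (glue_continuous cF cg cov).
Qed.

Lemma le_closed {X : topologicalType} (f g : X -> R) :
  continuous f -> continuous g -> closed [set x | f x <= g x].
Proof.
move=> cf cg.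
have -> : [set x | f x <= g x] = (fun x => g x - f x) @^-1` [set y | 0 <= y].
  by apply/seteqP; split => x /=; rewrite subr_ge0.
apply: preimage_closed; last exact: closed_ge.
by move=> x _; apply: cont_add => //; exact: cont_opp.
Qed.

Lemma lt_open {X : topologicalType} (f g : X -> R) :
  continuous f -> continuous g -> open [set x | f x < g x].
Proof.
move=> cf cg; have -> : [set x | f x < g x] = ~` [set x | g x <= f x].
  by apply/seteqP; split => x /=; rewrite ltNge => /negP.
by apply: closed_openC; exact: le_closed.
Qed.

Lemma neq_open {X : topologicalType} (f g : X -> R) :
  continuous f -> continuous g -> open [set x | f x != g x].
Proof.
move=> cf cg; have -> : [set x | f x != g x] = [set x | f x < g x] `|` [set x | g x < f x].
  by apply/seteqP; split => x /=; rewrite neq_lt; [case/orP; [left|right]|case=> ->; rewrite ?orbT].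
by apply: openU; exact: lt_open.
Qed.

End continuity.

Ltac cont_step :=
  match goal with |- forall x, continuous_at x ?F =>
    lazymatch F with
    | fun _ => ?c => exact: cst_continuous
    | fun x => x => exact: cont_id
    | fun x => fst (@?f x) => apply: cont_fst
    | fun x => snd (@?f x) => apply: cont_snd
    | fun x => unitclamp (@?f x) => apply: cont_clamp
    | fun x => (@?f x, @?g x) => apply: continuous_pairing
    | fun x => Order.max (@?f x) (@?g x) => apply: cont_max
    | fun x => Order.min (@?f x) (@?g x) => apply: cont_min
    | fun x => GRing.mul (@?f x) (@?g x) => apply: cont_mul
    | fun x => GRing.scale (@?f x) (@?g x) => apply: cont_scale
    | fun x => Algebra.opp (@?f x) => apply: cont_opp
    | fun x => Algebra.add (@?f x) (@?g x) => apply: cont_add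
    | fun x => Num.norm (@?f x) => apply: cont_norm
    | fun x => Num.sqrt (@?f x) => apply: cont_sqrt
    | fun x => GRing.exp (@?f x) _ => apply: cont_exp
    | GRing.mul ?c => refine (@cont_mul _ _ (fun=> c) (fun x => x) _ _)
    | Algebra.add ?c => refine (@cont_add _ _ _ (fun=> c) (fun x => x) _ _)
    | Algebra.opp => refine (@cont_opp _ _ _ (fun x => x) _)
    | pair ?c => refine (@continuous_pairing _ _ _ (fun=> c) (fun x => x) _ _)
    | fst => refine (@cont_fst _ _ _ (fun x => x) _)
    | snd => refine (@cont_snd _ _ _ (fun x => x) _)
    | unitclamp => refine (@cont_clamp _ _ (fun x => x) _)
    | fun x => ?G x =>
        match goal with H : forall x, continuous_at x G |- _ => exact: H end
    | _ => match goal with H : forall x, continuous_at x F |- _ => exact: H end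
    end
  end.
Ltac cont := repeat cont_step.

(** * Paths and squares *)

Section squares.
Context {R : realType}.

Definition usq (z : R * R) : bool := (0 <= z.1 <= 1) && (0 <= z.2 <= 1).

Definition frame (z : R * R) : Prop :=
  usq z /\ [\/ z.1 = 0, z.1 = 1, z.2 = 0 | z.2 = 1].

Context {V : topologicalType}.
Implicit Types (X Y A : set V) (H D : R * R -> V) (p q : R -> V).

Definition path_in X p := continuous p /\ forall t : R, 0 <= t <= 1 -> X (p t).

Definition square_in X H := continuous H /\ forall z, usq z -> X (H z).

Lemma path_inS X Y p : X `<=` Y -> path_in X p -> path_in Y p.
Proof. by move=> XY [cp pX]; split => // t /pX/XY. Qed.

Lemma square_inS X Y H : X `<=` Y -> square_in X H -> square_in Y H.
Proof. by move=> XY [cH HX]; split => // t /HX/XY. Qed.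

Lemma square_comp X H (f g : R * R -> R) : square_in X H ->
  continuous f -> continuous g -> 
  square_in X (fun z => H (unitclamp (f z), unitclamp (g z))).
Proof.
move=> [cH HX] cf cg; split.
  by apply: continuous_compose cH; cont.
by move=> z _; apply: HX; rewrite /usq /= !unitclamp01.
Qed.

Definition pcat p q : R -> V :=
  fun s => if s <= 2^-1 then p (2 * s) else q (2 * s - 1).

Lemma pcat_continuous p q : continuous p -> continuous q -> p 1 = q 0 ->
  continuous (pcat p q).
Proof.
move=> cp cq pq; apply: paste_continuous; first exact: cont_id.
- by apply: continuous_compose cp; cont.
- by apply: continuous_compose cq; cont.
- by move=> x ->; rewrite divff ?subrr // pnatr_eq0.
Qed.

Lemma pcat0 p q : pcat p q 0 = p 0.
Proof. by rewrite /pcat invr_ge0 ler0n mulr0. Qed.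

Lemma pcat1 p q : pcat p q 1 = q 1.
Proof.
rewrite /pcat ifF; first by congr q; lra.
by apply/negbTE; rewrite -ltNge; lra.
Qed.

Lemma pcatl p q s : s <= 2^-1 -> pcat p q s = p (2 * s).
Proof. by rewrite /pcat => ->. Qed.

Lemma pcatr p q s : 2^-1 <= s -> p 1 = q 0 -> pcat p q s = q (2 * s - 1).
Proof.
move=> s2 pq; rewrite /pcat; case: ifP => // s2'.
have -> : s = 2^-1 by apply/eqP; rewrite eq_le s2 s2'.
by rewrite divff ?subrr // pnatr_eq0.
Qed.

Lemma pcat_in X p q : path_in X p -> path_in X q -> p 1 = q 0 ->
  path_in X (pcat p q).
Proof.
move=> [cp pX] [cq qX] pq; split; first exact: pcat_continuous.
move=> t t01; rewrite /pcat; case: ifP => t2; first by apply: pX; lra.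
by apply: qX; move: t2 => /negbT; rewrite -ltNge; lra.
Qed.

Definition hcat H1 H2 : R * R -> V := fun z =>
  if z.1 <= 2^-1 then H1 (2 * z.1, unitclamp z.2)
  else H2 (2 * z.1 - 1, unitclamp z.2).

Definition vcat H1 H2 : R * R -> V := fun z =>
  if z.2 <= 2^-1 then H1 (unitclamp z.1, 2 * z.2)
  else H2 (unitclamp z.1, 2 * z.2 - 1).

Lemma hcat_in X H1 H2 : square_in X H1 -> square_in X H2 ->
  (forall t : R, 0 <= t <= 1 -> H1 (1, t) = H2 (0, t)) ->
  square_in X (hcat H1 H2).
Proof.
move=> [c1 H1X] [c2 H2X] H12; split.
  apply: paste_continuous; first by cont.
  - by apply: continuous_compose c1; cont.
  - by apply: continuous_compose c2; cont.
  - by move=> x ->; rewrite divff ?subrr ?H12 // ?unitclamp01 // pnatr_eq0.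
move=> [s t] /andP[/= s01 t01]; rewrite /hcat /=.
case: ifP => [s2|/negbT]; last rewrite -ltNge => s2.
  by apply: H1X; rewrite /usq /= unitclamp01 andbT; lra.
by apply: H2X; rewrite /usq /= unitclamp01 andbT; lra.
Qed.

Lemma vcat_in X H1 H2 : square_in X H1 -> square_in X H2 ->
  (forall t : R, 0 <= t <= 1 -> H1 (t, 1) = H2 (t, 0)) ->
  square_in X (vcat H1 H2).
Proof.
move=> [c1 H1X] [c2 H2X] H12; split.
  apply: paste_continuous; first by cont.
  - by apply: continuous_compose c1; cont.
  - by apply: continuous_compose c2; cont.
  - by move=> x ->; rewrite divff ?subrr ?H12 // ?unitclamp01 // pnatr_eq0.
move=> [s t] /andP[/= s01 t01]; rewrite /vcat /=.
case: ifP => [t2|/negbT]; last rewrite -ltNge => t2.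
  by apply: H1X; rewrite /usq /= unitclamp01 /=; lra.
by apply: H2X; rewrite /usq /= unitclamp01 /=; lra.
Qed.

(** The bilinearly blended Coons patch: the two ruled interpolations are added and the bilinear
    interpolation of the corners is subtracted. It restricts to the four given functions on the
    sides as soon as these agree at the corners. *)
Definition coons (b t l r : R -> R) (z : R * R) : R :=
  (1 - z.2) * b z.1 + z.2 * t z.1 + (1 - z.1) * l z.2 + z.1 * r z.2
  - ((1 - z.1) * (1 - z.2) * b 0 + z.1 * (1 - z.2) * b 1
     + (1 - z.1) * z.2 * t 0 + z.1 * z.2 * t 1).

Lemma coons_continuous b t l r : continuous b -> continuous t ->
  continuous l -> continuous r -> continuous (coons b t l r).
Proof.
move=> cb ct cl cr; rewrite /coons.
have c1 (f : R -> R) : continuous f -> continuous (fun z : R * R => f z.1).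
  by move=> cf; apply: continuous_compose cf; cont.
have c2 (f : R -> R) : continuous f -> continuous (fun z : R * R => f z.2).
  by move=> cf; apply: continuous_compose cf; cont.
cont; first [exact: c1|exact: c2].
Qed.

(* Any loop factoring through a square bounds: the square is convex. *)
Lemma reshape X D (b t l r : R -> R * R) : square_in X D ->
  continuous b -> continuous t -> continuous l -> continuous r ->
  (forall s : R, 0 <= s <= 1 -> [/\ usq (b s), usq (t s), usq (l s) & usq (r s)]) ->
  b 0 = l 0 -> b 1 = r 0 -> t 0 = l 1 -> t 1 = r 1 ->
  exists2 E, square_in X E & forall s : R, 0 <= s <= 1 ->
    [/\ E (s, 0) = D (b s), E (s, 1) = D (t s),
        E (0, s) = D (l s) & E (1, s) = D (r s)].
Proof.
move=> DX cb ct cl cr usqs bl br tl tr.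
pose f1 := coons (fun s => (b s).1) (fun s => (t s).1)
                 (fun s => (l s).1) (fun s => (r s).1).
pose f2 := coons (fun s => (b s).2) (fun s => (t s).2)
                 (fun s => (l s).2) (fun s => (r s).2).
exists (fun z => D (unitclamp (f1 z), unitclamp (f2 z))).
  by apply: square_comp => //; apply: coons_continuous; cont.
have DE w z : usq w -> f1 z = w.1 -> f2 z = w.2 ->
    D (unitclamp (f1 z), unitclamp (f2 z)) = D w.
  by case: w => w1 w2 /andP[/= ? ?] -> ->; rewrite !unitclamp_id.
move=> s s01; have [ub ut ul ur] := usqs s s01.
by split; apply: DE => //; rewrite /f1 /f2 /coons /= ?bl ?br ?tl ?tr; ring.
Qed.

(** A path is a square that does not depend on its second coordinate. *)
Lemma reshape_path X p (b t l r : R -> R) : path_in X p ->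
  continuous b -> continuous t -> continuous l -> continuous r ->
  (forall s : R, 0 <= s <= 1 ->
     [/\ 0 <= b s <= 1, 0 <= t s <= 1, 0 <= l s <= 1 & 0 <= r s <= 1]) ->
  b 0 = l 0 -> b 1 = r 0 -> t 0 = l 1 -> t 1 = r 1 ->
  exists2 E, square_in X E & forall s : R, 0 <= s <= 1 ->
    [/\ E (s, 0) = p (b s), E (s, 1) = p (t s),
        E (0, s) = p (l s) & E (1, s) = p (r s)].
Proof.
move=> [cp pX] cb ct cl cr bnd bl br tl tr.
have DX : square_in X (fun z => p z.1).
  split; first by apply: continuous_compose cp; cont.
  by move=> z /andP[? _]; exact: pX.
have [|||||||||E EX EE] := reshape (b := fun s => (b s, 0))
    (t := fun s => (t s, 0)) (l := fun s => (l s, 0)) (r := fun s => (r s, 0)) DX.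
- by cont.
- by cont.
- by cont.
- by cont.
- by move=> s /bnd[? ? ? ?]; rewrite /usq /= lexx ler01 !andbT.
- by rewrite bl.
- by rewrite br.
- by rewrite tl.
- by rewrite tr.
by exists E.
Qed.

(** A shrunken copy of [h] fills the concentric square of half the size, and each of the four
    trapezoids around it carries one of the other squares. In centered coordinates with maximum norm
    [m], a trapezoid is parametrized by the radial projection to the outer side and by
    [2 * m - 1]. *)
Lemma collar X h Db Dt Dl Dr : square_in X h -> square_in X Db ->
  square_in X Dt -> square_in X Dl -> square_in X Dr ->
  (forall s : R, 0 <= s <= 1 -> [/\ Db (s, 0) = h (s, 0), Dt (s, 0) = h (s, 1),
     Dl (s, 0) = h (0, s) & Dr (s, 0) = h (1, s)]) ->
  (forall s : R, 0 <= s <= 1 -> [/\ Db (0, s) = Dl (0, s), Db (1, s) = Dr (0, s),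
     Dt (0, s) = Dl (1, s) & Dt (1, s) = Dr (1, s)]) ->
  exists2 B, square_in X B & forall s : R, 0 <= s <= 1 ->
    [/\ B (s, 0) = Db (s, 1), B (s, 1) = Dt (s, 1),
        B (0, s) = Dl (s, 1) & B (1, s) = Dr (s, 1)].
Proof.
move=> hX bX tX lX rX side corner.
have a1 (a b : R) : a = - b -> a = 2^-1 -> b + 2^-1 = 0 by lra.
have a2 (a b : R) : a = b -> a = 2^-1 -> b + 2^-1 = 1 by lra.
have a3 (a : R) : a = 2^-1 -> 2 * a - 1 = 0 by lra.
have a4 (a b : R) : a = - b -> a = b -> a = 0 by lra.
have half (a : R) : (a * 2 + 1) / 2 = a + 2^-1 by lra.
have o2 : (1 + 1) / 2 = 1 :> R by lra.
pose x (z : R * R) : R := 2 * z.1 - 1.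
pose y (z : R * R) : R := 2 * z.2 - 1.
have cx : continuous x by rewrite /x; cont.
have cy : continuous y by rewrite /y; cont.
pose m z : R := Num.max `|x z| `|y z|.
have cm : continuous m by rewrite /m; cont.
(* The truncation keeps the inverse of [m] continuous at the center and has no effect on the
   trapezoids. *)
pose M z : R := (Num.max (m z) 2^-1)^-1.
have cM : continuous M.
  apply: cont_inv; last by cont.
  by move=> z; rewrite gt_eqF // lt_max invr_gt0 ltr0n orbT.
pose g (i : nat) : R * R -> V := match i with
  | 0 => fun z => h (unitclamp (x z + 2^-1), unitclamp (y z + 2^-1))
  | 1 => fun z => Db (unitclamp ((x z * M z + 1) / 2), unitclamp (2 * m z - 1))
  | 2 => fun z => Dt (unitclamp ((x z * M z + 1) / 2), unitclamp (2 * m z - 1))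
  | 3 => fun z => Dl (unitclamp ((y z * M z + 1) / 2), unitclamp (2 * m z - 1))
  | _ => fun z => Dr (unitclamp ((y z * M z + 1) / 2), unitclamp (2 * m z - 1))
  end.
pose F (i : nat) : set (R * R) := match i with
  | 0 => [set z | m z <= 2^-1]
  | 1 => [set z | 2^-1 <= m z] `&` [set z | `|x z| <= - y z]
  | 2 => [set z | 2^-1 <= m z] `&` [set z | `|x z| <= y z]
  | 3 => [set z | 2^-1 <= m z] `&` [set z | `|y z| <= - x z]
  | 4 => [set z | 2^-1 <= m z] `&` [set z | `|y z| <= x z]
  | _ => set0 end.
have gX i : square_in X (g i).
  by case: i => [|[|[|[|i]]]]; apply: square_comp => //; cont.
have cF i : closed (F i).
  by case: i => [|[|[|[|[|i]]]]]; rewrite /F /=;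
    first [exact: closed0|apply: closedI; apply: le_closed; cont
          |apply: le_closed; cont].
have cov z : exists2 i, (i < 5)%N & F i z.
  have [m2|/ltW m2] := leP (m z) 2^-1; first by exists 0%N.
  have [xy|yx] := leP `|x z| `|y z|.
    have [y0|y0] := leP 0 (y z).
      by exists 2%N => //; split => //=; rewrite (ger0_norm y0) in xy.
    by exists 1%N => //; split => //=; rewrite (ltr0_norm y0) in xy.
  have [x0|x0] := leP 0 (x z).
    by exists 4%N => //; split => //=; rewrite (ger0_norm x0) in yx; exact: ltW.
  by exists 3%N => //; split => //=; rewrite (ltr0_norm x0) in yx; exact: ltW.
have ME z : 2^-1 <= m z -> M z = (m z)^-1 by rewrite /M => /max_l ->.
have m0 z : 2^-1 <= m z -> m z != 0.
  by move=> mz; rewrite gt_eqF // (lt_le_trans _ mz) // invr_gt0 ltr0n.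
have M2 z : 2^-1 <= m z -> m z <= 2^-1 -> m z = 2^-1 /\ M z = 2.
  by move=> m1 m2; rewrite ME // (le_anti (introT andP (conj m2 m1))) invrK.
have F1 z : F 1 z -> m z = - y z.
  move=> [_ /= xy]; have y0 : y z <= 0 by rewrite -oppr_ge0 (le_trans _ xy).
  by rewrite /m (ler0_norm y0) max_r.
have F2 z : F 2 z -> m z = y z.
  move=> [_ /= xy]; have y0 : 0 <= y z by rewrite (le_trans _ xy).
  by rewrite /m (ger0_norm y0) max_r.
have F3 z : F 3 z -> m z = - x z.
  move=> [_ /= xy]; have y0 : x z <= 0 by rewrite -oppr_ge0 (le_trans _ xy).
  by rewrite /m (ler0_norm y0) max_l.
have F4 z : F 4 z -> m z = x z.
  move=> [_ /= xy]; have y0 : 0 <= x z by rewrite (le_trans _ xy).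
  by rewrite /m (ger0_norm y0) max_l.
have cl0 (e : R) : e = 0 -> unitclamp e = 0.
  by move=> ->; rewrite unitclamp_le0.
have cl1 (e : R) : e = 1 -> unitclamp e = 1.
  by move=> ->; rewrite unitclamp_ge1.
have sM e z : 2^-1 <= m z -> m z = - e -> unitclamp ((e * M z + 1) / 2) = 0.
  move=> mz em; apply: cl0; rewrite ME // em invrN mulrN divff ?addNr ?mul0r //.
  by rewrite -oppr_eq0 -em m0.
have sP e z : 2^-1 <= m z -> m z = e -> unitclamp ((e * M z + 1) / 2) = 1.
  by move=> mz em; apply: cl1; rewrite ME // -em divff ?m0.
have c01 := @unitclamp01 R.
have ov i j z : (i < j)%N -> F i z -> F j z -> g i z = g j z.
  case: i j => [|[|[|[|[|i]]]]] [|[|[|[|[|j]]]]] //= _.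
  - move=> z0 zF; have [/F1 e [z2 _]] := (zF, zF).
    have [m2 ->] := M2 z z2 z0; rewrite half (cl0 _ (a3 _ m2)).
    by rewrite (cl0 _ (a1 _ _ e m2)); have [->] := side _ (c01 (x z + 2^-1)).
  - move=> z0 zF; have [/F2 e [z2 _]] := (zF, zF).
    have [m2 ->] := M2 z z2 z0; rewrite half (cl0 _ (a3 _ m2)).
    by rewrite (cl1 _ (a2 _ _ e m2)); have [_ ->] := side _ (c01 (x z + 2^-1)).
  - move=> z0 zF; have [/F3 e [z2 _]] := (zF, zF).
    have [m2 ->] := M2 z z2 z0; rewrite half (cl0 _ (a3 _ m2)).
    by rewrite (cl0 _ (a1 _ _ e m2)); have [_ _ ->] := side _ (c01 (y z + 2^-1)).
  - move=> z0 zF; have [/F4 e [z2 _]] := (zF, zF).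
    have [m2 ->] := M2 z z2 z0; rewrite half (cl0 _ (a3 _ m2)).
    by rewrite (cl1 _ (a2 _ _ e m2)); have [_ _ _ ->] := side _ (c01 (y z + 2^-1)).
  (* Opposite trapezoids could meet only at the center, which belongs to neither. *)
  - by move=> zF zG; have /eqP[] := m0 z zF.1; apply: a4 (F1 z zF) (F2 z zG).
  - move=> zF zG; rewrite (sM (x z)) ?(sM (y z)) //; try exact: zF.1.
    + by have [->] := corner _ (c01 (2 * m z - 1)).
    + exact: F1.
    + exact: F3.
  - move=> zF zG; rewrite (sP (x z)) ?(sM (y z)) //; try exact: zF.1.
    + by have [_ ->] := corner _ (c01 (2 * m z - 1)).
    + exact: F1.
    + exact: F4.
  - move=> zF zG; rewrite (sM (x z)) ?(sP (y z)) //; try exact: zF.1.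
    + by have [_ _ ->] := corner _ (c01 (2 * m z - 1)).
    + exact: F2.
    + exact: F3.
  - move=> zF zG; rewrite (sP (x z)) ?(sP (y z)) //; try exact: zF.1.
    + by have [_ _ _ ->] := corner _ (c01 (2 * m z - 1)).
    + exact: F2.
    + exact: F4.
  - by move=> zF zG; have /eqP[] := m0 z zF.1; apply: a4 (F3 z zF) (F4 z zG).
have [|B [cB BE]] := glue_exists (h (0, 0)) cF _ cov ov.
  by move=> i; have [] := gX i.
exists B.
  split => // z uz; have [i _ Fz] := cov z.
  by rewrite (BE i z Fz); have [_ gi] := gX i; exact: gi.
have sv (d : R * R -> V) (s : R) (e1 e2 : R) : 0 <= s <= 1 ->
    e1 = s -> e2 = 1 -> d (unitclamp e1, unitclamp e2) = d (s, 1).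
  by move=> s01 -> ->; rewrite (unitclamp_id s01) cl1.
have n1 (s : R) : 0 <= s <= 1 -> `|2 * s - 1| <= 1.
  by clear; rewrite ler_norml; lra.
have n0 : `|2 * 0 - 1| = 1 :> R by rewrite mulr0 sub0r normrN normr1.
have n2 : `|2 * 1 - 1| = 1 :> R by rewrite mulr1 addrK normr1.
have e3 (s : R) : ((2 * s - 1) * 1 + 1) / 2 = s by clear; lra.
have e4 : 2 * 1 - 1 = 1 :> R by rewrite mulr1 addrK.
have e5 : 2^-1 <= 1 :> R by clear; lra.
have M1 z : m z = 1 -> M z = 1 by move=> mz; rewrite ME mz ?invr1.
move=> s s01; have s1 := n1 s s01; split.
- have mz : m (s, 0) = 1 by rewrite /m /x /y /= n0 max_r.
  have Fz : F 1%N (s, 0).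
    by split; rewrite /= ?mz // /x /y /= mulr0 sub0r opprK.
  by rewrite (BE _ _ Fz) /=; apply: sv; rewrite ?(M1 _ mz) ?mz // /x /= e3.
- have mz : m (s, 1) = 1 by rewrite /m /x /y /= n2 max_r.
  have Fz : F 2%N (s, 1).
    by split; rewrite /= ?mz // /x /y /= e4.
  by rewrite (BE _ _ Fz) /=; apply: sv; rewrite ?(M1 _ mz) ?mz // /x /= e3.
- have mz : m (0, s) = 1 by rewrite /m /x /y /= n0 max_l.
  have Fz : F 3%N (0, s).
    by split; rewrite /= ?mz // /x /y /= mulr0 sub0r opprK.
  by rewrite (BE _ _ Fz) /=; apply: sv; rewrite ?(M1 _ mz) ?mz // /y /= e3.
- have mz : m (1, s) = 1 by rewrite /m /x /y /= n2 max_l.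
  have Fz : F 4%N (1, s).
    by split; rewrite /= ?mz // /x /y /= e4.
  by rewrite (BE _ _ Fz) /=; apply: sv; rewrite ?(M1 _ mz) ?mz // /y /= e3.
Qed.

End squares.

(** * Pairs with equivalent fundamental groupoids *)

Section good_pairs.
Context {R : realType} {V : topologicalType}.
Implicit Types (X Y A : set V) (H D : R * R -> V) (p q : R -> V).

(** For the functor between fundamental groupoids, the next three properties are essential
    surjectivity, fullness and faithfulness. In the second one the ends of the path may move inside
    [A]: following their tracks as well gives a homotopy with fixed ends to a path in [A]. *)
Definition reaches X A := forall x, X x ->
  exists p, [/\ path_in X p, p 0 = x & A (p 1)].

Definition compresses_paths X A := forall p, path_in X p ->
  A (p 0) -> A (p 1) -> exists H, [/\ square_in X H,
    forall s : R, 0 <= s <= 1 -> H (s, 0) = p s,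
    forall s : R, 0 <= s <= 1 -> A (H (s, 1)) &
    forall t : R, 0 <= t <= 1 -> A (H (0, t)) /\ A (H (1, t))].

Definition compresses_squares X A := forall H, square_in X H ->
  (forall z, frame z -> A (H z)) ->
  exists K, square_in (X `&` A) K /\ forall z, frame z -> K z = H z.

(* The inclusion of [X `&` A] in [X] is an equivalence of fundamental
   groupoids. *)
Definition good X A :=
  [/\ reaches X A, compresses_paths X A & compresses_squares X A].

Lemma frameP (P : R * R -> Prop) :
  (forall s : R, 0 <= s <= 1 -> [/\ P (s, 0), P (s, 1), P (0, s) & P (1, s)]) <->
  (forall z, frame z -> P z).
Proof.
split => [HP [s t] [/andP[/= s01 t01]] | HP s s01].
  by case=> /= ->; [have [] := HP t t01|have [] := HP t t01|
    have [] := HP s s01|have [] := HP s s01].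
have e0 : 0 <= (0 : R) <= 1 by clear; lra.
have e1 : 0 <= (1 : R) <= 1 by clear; lra.
split; apply: HP; split; rewrite /usq /= ?s01 ?e0 ?e1 //.
- exact: Or43.
- exact: Or44.
- exact: Or41.
- exact: Or42.
Qed.

Lemma frame_usq (z : R * R) : frame z -> usq z.
Proof. by case. Qed.

Definition clamp2 (z : R * R) : R * R := (unitclamp z.1, unitclamp z.2).

Lemma clamp2_usq z : usq (clamp2 z).
Proof. by rewrite /usq !unitclamp01. Qed.

Lemma clamp2_id z : usq z -> clamp2 z = z.
Proof. by case: z => s t /andP[/= ? ?]; rewrite /clamp2 !unitclamp_id. Qed.

Lemma clamp2_continuous : continuous clamp2.
Proof. by rewrite /clamp2; cont. Qed.

Lemma square_clamp X H : square_in X H -> square_in X (H \o clamp2).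
Proof. by move=> HX; apply: square_comp => //; cont. Qed.

Definition flip D : R * R -> V := fun z => D (z.1, 1 - z.2).

Lemma flip_in X D : square_in X D -> square_in X (flip D).
Proof.
move=> [cD DX]; split; first by apply: continuous_compose cD; cont.
by move=> z /andP[z1 z2]; apply: DX; rewrite /usq /= z1 /=; lra.
Qed.

(* To fill [H] in [A] one may first slide its boundary inside [A]. *)
Lemma refill X A H Db Dt Dl Dr : square_in X H -> square_in (X `&` A) Db ->
  square_in (X `&` A) Dt -> square_in (X `&` A) Dl -> square_in (X `&` A) Dr ->
  (forall s : R, 0 <= s <= 1 -> [/\ Db (s, 0) = H (s, 0), Dt (s, 0) = H (s, 1),
     Dl (s, 0) = H (0, s) & Dr (s, 0) = H (1, s)]) ->
  (forall s : R, 0 <= s <= 1 -> [/\ Db (0, s) = Dl (0, s), Db (1, s) = Dr (0, s),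
     Dt (0, s) = Dl (1, s) & Dt (1, s) = Dr (1, s)]) ->
  (forall B, square_in X B -> (forall s : R, 0 <= s <= 1 ->
    [/\ B (s, 0) = Db (s, 1), B (s, 1) = Dt (s, 1),
        B (0, s) = Dl (s, 1) & B (1, s) = Dr (s, 1)]) ->
    exists K, square_in (X `&` A) K /\ forall z, frame z -> K z = B z) ->
  exists K, square_in (X `&` A) K /\ forall z, frame z -> K z = H z.
Proof.
move=> HX bA tA lA rA side corner fill.
have sX D : square_in (X `&` A) D -> square_in X D.
  by apply: square_inS; exact: subIsetl.
have [B BX BE] := collar HX (sX _ bA) (sX _ tA) (sX _ lA) (sX _ rA) side corner.
have [K [KA KE]] := fill B BX BE.
have KE' := (frameP (fun z => K z = B z)).2 KE.
(* The reversed collars lead from the slid boundary back to that of [H], now inside [A]. *)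
have [||L LA LE] := collar KA (flip_in bA) (flip_in tA) (flip_in lA)
    (flip_in rA).
- move=> s s01; have [-> -> -> ->] := KE' s s01.
  by have [-> -> -> ->] := BE s s01; rewrite /flip /= subr0.
- move=> s s01; rewrite /flip /=; apply: corner; lra.
exists L; split => //; apply/frameP => s s01.
have [-> -> -> ->] := LE s s01; rewrite /flip /= subrr.
exact: side.
Qed.

(** Reduction to squares that are constant on their top and right sides, with value in [S]. A path
    from the corner [(1, 1)] to [S] is appended; the top and right sides are contracted along
    themselves and this path to its end, while the bottom and left sides are prolonged to run
    through them. *)
Lemma compresses_squares_base X A (S : set V) :
  (forall a, X a -> A a -> exists c : R -> V, [/\ path_in (X `&` A) c, c 0 = a & S (c 1)]) ->
  (forall H, square_in X H -> (forall z, frame z -> A (H z)) -> S (H (1, 1)) ->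
    (forall s : R, 0 <= s <= 1 -> H (s, 1) = H (1, 1) /\ H (1, s) = H (1, 1)) ->
    exists K, square_in (X `&` A) K /\ forall z, frame z -> K z = H z) ->
  compresses_squares X A.
Proof.
move=> toS fill H HX HA; have [cH HX'] := HX.
have u11 : usq ((1, 1) : R * R) by rewrite /usq /= lexx ler01.
have f11 : frame ((1, 1) : R * R) by split => //; exact: Or42.
have [c [cA c0 c1]] := toS (H (1, 1)) (HX' _ u11) (HA _ f11).
have HA' := (frameP (fun z => A (H z))).2 HA.
have c01 := @unitclamp01 R.
have e0 : 0 <= (0 : R) <= 1 by clear; lra.
have e1 : 0 <= (1 : R) <= 1 by clear; lra.
have side (f g : R -> R) : continuous f -> continuous g ->
    (forall s, frame (unitclamp (f s), unitclamp (g s))) ->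
    path_in (X `&` A) (fun s => H (unitclamp (f s), unitclamp (g s))).
  move=> cf cg fg; split; first by apply: continuous_compose cH; cont.
  by move=> t _; split; [apply/HX'/frame_usq|apply: HA].
have cl0 : unitclamp 0 = 0 :> R by rewrite unitclamp_id.
have cl1 : unitclamp 1 = 1 :> R by rewrite unitclamp_id.
have fr := (frameP (@frame R)).2 (fun z Hz => Hz).
pose b s := H (unitclamp s, unitclamp 0).
pose t s := H (unitclamp s, unitclamp 1).
pose l s := H (unitclamp 0, unitclamp s).
pose r s := H (unitclamp 1, unitclamp s).
have bA : path_in (X `&` A) b.
  by apply: side; [cont|cont|move=> s; rewrite cl0; have [] := fr _ (c01 s)].
have tA : path_in (X `&` A) t.
  by apply: side; [cont|cont|move=> s; rewrite cl1; have [] := fr _ (c01 s)].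
have lA : path_in (X `&` A) l.
  by apply: side; [cont|cont|move=> s; rewrite cl0; have [] := fr _ (c01 s)].
have rA : path_in (X `&` A) r.
  by apply: side; [cont|cont|move=> s; rewrite cl1; have [] := fr _ (c01 s)].
have rc : r 1 = c 0 by rewrite /r cl1 c0.
have tc : t 1 = c 0 by rewrite /t cl1 c0.
have Pr := pcat_in rA cA rc; have Pt := pcat_in tA cA tc.
have br : b 1 = pcat r c 0 by rewrite pcat0 /b /r cl0 cl1.
have lt : l 1 = pcat t c 0 by rewrite pcat0 /l /t cl0 cl1.
have Pb := pcat_in bA Pr br; have Pl := pcat_in lA Pt lt.
have fold p : path_in (X `&` A) p ->
    exists2 E, square_in (X `&` A) E & forall s : R, 0 <= s <= 1 ->
      [/\ E (s, 0) = p (2^-1 * s), E (s, 1) = p 1,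
          E (0, s) = p s & E (1, s) = p (2^-1 + 2^-1 * s)].
  move=> pA; have := @reshape_path R V _ p (fun s => 2^-1 * s) (fun=> 1)
    (fun s => s) (fun s => 2^-1 + 2^-1 * s) pA; apply.
  - by cont.
  - by cont.
  - by cont.
  - by cont.
  - by move=> s s01; split; lra.
  - by rewrite mulr0.
  - by rewrite mulr1 mulr0 addr0.
  - by [].
  - by lra.
have [Dr DrA DrE] := fold _ Pr; have [Dt DtA DtE] := fold _ Pt.
have slide p : path_in (X `&` A) p ->
    square_in (X `&` A) (fun z => p (unitclamp (z.1 * (1 + z.2) / 2))).
  move=> [cp pA]; split; first by apply: continuous_compose cp; cont.
  by move=> z _; exact: pA.
have half (s : R) : 0 <= s <= 1 -> 2^-1 * s <= 2^-1 by lra.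
have half' (s : R) : 0 <= s <= 1 -> 2^-1 <= 2^-1 + 2^-1 * s by lra.
have clh (s : R) : 0 <= s <= 1 -> unitclamp (s * (1 + 0) / 2) = 2^-1 * s.
  by move=> s01; rewrite unitclamp_id; lra.
have clh' (s : R) : 0 <= s <= 1 -> unitclamp (1 * (1 + s) / 2) = 2^-1 + 2^-1 * s.
  by move=> s01; rewrite unitclamp_id; lra.
have cz (s : R) : unitclamp (0 * (1 + s) / 2) = 0 by rewrite !mul0r.
have k1 (s : R) : 2 * (2^-1 * s) = s by lra.
have k2 (s : R) : 2 * (2^-1 + 2^-1 * s) - 1 = s by lra.
apply: (refill HX (slide _ Pb) DtA (slide _ Pl) DrA).
- move=> s s01; have [-> _ _ _] := DtE s s01; have [-> _ _ _] := DrE s s01.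
  rewrite /= clh // !pcatl ?half // !k1 /t /r /b /l !cl0 !cl1.
  by rewrite unitclamp_id.
- move=> s s01; have [_ _ -> ->] := DtE s s01; have [_ _ -> ->] := DrE s s01.
  rewrite /= !cz !pcat0 clh' // !(pcatr (half' s s01)) // k2.
  by rewrite /b /l !cl0.
- move=> B BX BE.
  have BE1 s : 0 <= s <= 1 -> B (s, 1) = c 1 /\ B (1, s) = c 1.
    move=> s01; have [_ -> _ ->] := BE s s01.
    have [_ -> _ _] := DtE s s01; have [_ -> _ _] := DrE s s01.
    by rewrite !pcat1.
  have B11 : B (1, 1) = c 1 by have [] := BE1 1 e1.
  apply: fill => //.
  + have uz (s : R) : 0 <= s <= 1 -> usq (s, 1) by move=> s01; rewrite /usq /= s01 e1.
    apply/frameP => s s01; have [-> -> -> ->] := BE s s01.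
    split; first by have [] := (slide _ Pb).2 _ (uz s s01).
    + by have [] := DtA.2 _ (uz s s01).
    + by have [] := (slide _ Pl).2 _ (uz s s01).
    + by have [] := DrA.2 _ (uz s s01).
  + by rewrite B11.
  + by move=> s /BE1[-> ->]; rewrite B11.
Qed.

(* The deformation of [X] into [Y] is chosen for each square separately, so it
   may depend on a bound obtained from compactness. *)
Definition pushes X Y A := forall g, square_in X g ->
  exists G : (R * R) * R -> V, continuous G /\
  forall z (u : R), usq z -> 0 <= u <= 1 -> [/\ X (G (z, u)), G (z, 0) = g z,
    Y (G (z, 1)), Y (g z) -> Y (G (z, u)) & A (g z) -> A (G (z, u))].

(** The deformation preserves both [Y] and [A]. From [X] to [Y], a solution found in [X] is pushed
    into [Y], and its boundary is led back by the reversed tracks. From [Y] to [X], the data are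
    pushed into [Y], the problem is solved there and the tracks are attached to the solution. *)
Lemma pushes_good X Y A : Y `<=` X -> pushes X Y A -> good X A <-> good Y A.
Proof.
move=> YX push.
have c01 := @unitclamp01 R; have cid := @unitclamp_id R.
have e0 : 0 <= (0 : R) <= 1 by clear; lra.
have e1 : 0 <= (1 : R) <= 1 by clear; lra.
have cl0 := cid 0 e0; have cl1 := cid 1 e1.
have clu (s t : R) : usq (unitclamp s, unitclamp t) by rewrite /usq /= !c01.
have fr := (frameP (@frame R)).2 (fun z Hz => Hz).
have fr1 (s : R) := fr _ (c01 s).
pose sq (G : (R * R) * R -> V) (a b c : R * R -> R) :=
  fun z => G ((unitclamp (a z), unitclamp (b z)), unitclamp (c z)).
pose pt (G : (R * R) * R -> V) (a b c : R -> R) :=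
  fun z => G ((unitclamp (a z), unitclamp (b z)), unitclamp (c z)).
have sqin (G : (R * R) * R -> V) (a b c : R * R -> R) (Z : set V) : continuous G -> continuous a -> continuous b ->
    continuous c -> (forall z, Z (sq G a b c z)) -> square_in Z (sq G a b c).
  move=> cG ca cb cc HZ; split => [|z _]; last exact: HZ.
  by apply: continuous_compose cG; cont.
have ptin (G : (R * R) * R -> V) (a b c : R -> R) (Z : set V) : continuous G -> continuous a -> continuous b ->
    continuous c -> (forall z, Z (pt G a b c z)) -> path_in Z (pt G a b c).
  move=> cG ca cb cc HZ; split => [|z _]; last exact: HZ.
  by apply: continuous_compose cG; cont.
have cf : continuous (fun z : R * R => z.1) by cont.
have cs : continuous (fun z : R * R => z.2) by cont.
have c0 : continuous (fun _ : R * R => 0 : R) by cont.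
split=> [] [reach path_c sq_c]; split.
- move=> y Yy; have [p [[cp pX] p0 p1]] := reach y (YX y Yy).
  pose g (z : R * R) := p (unitclamp z.1).
  have gX : square_in X g.
    split; first by apply: continuous_compose cp; cont.
    by move=> z _; exact: pX.
  have [G [cG GP]] := push g gX.
  have [_ G00 G01 GY _] := GP _ 0 (clu 0 0) e0.
  have gE (s t : R) : g (unitclamp s, t) = p (unitclamp s).
    by rewrite /g unitclampK.
  exists (pcat (pt G (fun=> 0) (fun=> 0) id) (pt G id (fun=> 0) (fun=> 1))).
  split; last 2 first.
  + rewrite pcat0; have -> : pt G (fun=> 0) (fun=> 0) id 0 =
      G ((unitclamp 0, unitclamp 0), 0) by congr (G (_, _)); exact: cl0.
    by rewrite G00 gE cl0.
  + rewrite pcat1 /pt /= !cl1.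
    have [_ _ _ _] := GP _ 1 (clu 1 0) e1; rewrite cl1; apply.
    by rewrite /g /= cl1.
  + apply: pcat_in; last by rewrite /pt cl0 cl1.
      apply: ptin; [by []|by cont|by cont|by cont|].
      move=> z; have [_ _ _ + _] := GP _ _ (clu 0 0) (c01 z); apply.
      by rewrite gE cl0 p0.
    apply: ptin; [by []|by cont|by cont|by cont|].
    by move=> z; rewrite /pt cl1; have [] := GP _ _ (clu z 0) e1.
- move=> p pY pA0 pA1; have [D [DX Db Dt Dlr]] := path_c p (path_inS YX pY) pA0 pA1.
  have [G [cG GP]] := push D DX.
  have GA (s t u : R) : A (D (unitclamp s, unitclamp t)) ->
      A (G ((unitclamp s, unitclamp t), unitclamp u)).
    by have [_ _ _ _] := GP _ _ (clu s t) (c01 u).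
  exists (vcat (sq G (fun z => z.1) (fun=> 0) (fun z => z.2))
               (sq G (fun z => z.1) (fun z => z.2) (fun=> 1))); split.
  + apply: vcat_in => [||t t01]; last by rewrite /sq /= cl0 cl1.
      apply: sqin => // z; have [_ _ _ + _] := GP _ _ (clu z.1 0) (c01 z.2).
      by apply; rewrite cl0 Db //; apply: pY.2.
    apply: sqin => //; first by cont.
    by move=> z; rewrite /sq cl1; have [] := GP _ _ (clu z.1 z.2) e1.
  + move=> s s01; rewrite /vcat /= invr_ge0 ler0n /sq /= mulr0 unitclampK cl0.
    have [_ + _ _ _] := GP _ _ (clu s 0) e0; rewrite cl0 => ->.
    by rewrite (cid _ s01) Db.
  + move=> s s01; rewrite /vcat /= ifF; last by apply/negbTE; rewrite -ltNge; clear; lra.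
    by rewrite /sq /= unitclampK; apply: GA; rewrite (cid (2 * 1 - 1)) ?mulr1 ?addrK //; exact: Dt.
  + move=> t t01; rewrite /vcat /=; case: ifP => _; rewrite /sq /= !unitclampK.
      by split; apply: GA; rewrite ?cl0 ?cl1 Db ?pA0 ?pA1.
    by split; apply: GA; rewrite ?cl0 ?cl1; have [] := Dlr _ (c01 (2 * t - 1)).
- move=> H HY HA; have [K [KXA KE]] := sq_c H (square_inS YX HY) HA.
  have [G [cG GP]] := push K (square_inS (@subIsetl _ _ _) KXA).
  have KA z : usq z -> A (K z) by move=> /KXA.2[].
  have GYA z : usq z -> Y (K z) -> forall u, (Y `&` A) (G (z, unitclamp u)).
    move=> uz Yz u; have [_ _ _ GY GA] := GP z _ uz (c01 u).
    by split; [exact: GY|exact/GA/KA].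
  have KY z : frame z -> Y (K z).
    by move=> fz; rewrite KE //; apply: HY.2; exact: frame_usq.
  pose c (z : R * R) : R := 1 - z.2.
  have cc : continuous c by rewrite /c; cont.
  have c1 : continuous (fun _ : R * R => 1 : R) by cont.
  have fb (a b : R * R -> R) : continuous a -> continuous b ->
      (forall z, frame (unitclamp (a z), unitclamp (b z))) ->
      square_in (Y `&` A) (sq G a b c).
    move=> ca cb fab; apply: sqin => // z; apply: GYA; first exact: clu.
    exact: KY.
  have [|||||||B BYA BE] := collar
      (h := sq G (fun z => z.1) (fun z => z.2) (fun=> 1))
      (Db := sq G (fun z => z.1) (fun=> 0) c) (Dt := sq G (fun z => z.1) (fun=> 1) c)
      (Dl := sq G (fun=> 0) (fun z => z.1) c) (Dr := sq G (fun=> 1) (fun z => z.1) c)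
      (X := Y `&` A).
  + apply: sqin => // z; have [_ _ GY _ GA] := GP _ _ (clu z.1 z.2) e1.
    by rewrite /sq cl1; split; [exact: GY|apply: GA; exact: KA].
  + by apply: fb => // z; rewrite cl0; have [] := fr1 z.1.
  + by apply: fb => // z; rewrite cl1; have [] := fr1 z.1.
  + by apply: fb => // z; rewrite cl0; have [] := fr1 z.1.
  + by apply: fb => // z; rewrite cl1; have [] := fr1 z.1.
  + by move=> s s01; rewrite /sq /c /= subr0.
  + by move=> s s01; rewrite /sq /c /=.
  exists B; split => //; apply/frameP => s s01.
  have GK z : frame z -> G (z, 0) = H z.
    by move=> fz; have [_ -> _ _ _] := GP z 0 (frame_usq fz) e0; exact: KE.
  have [-> -> -> ->] := BE s s01.
  by rewrite /sq /c /= subrr cl0 cl1 (cid _ s01) !GK //; have [] := fr s s01.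
- move=> x Xx.
  have gX : square_in X (fun _ : R * R => x) by split; [cont|].
  have [G [cG GP]] := push _ gX.
  have [_ G00 _ _ _] := GP _ 0 (clu 0 0) e0.
  have [_ _ GY _ _] := GP _ 1 (clu 0 0) e1.
  have [p [pY p0 p1]] := reach _ GY.
  exists (pcat (pt G (fun=> 0) (fun=> 0) id) p); rewrite pcat0 pcat1; split => //.
    apply: pcat_in; [|exact: path_inS pY|by rewrite /pt p0 cl0 cl1].
    apply: ptin; [by []|by cont|by cont|by cont|].
    by move=> z; have [] := GP _ _ (clu 0 0) (c01 z).
  have -> : pt G (fun=> 0) (fun=> 0) id 0 = G ((unitclamp 0, unitclamp 0), 0).
    by congr (G (_, _)); exact: cl0.
  by rewrite G00.
- move=> p [cp pX] pA0 pA1.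
  pose g (z : R * R) := p (unitclamp z.1).
  have gX : square_in X g.
    split; first by apply: continuous_compose cp; cont.
    by move=> z _; exact: pX.
  have [G [cG GP]] := push g gX.
  have gE (s t : R) : g (unitclamp s, t) = p (unitclamp s).
    by rewrite /g unitclampK.
  have GA0 (u : R) : A (G ((unitclamp 0, unitclamp 0), unitclamp u)).
    by have [_ _ _ _] := GP _ _ (clu 0 0) (c01 u); apply; rewrite gE cl0.
  have GA1 (u : R) : A (G ((unitclamp 1, unitclamp 0), unitclamp u)).
    by have [_ _ _ _] := GP _ _ (clu 1 0) (c01 u); apply; rewrite gE cl1.
  have qY : path_in Y (pt G id (fun=> 0) (fun=> 1)).
    apply: ptin; [by []|by cont|by cont|by cont|].
    by move=> z; rewrite /pt cl1; have [] := GP _ _ (clu z 0) e1.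
  have [D [DY Db Dt Dlr]] := path_c _ qY (GA0 1) (GA1 1).
  exists (vcat (sq G (fun z => z.1) (fun=> 0) (fun z => z.2)) D); split.
  + apply: vcat_in => [||t t01]; last by rewrite Db.
      by apply: sqin => // z; have [] := GP _ _ (clu z.1 0) (c01 z.2).
    exact: square_inS DY.
  + move=> s s01; rewrite /vcat /= invr_ge0 ler0n /sq /= mulr0 unitclampK cl0.
    have [_ + _ _ _] := GP _ _ (clu s 0) e0; rewrite cl0 => ->.
    by rewrite gE (cid _ s01).
  + move=> s s01; rewrite /vcat /= ifF; last by apply/negbTE; rewrite -ltNge; clear; lra.
    by rewrite mulr1 addrK (cid _ s01); exact: Dt.
  + move=> t t01; rewrite /vcat /=; case: ifPn => t2.
      by rewrite /sq /= !unitclampK; split; [exact: GA0|exact: GA1].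
    rewrite cl0 cl1; apply: Dlr; move: t2 t01; rewrite -ltNge; clear; lra.
- move=> H HX HA; have [G [cG GP]] := push _ (square_clamp HX).
  have HE z : usq z -> (H \o clamp2) z = H z by move=> uz; rewrite /= clamp2_id.
  pose c (z : R * R) : R := 1 - z.2.
  have cc : continuous c by rewrite /c; cont.
  have c1 : continuous (fun _ : R * R => 1 : R) by cont.
  have GXA z : frame z -> forall u, (X `&` A) (G (z, unitclamp u)).
    move=> fz u; have [GX _ _ _ GA] := GP z _ (frame_usq fz) (c01 u).
    by split => //; apply: GA; rewrite HE; [exact: HA|exact: frame_usq].
  have H1Y : square_in Y (sq G (fun z => z.1) (fun z => z.2) (fun=> 1)).
    apply: sqin => // z; have [_ _ GY _ _] := GP _ _ (clu z.1 z.2) e1.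
    by rewrite /sq cl1.
  have H1E z : usq z ->
      sq G (fun z => z.1) (fun z => z.2) (fun=> 1) z = G (z, unitclamp 1).
    by move=> uz; rewrite /sq -[(_, unitclamp z.2)]/(clamp2 z) clamp2_id.
  have [|K [KYA KE]] := sq_c _ H1Y.
    by move=> z fz; rewrite H1E ?frame_usq //; have [] := GXA z fz 1.
  have fb (a b : R * R -> R) : continuous a -> continuous b ->
      (forall z, frame (unitclamp (a z), unitclamp (b z))) ->
      square_in (X `&` A) (sq G a b c).
    by move=> ca cb fab; apply: sqin => // z; apply: GXA.
  have [|||||||B BYA BE] := collar
      (h := K)
      (Db := sq G (fun z => z.1) (fun=> 0) c) (Dt := sq G (fun z => z.1) (fun=> 1) c)
      (Dl := sq G (fun=> 0) (fun z => z.1) c) (Dr := sq G (fun=> 1) (fun z => z.1) c)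
      (X := X `&` A).
  + by apply: square_inS KYA; exact: setSI.
  + by apply: fb => // z; rewrite cl0; have [] := fr1 z.1.
  + by apply: fb => // z; rewrite cl1; have [] := fr1 z.1.
  + by apply: fb => // z; rewrite cl0; have [] := fr1 z.1.
  + by apply: fb => // z; rewrite cl1; have [] := fr1 z.1.
  + move=> s s01; have [? ? ? ?] := fr s s01.
    rewrite !KE // !H1E ?frame_usq // /sq /c /= subr0.
    by rewrite cl0 cl1 (cid _ s01).
  + by move=> s s01; rewrite /sq /c /=.
  exists B; split => //; apply/frameP => s s01.
  have GK z : frame z -> G (z, 0) = H z.
    move=> fz; have [_ -> _ _ _] := GP z 0 (frame_usq fz) e0.
    by rewrite HE ?frame_usq.
  have [-> -> -> ->] := BE s s01.
  by rewrite /sq /c /= subrr cl0 cl1 (cid _ s01) !GK //; have [] := fr s s01.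
Qed.

End good_pairs.
Arguments reaches R {V} X A.
Arguments compresses_paths R {V} X A.
Arguments compresses_squares R {V} X A.
Arguments good R {V} X A.
Arguments pushes R {V} X Y A.

(** * Open covers *)

Section lebesgue_number.
Context {R : realType}.

Lemma usq_compact : compact [set z : R * R | usq z].
Proof.
have -> : [set z : R * R | usq z] = `[0, 1] `*` `[0, 1].
  by apply/seteqP; split => -[s t]; rewrite /usq /= !in_itv /= => /andP.
by apply: compact_setX; exact: segment_compact.
Qed.

(** A hereditary property takes the place of membership in a piece of a cover, because the lift of
    unordered configurations applies this to a condition on pairs of points of the ball. *)
Lemma lebesgue_number (P : set (R * R) -> Prop) :
  (forall A B, A `<=` B -> P B -> P A) ->
  (forall z, usq z -> exists2 e : R, 0 < e & P (ball z e)) ->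
  exists2 e : R, 0 < e & forall z, usq z -> P (ball z e).
Proof.
move=> PS Pnear.
have near z : usq z -> \forall z' \near z & e \near (0 : R)^'+, P (ball z' e).
  move=> /Pnear[e e0 Pe].
  exists (ball z (e / 2), [set d | d < e / 2]) => /=.
    split; first by apply: nbhsx_ballx; rewrite divr_gt0.
    by apply: nbhs_right_lt; rewrite divr_gt0.
  move=> [z' d] [/= zz' de]; apply: PS Pe => w z'w.
  rewrite [e](splitr e); apply: ball_triangle zz' _.
  by apply: le_ball z'w; exact: ltW.
have /compact_near_coveringP cov := usq_compact.
have Pnear0 : \forall e \near (0 : R)^'+, forall z, usq z -> P (ball z e).
  exact: (cov R _ (fun e z => P (ball z e))).
have [e [Pe e0]] : exists e : R, (forall z, usq z -> P (ball z e)) /\ 0 < e.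
  apply: (@filter_ex _ (0 : R)^'+); apply: filterI => //.
  exact: nbhs_right_gt.
by exists e.
Qed.

(** Powers of two, because subdivided paths and squares are reassembled by repeated halving. *)
Lemma dyadic_lt (e : R) : 0 < e -> exists k, (2 ^ k)%:R^-1 < e.
Proof.
move=> e0; have [n ne] : exists n, e^-1 < n%:R.
  by exists (Num.truncn e^-1).+1; rewrite truncnS_gt.
exists n; rewrite -[ltRHS]invrK ltf_pV2 ?posrE ?invr_gt0 //.
  by apply: lt_le_trans ne _; rewrite ler_nat ltnW // ltn_expl.
by rewrite ltr0n expn_gt0.
Qed.

Lemma cell_in_ball (n i j : nat) (s t : R) : (0 < n)%N -> (i < n)%N ->
  (j < n)%N -> 0 <= s <= 1 -> 0 <= t <= 1 -> forall e : R, n%:R^-1 < e ->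
  ball ((i%:R / n%:R, j%:R / n%:R) : R * R) e
    ((i%:R + s) / n%:R, (j%:R + t) / n%:R).
Proof.
move=> n0 iN jN s01 t01 e ne.
have H (k : nat) (u : R) : 0 <= u <= 1 -> ball (k%:R / n%:R : R) e ((k%:R + u) / n%:R).
  move=> /andP[u0 u1]; rewrite /ball /= -mulrBl opprD addNKr mulNr normrN.
  rewrite ger0_norm ?divr_ge0 ?ler0n //; apply: le_lt_trans ne.
  by rewrite ler_piMl // invr_ge0 ler0n.
by split; exact: H.
Qed.

End lebesgue_number.

(** * Subdivision and reassembly over an open cover *)

Section van_Kampen.
Context {R : realType} {V : topologicalType}.
Implicit Types (X A Z : set V) (p q : R -> V).

(** Concatenation along a balanced tree gives all [2 ^ k] pieces parameter intervals of equal
    length, so that a uniformly subdivided path is recovered exactly and not only up to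
    reparametrization. *)
Fixpoint iter_cat (q : nat -> R -> V) k i : R -> V :=
  if k is k'.+1 then pcat (iter_cat q k' i) (iter_cat q k' (i + 2 ^ k')%N) else q i.

Lemma iter_cat_pieces (q : nat -> R -> V) p (n m : nat) : (0 < n)%N ->
  (forall i, (i < m)%N -> forall s : R, 0 <= s <= 1 -> q i s = p ((i%:R + s) / n%:R)) ->
  forall k i, (i + 2 ^ k <= m)%N -> forall s : R, 0 <= s <= 1 ->
  iter_cat q k i s = p ((i%:R + (2 ^ k)%:R * s) / n%:R).
Proof.
move=> n0 qE; elim=> [|k ih] i im s s01.
  by rewrite /= mul1r qE // -addn1.
have k2 : (2 ^ k.+1 = 2 ^ k + 2 ^ k)%N by rewrite expnS mul2n addnn.
have im1 : (i + 2 ^ k <= m)%N.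
  by apply: leq_trans im; rewrite leq_add2l k2 leq_addr.
have im2 : (i + 2 ^ k + 2 ^ k <= m)%N by rewrite -addnA -k2.
rewrite /= /pcat; case: ifPn => [s2|]; last rewrite -ltNge => s2.
  rewrite ih //; last by lra.
  by rewrite k2 natrD; congr (p (_ / _)); ring.
rewrite ih //; last by lra.
by rewrite k2 !natrD; congr (p (_ / _)); ring.
Qed.

Lemma hcat_row Z A (l b : nat -> R -> V) (m : nat) :
  (forall i, (i < m)%N -> exists F, square_in Z F /\ forall s : R, 0 <= s <= 1 ->
    [/\ F (s, 0) = b i s, A (F (s, 1)), F (0, s) = l i s & F (1, s) = l i.+1 s]) ->
  forall k i, (i + 2 ^ k <= m)%N ->
  exists F, square_in Z F /\ forall s : R, 0 <= s <= 1 ->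
    [/\ F (s, 0) = iter_cat b k i s, A (F (s, 1)), F (0, s) = l i s &
        F (1, s) = l (i + 2 ^ k)%N s].
Proof.
move=> HF; elim=> [|k ih] i im.
  have [|F [FZ FE]] := HF i; first by rewrite -addn1.
  by exists F; split => // s /FE[]; rewrite addn1.
have k2 : (2 ^ k.+1 = 2 ^ k + 2 ^ k)%N by rewrite expnS mul2n addnn.
have im1 : (i + 2 ^ k <= m)%N.
  by apply: leq_trans im; rewrite leq_add2l k2 leq_addr.
have im2 : (i + 2 ^ k + 2 ^ k <= m)%N by rewrite -addnA -k2.
have [F [FZ FE]] := ih _ im1; have [G [GZ GE]] := ih _ im2.
exists (hcat F G); split.
  by apply: hcat_in => // t t01; have [_ _ _ ->] := FE t t01; have [_ _ ->] := GE t t01.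
have cl0 : unitclamp 0 = 0 :> R by rewrite unitclamp_le0.
have cl1 : unitclamp 1 = 1 :> R by rewrite unitclamp_ge1.
move=> s s01; rewrite /hcat /= cl0 cl1 (unitclamp_id s01) mulr0 mulr1 addrK.
have ge2 : (1 <= 2^-1 :> R) = false.
  by apply/negbTE; rewrite -ltNge; clear; lra.
rewrite ge2 invr_ge0 ler0n k2 addnA.
have [_ _ -> _] := FE s s01; have [_ _ _ ->] := GE s s01.
rewrite /pcat; case: ifPn => [s2|]; last rewrite -ltNge => s2.
  have s2' : 0 <= 2 * s <= 1 by move: s01 s2; clear; lra.
  by have [-> ? _ _] := FE _ s2'.
have s2' : 0 <= 2 * s - 1 <= 1 by move: s01 s2; clear; lra.
by have [-> ? _ _] := GE _ s2'.
Qed.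

Lemma grid_fill Z (qh qv : nat -> nat -> R -> V) (m : nat) :
  (forall i j, (i < m)%N -> (j < m)%N ->
    exists F, square_in Z F /\ forall s : R, 0 <= s <= 1 ->
    [/\ F (s, 0) = qh i j s, F (s, 1) = qh i j.+1 s,
        F (0, s) = qv i j s & F (1, s) = qv i.+1 j s]) ->
  forall k i j, (i + 2 ^ k <= m)%N -> (j + 2 ^ k <= m)%N ->
  exists F, square_in Z F /\ forall s : R, 0 <= s <= 1 ->
    [/\ F (s, 0) = iter_cat (qh ^~ j) k i s,
        F (s, 1) = iter_cat (qh ^~ (j + 2 ^ k)%N) k i s,
        F (0, s) = iter_cat (qv i) k j s &
        F (1, s) = iter_cat (qv (i + 2 ^ k)%N) k j s].
Proof.
move=> HF; elim=> [|k ih] i j im jm.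
  by rewrite /= !addn1; apply: HF; rewrite -addn1.
have k2 : (2 ^ k.+1 = 2 ^ k + 2 ^ k)%N by rewrite expnS mul2n addnn.
have lo a : (a + 2 ^ k.+1 <= m)%N -> (a + 2 ^ k <= m)%N.
  by apply: leq_trans; rewrite leq_add2l k2 leq_addr.
have hi a : (a + 2 ^ k.+1 <= m)%N -> (a + 2 ^ k + 2 ^ k <= m)%N.
  by rewrite -addnA -k2.
have [F00 [Z00 E00]] := ih _ _ (lo _ im) (lo _ jm).
have [F10 [Z10 E10]] := ih _ _ (hi _ im) (lo _ jm).
have [F01 [Z01 E01]] := ih _ _ (lo _ im) (hi _ jm).
have [F11 [Z11 E11]] := ih _ _ (hi _ im) (hi _ jm).
have cl0 : unitclamp 0 = 0 :> R by rewrite unitclamp_le0.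
have cl1 : unitclamp 1 = 1 :> R by rewrite unitclamp_ge1.
have ge2 : (1 <= 2^-1 :> R) = false.
  by apply/negbTE; rewrite -ltNge; clear; lra.
have le2 : (0 <= 2^-1 :> R) by rewrite invr_ge0 ler0n.
have halfP (s : R) : 0 <= s <= 1 ->
    (s <= 2^-1 /\ 0 <= 2 * s <= 1) \/ ((s <= 2^-1) = false /\ 0 <= 2 * s - 1 <= 1).
  move=> s01; case: (boolP (s <= 2^-1)) => s2; [left|right]; split => //.
    by move: s01 s2; clear; lra.
  by move: s01 s2; rewrite -ltNge; clear; lra.
have B0 : square_in Z (hcat F00 F10).
  by apply: hcat_in => // t t01; have [_ _ _ ->] := E00 t t01; have [_ _ ->] := E10 t t01.
have B1 : square_in Z (hcat F01 F11).
  by apply: hcat_in => // t t01; have [_ _ _ ->] := E01 t t01; have [_ _ ->] := E11 t t01.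
exists (vcat (hcat F00 F10) (hcat F01 F11)); split.
  apply: vcat_in => // t t01; rewrite /hcat /= cl0 cl1.
  have [[-> t2]|[-> t2]] := halfP _ t01.
    by have [_ -> _ _] := E00 _ t2; have [-> _ _ _] := E01 _ t2.
  by have [_ -> _ _] := E10 _ t2; have [-> _ _ _] := E11 _ t2.
move=> s s01; rewrite /vcat /= le2 ge2 cl0 cl1 (unitclamp_id s01).
rewrite mulr0 mulr1 addrK k2 !addnA /hcat /= le2 ge2 cl0 cl1 !mulr0 !mulr1 addrK.
rewrite /pcat; have [[-> s2]|[-> s2]] := halfP _ s01.
  have [a1 a2 a3 a4] := E00 _ s2; have [_ b2 _ _] := E01 _ s2.
  by have [_ _ _ c4] := E10 _ s2; rewrite (unitclamp_id s2).
have [a1 a2 a3 a4] := E11 _ s2; have [b1 _ _ _] := E10 _ s2.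
by have [_ _ c3 _] := E01 _ s2; rewrite (unitclamp_id s2).
Qed.

(** The path that runs back along [b0], then along [p] and [b1], has its ends in [A] and can be
    compressed. The result is reshaped: [b0] and [b1] become vertical sides, and the other three
    sides of the compression, which lie in [A], together become the top. *)
Lemma edge_square X A p (b0 b1 : R -> V) : compresses_paths R X A ->
  path_in X p -> path_in X b0 -> path_in X b1 -> b0 0 = p 0 -> b1 0 = p 1 ->
  A (b0 1) -> A (b1 1) ->
  exists D, square_in X D /\ forall s : R, 0 <= s <= 1 ->
    [/\ D (s, 0) = p s, A (D (s, 1)), D (0, s) = b0 s & D (1, s) = b1 s].
Proof.
move=> cp pX [cb0 b0X] b1X e0 e1 A0 A1.
have rX : path_in X (fun s => b0 (1 - s)).
  split; first by apply: continuous_compose cb0; cont.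
  by move=> t t01; apply: b0X; lra.
have pb1 : p 1 = b1 0 by rewrite e1.
have qX := pcat_in pX b1X pb1.
have rq : (fun s => b0 (1 - s)) 1 = pcat p b1 0 by rewrite /= subrr pcat0.
have PX := pcat_in rX qX rq.
have [||D [DX Db Dt Dlr]] := cp _ PX.
- by rewrite pcat0 subr0.
- by rewrite !pcat1.
(* Runs up the left side, along the top and down the right side, in a third of the time each. The
   quarters below come from the nested halving in [pcat]: [p] occupies the third quarter and [b1]
   the last. *)
pose t (s : R) : R * R :=
  (unitclamp (3 * s - 1), unitclamp (Num.min (3 * s) (3 - 3 * s))).
have h1 (s : R) : 0 <= s <= 1 -> 0 <= 2^-1 + s / 4 <= 1 /\
    2^-1 <= 2^-1 + s / 4 /\ 2 * (2^-1 + s / 4) - 1 <= 2^-1 /\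
    2 * (2 * (2^-1 + s / 4) - 1) = s by move=> s01; split; [|split; [|split]]; lra.
have h2 (s : R) : 0 <= s <= 1 -> 0 <= 2^-1 - s / 2 <= 1 /\ 2^-1 - s / 2 <= 2^-1 /\
  1 - 2 * (2^-1 - s / 2) = s by move=> s01; split; [|split]; lra.
have h3 (s : R) : 0 <= s <= 1 -> 0 <= 3/4 + s / 4 <= 1 /\
    2^-1 <= 3/4 + s / 4 /\ 2^-1 <= 2 * (3/4 + s / 4) - 1 /\
    2 * (2 * (3/4 + s / 4) - 1) - 1 = s by move=> s01; split; [|split; [|split]]; lra.
have e00 : 0 <= (0 : R) <= 1 by clear; lra.
have [|||||||||E EX EE] := reshape (b := fun s => (2^-1 + s / 4, 0)) (t := t)
  (l := fun s => (2^-1 - s / 2, 0)) (r := fun s => (3/4 + s / 4, 0)) DX.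
- by cont.
- by rewrite /t; cont.
- by cont.
- by cont.
- move=> s s01; have [h1' _] := h1 s s01; have [h2' _] := h2 s s01.
  have [h3' _] := h3 s s01.
  by rewrite /usq /t /= h1' h2' h3' e00 !unitclamp01.
- by rewrite !mul0r addr0 subr0.
- by congr pair; lra.
- rewrite /t; congr pair.
    by rewrite mulr0 sub0r unitclamp_le0 ?subrr //; lra.
  by rewrite mulr0 subr0 unitclamp_le0 // ge_min lexx.
- rewrite /t; congr pair.
    by rewrite unitclamp_ge1; lra.
  by rewrite mulr1 subrr unitclamp_le0 // ge_min lexx orbT.
exists E; split => // s s01.
have [-> -> -> ->] := EE s s01.
have [k1 [k2 [k3 k4]]] := h1 s s01; have [l1 [l2 l3]] := h2 s s01.
have [m1 [m2 [m3 m4]]] := h3 s s01; rewrite !Db //.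
rewrite (pcatr k2 rq) (pcatl _ _ k3) k4 (pcatl _ _ l2) l3.
rewrite (pcatr m2 rq) (pcatr m3 pb1) m4; split => //.
rewrite /t; have [s3|s3] := leP (3 * s - 1) 0.
  by rewrite (unitclamp_le0 s3); have [] := Dlr _ (unitclamp01 (Num.min (3 * s) (3 - 3 * s))).
have [s4|s4] := leP 1 (3 * s - 1).
  by rewrite (unitclamp_ge1 s4); have [] := Dlr _ (unitclamp01 (Num.min (3 * s) (3 - 3 * s))).
rewrite [unitclamp (Num.min _ _)]unitclamp_ge1; first exact/Dt/unitclamp01.
by rewrite le_min; move: s3 s4; clear; lra.
Qed.

Section cover.
Context {T : eqType} (X A : set V) (U : T -> set V).
Hypothesis oU : forall i, open (U i).
Hypothesis XU : forall v, X v -> exists i, U i v.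

Let UJ (J : seq T) : set V := X `&` [set v | {in J, forall i, U i v}].

Let UJS (J J' : seq T) : {subset J <= J'} -> UJ J' `<=` UJ J.
Proof. by move=> JJ v [Xv Uv]; split => // i /JJ; exact: Uv. Qed.

Let UJX J : UJ J `<=` X.
Proof. by move=> v []. Qed.

(** A point of [A] is not moved; this is what keeps the boundary of a square fixed later. *)
Let to_A J v : reaches R (UJ J) A -> UJ J v -> exists p : R -> V,
  [/\ path_in (UJ J) p, p 0 = v, A (p 1) & A v -> p = fun=> v].
Proof.
move=> rJ Jv; have [Av|nAv] := pselect (A v).
  by exists (fun=> v); split => //; split => //; cont.
by have [p [? ? ?]] := rJ v Jv; exists p; split => // /nAv.
Qed.

(** A variant of [edge_square] that leaves an edge alone if it already lies in [A]. *)
Let edge J p (b0 b1 : R -> V) : compresses_paths R (UJ J) A ->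
  path_in (UJ J) p -> path_in (UJ J) b0 -> path_in (UJ J) b1 ->
  b0 0 = p 0 -> b1 0 = p 1 -> A (b0 1) -> A (b1 1) ->
  (A (p 0) -> b0 = fun=> p 0) -> (A (p 1) -> b1 = fun=> p 1) ->
  exists D, [/\ square_in (UJ J) D, forall s : R, 0 <= s <= 1 ->
    [/\ D (s, 0) = p s, A (D (s, 1)), D (0, s) = b0 s & D (1, s) = b1 s] &
    (forall s : R, 0 <= s <= 1 -> A (p s)) ->
      forall s : R, 0 <= s <= 1 -> D (s, 1) = p s].
Proof.
move=> cJ pJ b0J b1J e0 e1 A0 A1 c0 c1.
have e00 := @unit0 R.
have e11 := @unit1 R.
have [pA|npA] := pselect (forall s : R, 0 <= s <= 1 -> A (p s)).
  exists (fun z => p (unitclamp z.1)); split => [|s s01|_ s s01] /=.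
  - split; first by apply: continuous_compose pJ.1; cont.
    by move=> z _; apply: pJ.2; exact: unitclamp01.
  - rewrite !unitclamp_id ?e00 ?e11 // c0 ?c1; [|exact: pA|exact: pA].
    by split => //; exact: pA.
  - by rewrite unitclamp_id.
have [D [DJ DE]] := edge_square cJ pJ b0J b1J e0 e1 A0 A1.
by exists D; split => // /npA.
Qed.

Let pieces (H : R * R -> V) : square_in X H ->
  exists k, forall i j, exists a : T, (i < 2 ^ k)%N -> (j < 2 ^ k)%N ->
    forall s t : R, 0 <= s <= 1 -> 0 <= t <= 1 ->
    U a (H ((i%:R + s) / (2 ^ k)%N%:R, (j%:R + t) / (2 ^ k)%N%:R)).
Proof.
move=> [cH HX].
have [||e e0 He] := @lebesgue_number R
    (fun B => exists a, forall z, B z -> U a (H z)).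
- by move=> B B' BB' [a B'a]; exists a => z /BB'; exact: B'a.
- move=> z uz; have [a Ua] := XU (HX z uz).
  have : nbhs z (H @^-1` U a) by apply: cH; apply: open_nbhs_nbhs.
  by move=> /nbhs_ballP[e e0 He]; exists e => //; exists a.
have [k ke] := dyadic_lt e0; exists k => i j.
have n0 : (0 < 2 ^ k)%N by rewrite expn_gt0.
have nR : 0 < (2 ^ k)%N%:R :> R by rewrite ltr0n.
have [iN|] := boolP ((i < 2 ^ k)%N && (j < 2 ^ k)%N); last first.
  have e00 : usq ((0, 0) : R * R) by rewrite /usq /= unit0.
  move=> /negP nb; have [a _] := He _ e00.
  by exists a => i1 j1; case: nb; rewrite i1 j1.
have /andP[i1 j1] := iN.
have lt (m : nat) : (m < 2 ^ k)%N -> 0 <= (m%:R : R) / (2 ^ k)%N%:R <= 1.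
  move=> mk; rewrite divr_ge0 ?ler0n //= ler_pdivrMr // mul1r ler_nat.
  exact: ltnW.
have [|a Ha] := He (i%:R / (2 ^ k)%N%:R, j%:R / (2 ^ k)%N%:R).
  by rewrite /usq /= !lt.
exists a => _ _ s t s01 t01; apply: Ha; exact: cell_in_ball.
Qed.

Lemma reaches_cover :
  (forall i, reaches R (UJ [:: i]) A) -> reaches R X A.
Proof.
move=> h0 x Xx; have [i Ui] := XU Xx.
have [|p [pJ p0 p1]] := h0 i x.
  by split => // j; rewrite inE => /eqP ->.
by exists p; split => //; apply: path_inS pJ.
Qed.

(** Each cut point is moved into [A] within the intersection of the pieces on its two sides; each
    segment is then compressed within its own piece, compatibly with these motions of its ends. *)
Lemma compresses_paths_cover :
  (forall i j, reaches R (UJ [:: i; j]) A) ->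
  (forall i, compresses_paths R (UJ [:: i]) A) ->
  compresses_paths R X A.
Proof.
move=> h0 h1 p [cp pX] pA0 pA1.
pose H (z : R * R) := p z.1.
have HX : square_in X H.
  split; first by apply: continuous_compose cp; cont.
  by move=> z /andP[? _]; exact: pX.
have [k Hk] := pieces HX; pose n := (2 ^ k)%N; rewrite -/n in Hk.
have n0 : (0 < n)%N by rewrite expn_gt0.
have nR : 0 < n%:R :> R by rewrite ltr0n.
have /choice[a aP] := fun i => Hk i 0%N.
have aU i : (i < n)%N -> forall s : R, 0 <= s <= 1 -> U (a i) (p ((i%:R + s) / n%:R)).
  by move=> iN s s01; exact: (aP i iN n0 s 0 s01 (@unit0 R)).
pose v (i : nat) := p (i%:R / n%:R).
(* [i.-1] and [cut i] number the segments to the left and right of the cut point [i]; at either end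
   of the path both name the only adjacent segment. *)
pose cut i := minn i n.-1.
pose Jv i := [:: a i.-1; a (cut i)].
have inU i : (i <= n)%N -> UJ (Jv i) (v i).
  move=> iN; split.
    by apply: pX; rewrite divr_ge0 ?ler0n //= ler_pdivrMr // mul1r ler_nat.
  move=> c; rewrite !inE => /orP[]/eqP ->.
    case: i iN => [|i] iN /=.
      by have := aU 0%N n0 0 (@unit0 R); rewrite add0r.
    by have := aU i iN 1 (@unit1 R); rewrite natr1.
  rewrite /cut; case: (ltnP i n) => iN'.
    have -> : minn i n.-1 = i by apply/minn_idPl; rewrite -ltnS prednK.
    by have := aU i iN' 0 (@unit0 R); rewrite addr0.
  have -> : i = n by apply/eqP; rewrite eqn_leq iN iN'.
  have -> : minn n n.-1 = n.-1 by apply/minn_idPr; exact: leq_pred.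
  have := aU n.-1; rewrite ltn_predL n0 => /(_ isT 1 (@unit1 R)).
  by rewrite natr1 prednK.
have /choice[b bP] : forall i, exists b : R -> V, (i <= n)%N ->
    [/\ path_in (UJ (Jv i)) b, b 0 = v i, A (b 1) & A (v i) -> b = fun=> v i].
  move=> i; case: (leqP i n) => iN; last by exists (fun=> v 0%N).
  by have [b ?] := to_A (h0 _ _) (inU i iN); exists b.
have Je i : (i < n)%N -> {subset [:: a i] <= Jv i} /\ {subset [:: a i] <= Jv i.+1}.
  move=> iN; split=> c; rewrite !inE => /eqP ->; last by rewrite eqxx.
  have -> : cut i = i by apply/minn_idPl; rewrite -ltnS prednK.
  by rewrite eqxx orbT.
pose q i (s : R) := p ((i%:R + s) / n%:R).
have row i : (i < n)%N -> exists F, square_in X F /\ forall s : R, 0 <= s <= 1 ->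
    [/\ F (s, 0) = q i s, A (F (s, 1)), F (0, s) = b i s & F (1, s) = b i.+1 s].
  move=> iN; have [J1 J2] := Je i iN.
  have [b1 b2 b3 b4] := bP i (ltnW iN); have [c1 c2 c3 c4] := bP i.+1 iN.
  have q0 : q i 0 = v i by rewrite /q addr0.
  have q1 : q i 1 = v i.+1 by rewrite /q natr1.
  have [||||||||||D [DJ DE _]] := @edge [:: a i] (q i) (b i) (b i.+1).
  - exact: h1.
  - split; first by apply: continuous_compose cp; cont.
    move=> s s01; split; last by move=> c; rewrite inE => /eqP ->; exact: aU.
    apply: pX; rewrite divr_ge0 ?addr_ge0 ?ler0n //=; last by case/andP: s01.
    rewrite ler_pdivrMr // mul1r (le_trans (y := i.+1%:R)) ?ler_nat // -natr1.
    by rewrite lerD2l; case/andP: s01.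
  - by apply: path_inS b1; exact: UJS.
  - by apply: path_inS c1; exact: UJS.
  - by rewrite q0.
  - by rewrite q1.
  - by [].
  - by [].
  - by rewrite q0.
  - by rewrite q1.
  by exists D; split => //; apply: square_inS DJ; exact: UJX.
have [F [FX FE]] := hcat_row row (leqnn (0 + n)).
have q1 (i : nat) : (i < n)%N -> forall s : R, 0 <= s <= 1 ->
    q i s = p ((i%:R + s) / n%:R) by [].
have e0 : v 0%N = p 0 by rewrite /v mul0r.
have e1 : v n = p 1 by rewrite /v divff // gt_eqF.
have A0 : b 0%N = fun=> p 0 by have [_ _ _] := bP 0%N isT; rewrite e0; apply.
have A1 : b n = fun=> p 1 by have [_ _ _] := bP n (leqnn n); rewrite e1; apply.
exists F; split => // s s01; have [E1 E2 E3 E4] := FE s s01 => //.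
  rewrite E1 (iter_cat_pieces n0 q1) // add0r; congr p.
  by rewrite mulrAC divff ?mul1r // gt_eqF.
by rewrite E3 E4 A0 add0n A1.
Qed.

(** On a fine grid, vertices are moved into [A] within the intersection of four pieces, edges within
    that of two. The squares traced by the edges form a collar around each cell, whose outer
    boundary lies in [A] and is filled within the piece of the cell. *)
Lemma compresses_squares_cover :
  (forall J, J != [::] -> good R (UJ J) A) -> compresses_squares R X A.
Proof.
move=> gJ H HX HA.
have [cH HX'] := HX.
have [k Hk] := pieces HX; pose n := (2 ^ k)%N; rewrite -/n in Hk.
have n0 : (0 < n)%N by rewrite expn_gt0.
have nR : 0 < n%:R :> R by rewrite ltr0n.
have /choice[a' a'P] := fun ij : nat * nat => Hk ij.1 ij.2.
pose a i j := a' (i, j).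
have aU i j : (i < n)%N -> (j < n)%N -> forall s t : R, 0 <= s <= 1 ->
    0 <= t <= 1 -> U (a i j) (H ((i%:R + s) / n%:R, (j%:R + t) / n%:R)).
  by move=> iN jN s t s01 t01; exact: (a'P (i, j)).
pose v i j := H (i%:R / n%:R, j%:R / n%:R).
pose cut i := minn i n.-1.
have cutE i : (i < n)%N -> cut i = i.
  by move=> iN; apply/minn_idPl; rewrite -ltnS prednK.
have adj i c : (i <= n)%N -> c \in [:: i.-1; cut i] ->
    (c < n)%N /\ exists2 s : R, 0 <= s <= 1 & i%:R = c%:R + s.
  move=> iN; rewrite !inE => /orP[]/eqP ->.
    case: i iN => [|i] iN /=; split => //.
      by exists 0; rewrite ?addr0 ?unit0.
    by exists 1; rewrite ?natr1 ?unit1.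
  case: (ltnP i n) => iN'; first rewrite cutE //.
    by split => //; exists 0; rewrite ?addr0 ?unit0.
  have -> : i = n by apply/eqP; rewrite eqn_leq iN iN'.
  have -> : cut n = n.-1 by apply/minn_idPr; exact: leq_pred.
  split; first by rewrite ltn_predL.
  by exists 1; rewrite ?natr1 ?prednK ?unit1.
have rng (i : nat) (s : R) : (i < n)%N -> 0 <= s <= 1 -> 0 <= (i%:R + s) / n%:R <= 1.
  move=> iN /andP[s0 s1]; rewrite divr_ge0 ?addr_ge0 ?ler0n //=.
  rewrite ler_pdivrMr // mul1r (le_trans (y := i.+1%:R)) ?ler_nat // -natr1.
  by rewrite lerD2l.
have rngn (i : nat) : (i <= n)%N -> 0 <= (i%:R : R) / n%:R <= 1.
  by move=> iN; rewrite divr_ge0 ?ler0n //= ler_pdivrMr // mul1r ler_nat.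
pose J2 i j := [seq a x.1 x.2 | x <- [:: (i.-1, j.-1); (i.-1, cut j);
                                        (cut i, j.-1); (cut i, cut j)]].
have J2P i j c : reflect (exists x y, [/\ x \in [:: i.-1; cut i],
    y \in [:: j.-1; cut j] & c = a x y]) (c \in J2 i j).
  apply: (iffP idP).
    rewrite /J2 /= !inE => /or4P[]/eqP ->;
      [exists i.-1, j.-1|exists i.-1, (cut j)|exists (cut i), j.-1|
       exists (cut i), (cut j)]; by split; rewrite // !inE eqxx ?orbT.
  by move=> [x [y [+ + ->]]]; rewrite !inE =>
    /orP[]/eqP -> /orP[]/eqP ->; rewrite eqxx ?orbT.
have inU i j : (i <= n)%N -> (j <= n)%N -> UJ (J2 i j) (v i j).
  move=> iN jN; split.
    by apply: HX'; rewrite /usq /= !rngn.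
  move=> c /J2P[x [y [xi yj ->]]].
  have [xN [s s01 xs]] := adj i x iN xi; have [yN [t t01 yt]] := adj j y jN yj.
  by rewrite /v xs yt; apply: aU.
have /choice[b' b'P] : forall ij : nat * nat, exists b : R -> V,
    (ij.1 <= n)%N -> (ij.2 <= n)%N ->
    [/\ path_in (UJ (J2 ij.1 ij.2)) b, b 0 = v ij.1 ij.2, A (b 1) &
        A (v ij.1 ij.2) -> b = fun=> v ij.1 ij.2].
  move=> [i j] /=; have [iN|iN] := leqP i n; last by exists (fun=> v 0%N 0%N).
  have [jN|jN] := leqP j n; last by exists (fun=> v 0%N 0%N).
  have [h0 _ _] := gJ (J2 i j) isT.
  by have [b ?] := to_A h0 (inU i j iN jN); exists b.
pose b i j := b' (i, j).
have bP i j : (i <= n)%N -> (j <= n)%N ->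
    [/\ path_in (UJ (J2 i j)) (b i j), b i j 0 = v i j, A (b i j 1) &
        A (v i j) -> b i j = fun=> v i j] := b'P (i, j).
pose eh i j (s : R) := H ((i%:R + s) / n%:R, j%:R / n%:R).
pose ev i j (s : R) := H (i%:R / n%:R, (j%:R + s) / n%:R).
have memc i : (i < n)%N -> i \in [:: i.-1; cut i] /\ i \in [:: i.+1.-1; cut i.+1].
  by move=> iN; rewrite cutE // !inE !eqxx orbT.
have memJ i j x y : x \in [:: i.-1; cut i] -> y \in [:: j.-1; cut j] ->
    a x y \in J2 i j by move=> xi yj; apply/J2P; exists x, y.
(* The cells on the two sides of a horizontal edge, and below those of a vertical edge. *)
pose Jh i j := [:: a i j.-1; a i (cut j)].
pose Jw i j := [:: a i.-1 j; a (cut i) j].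
have /choice[Dh' Dh'P] : forall ij : nat * nat, exists D,
    (ij.1 < n)%N -> (ij.2 <= n)%N ->
    [/\ square_in (UJ (Jh ij.1 ij.2)) D, forall s : R, 0 <= s <= 1 ->
    [/\ D (s, 0) = eh ij.1 ij.2 s, A (D (s, 1)), D (0, s) = b ij.1 ij.2 s &
        D (1, s) = b ij.1.+1 ij.2 s] &
    (forall s : R, 0 <= s <= 1 -> A (eh ij.1 ij.2 s)) ->
      forall s : R, 0 <= s <= 1 -> D (s, 1) = eh ij.1 ij.2 s].
  move=> [i j] /=; have [iN|iN] := ltnP i n; last by exists H.
  have [jN|jN] := leqP j n; last by exists H.
  have [_ h1 _] := gJ (Jh i j) isT.
  have [b1 b2 b3 b4] := bP i j (ltnW iN) jN; have [c1 c2 c3 c4] := bP i.+1 j iN jN.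
  have q0 : eh i j 0 = v i j by rewrite /eh addr0.
  have q1 : eh i j 1 = v i.+1 j by rewrite /eh natr1.
  have [m1 m2] := memc i iN.
  have sub1 : {subset Jh i j <= J2 i j}.
    by move=> c; rewrite in_cons mem_seq1 => /orP[]/eqP ->; apply: memJ;
      rewrite // !inE eqxx ?orbT.
  have sub2 : {subset Jh i j <= J2 i.+1 j}.
    by move=> c; rewrite in_cons mem_seq1 => /orP[]/eqP ->; apply: memJ;
      rewrite // !inE eqxx ?orbT.
  have [|||||||||D DP] := @edge (Jh i j) (eh i j) (b i j) (b i.+1 j) h1.
  - split; first by apply: continuous_compose cH; cont.
    move=> s s01; split; first by apply: HX'; rewrite /usq /= rng // rngn.
    move=> c cJ; have : exists2 y, y \in [:: j.-1; cut j] & c = a i y.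
      by move: cJ; rewrite !inE => /orP[]/eqP ->; [exists j.-1|exists (cut j)];
        rewrite // !inE eqxx ?orbT.
    move=> [y yj ->]; have [yN [t t01 yt]] := adj j y jN yj.
    by rewrite /eh yt; exact: aU.
  - by apply: path_inS b1; exact: UJS.
  - by apply: path_inS c1; exact: UJS.
  - by rewrite q0.
  - by rewrite q1.
  - by [].
  - by [].
  - by rewrite q0.
  - by rewrite q1.
  by exists D.
have /choice[Dv' Dv'P] : forall ij : nat * nat, exists D,
    (ij.1 <= n)%N -> (ij.2 < n)%N ->
    [/\ square_in (UJ (Jw ij.1 ij.2)) D, forall s : R, 0 <= s <= 1 ->
    [/\ D (s, 0) = ev ij.1 ij.2 s, A (D (s, 1)), D (0, s) = b ij.1 ij.2 s &
        D (1, s) = b ij.1 ij.2.+1 s] &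
    (forall s : R, 0 <= s <= 1 -> A (ev ij.1 ij.2 s)) ->
      forall s : R, 0 <= s <= 1 -> D (s, 1) = ev ij.1 ij.2 s].
  move=> [i j] /=; have [iN|iN] := leqP i n; last by exists H.
  have [jN|jN] := ltnP j n; last by exists H.
  have [_ h1 _] := gJ (Jw i j) isT.
  have [b1 b2 b3 b4] := bP i j iN (ltnW jN); have [c1 c2 c3 c4] := bP i j.+1 iN jN.
  have q0 : ev i j 0 = v i j by rewrite /ev addr0.
  have q1 : ev i j 1 = v i j.+1 by rewrite /ev natr1.
  have [m1 m2] := memc j jN.
  have sub1 : {subset Jw i j <= J2 i j}.
    by move=> c; rewrite in_cons mem_seq1 => /orP[]/eqP ->; apply: memJ;
      rewrite // !inE eqxx ?orbT.
  have sub2 : {subset Jw i j <= J2 i j.+1}.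
    by move=> c; rewrite in_cons mem_seq1 => /orP[]/eqP ->; apply: memJ;
      rewrite // !inE eqxx ?orbT.
  have [|||||||||D DP] := @edge (Jw i j) (ev i j) (b i j) (b i j.+1) h1.
  - split; first by apply: continuous_compose cH; cont.
    move=> s s01; split; first by apply: HX'; rewrite /usq /= rng // rngn.
    move=> c cJ; have : exists2 y, y \in [:: i.-1; cut i] & c = a y j.
      by move: cJ; rewrite !inE => /orP[]/eqP ->; [exists i.-1|exists (cut i)];
        rewrite // !inE eqxx ?orbT.
    move=> [y yj ->]; have [yN [t t01 yt]] := adj i y iN yj.
    by rewrite /ev yt; exact: aU.
  - by apply: path_inS b1; exact: UJS.
  - by apply: path_inS c1; exact: UJS.
  - by rewrite q0.
  - by rewrite q1.
  - by [].
  - by [].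
  - by rewrite q0.
  - by rewrite q1.
  by exists D.
pose qh i j (s : R) := Dh' (i, j) (s, 1); pose qv i j (s : R) := Dv' (i, j) (s, 1).
have e0 := @unit0 R.
have e1 := @unit1 R.
have cell i j : (i < n)%N -> (j < n)%N -> exists F, square_in (X `&` A) F /\
    forall s : R, 0 <= s <= 1 ->
    [/\ F (s, 0) = qh i j s, F (s, 1) = qh i j.+1 s,
        F (0, s) = qv i j s & F (1, s) = qv i.+1 j s].
  move=> iN jN; have [B1 B2 _] := Dh'P (i, j) iN (ltnW jN).
  have [T1 T2 _] := Dh'P (i, j.+1) iN jN; have [L1 L2 _] := Dv'P (i, j) (ltnW iN) jN.
  have [R1 R2 _] := Dv'P (i.+1, j) iN jN.
  pose h (z : R * R) := H ((i%:R + z.1) / n%:R, (j%:R + z.2) / n%:R).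
  have hX : square_in (UJ [:: a i j]) h.
    split; first by apply: continuous_compose cH; cont.
    move=> z /andP[z1 z2]; split; first by apply: HX'; rewrite /usq /= !rng.
    by move=> c; rewrite inE => /eqP ->; exact: aU.
  have inJ (J : seq T) (D : R * R -> V) : a i j \in J -> square_in (UJ J) D ->
      square_in (UJ [:: a i j]) D.
    by move=> aJ; apply: square_inS; apply: UJS => c; rewrite inE => /eqP ->.
  have mB : a i j \in Jh i j by rewrite /Jh cutE // !inE eqxx orbT.
  have mT : a i j \in Jh i j.+1 by rewrite /Jh !inE eqxx.
  have mL : a i j \in Jw i j by rewrite /Jw cutE // !inE eqxx orbT.
  have mR : a i j \in Jw i.+1 j by rewrite /Jw !inE eqxx.
  have [||C CX CE] := collar hX (inJ _ _ mB B1) (inJ _ _ mT T1)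
      (inJ _ _ mL L1) (inJ _ _ mR R1).
  - move=> s s01; have [-> _ _ _] := B2 s s01; have [-> _ _ _] := T2 s s01.
    have [-> _ _ _] := L2 s s01; have [-> _ _ _] := R2 s s01.
    by rewrite /h /eh /ev /= !addr0 !natr1.
  - move=> s s01; have [_ _ -> ->] := B2 s s01; have [_ _ -> ->] := T2 s s01.
    by have [_ _ -> ->] := L2 s s01; have [_ _ -> ->] := R2 s s01.
  have [_ _ g2] := gJ [:: a i j] isT.
  have [|K [KA KE]] := g2 C CX.
    apply/frameP => s s01; have [-> -> -> ->] := CE s s01.
    have [_ ? _ _] := B2 s s01; have [_ ? _ _] := T2 s s01.
    by have [_ ? _ _] := L2 s s01; have [_ ? _ _] := R2 s s01.
  exists K; split; first by apply: square_inS KA; apply: setSI; exact: UJX.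
  move=> s s01; have [-> -> -> ->] := (frameP (fun z => K z = C z)).2 KE s s01.
  exact: CE.
have [F [FA FE]] := grid_fill cell (leqnn (0 + n)) (leqnn (0 + n)).
exists F; split => //; apply/frameP => s s01.
have HAs := (frameP (fun z => A (H z))).2 HA.
have nn : (n%:R : R) / n%:R = 1 by rewrite divff // gt_eqF.
have ns : (0%N%:R + n%:R * s) / n%:R = s by rewrite add0r mulrAC divff ?mul1r // gt_eqF.
have [-> -> -> ->] := FE s s01; rewrite !add0n.
(* Edges on the outer boundary lie in [A], so they were left unchanged. *)
have p0 (i : nat) : (i < n)%N -> forall s : R, 0 <= s <= 1 ->
    qh i 0%N s = H ((i%:R + s) / n%:R, 0).
  move=> iN u u01; have [_ _ /(_ _ u u01)] := Dh'P (i, 0%N) iN isT.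
  rewrite /qh /eh /= mul0r; apply => w w01.
  by have [] := HAs _ (rng i w iN w01).
have pn (i : nat) : (i < n)%N -> forall s : R, 0 <= s <= 1 ->
    qh i n s = H ((i%:R + s) / n%:R, 1).
  move=> iN u u01; have [_ _ /(_ _ u u01)] := Dh'P (i, n) iN (leqnn n).
  rewrite /qh /eh /= nn; apply => w w01.
  by have [] := HAs _ (rng i w iN w01).
have w0 (i : nat) : (i < n)%N -> forall s : R, 0 <= s <= 1 ->
    qv 0%N i s = H (0, (i%:R + s) / n%:R).
  move=> iN u u01; have [_ _ /(_ _ u u01)] := Dv'P (0%N, i) isT iN.
  rewrite /qv /ev /= mul0r; apply => w w01.
  by have [] := HAs _ (rng i w iN w01).
have wn (i : nat) : (i < n)%N -> forall s : R, 0 <= s <= 1 ->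
    qv n i s = H (1, (i%:R + s) / n%:R).
  move=> iN u u01; have [_ _ /(_ _ u u01)] := Dv'P (n, i) (leqnn n) iN.
  rewrite /qv /ev /= nn; apply => w w01.
  by have [] := HAs _ (rng i w iN w01).
split.
- by rewrite (iter_cat_pieces (p := fun x => H (x, 0)) n0 p0) // ns.
- by rewrite (iter_cat_pieces (p := fun x => H (x, 1)) n0 pn) // ns.
- by rewrite (iter_cat_pieces (p := fun x => H (0, x)) n0 w0) // ns.
- by rewrite (iter_cat_pieces (p := fun x => H (1, x)) n0 wn) // ns.
Qed.

End cover.

Lemma good_cover (T : eqType) (X A : set V) (U : T -> set V) :
  (forall i, open (U i)) -> (forall v, X v -> exists i, U i v) ->
  (forall J : seq T, J != [::] ->
     good R (X `&` [set v | {in J, forall i, U i v}]) A) -> good R X A.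
Proof.
move=> oU XU gJ; split.
- by apply: (reaches_cover (U := U)) => // i; have [] := gJ [:: i] isT.
- apply: (compresses_paths_cover (U := U)) => // [i j|i].
    by have [] := gJ [:: i; j] isT.
  by have [] := gJ [:: i] isT.
- exact: (compresses_squares_cover (U := U)).
Qed.

End van_Kampen.

(** * The sphere *)

Section vectors.
Context {R : realType}.

Lemma cont_coord {X : topologicalType} m (f : X -> 'rV[R]_m.+1) i :
  continuous f -> continuous (fun x => f x 0 i).
Proof.
move=> cf; apply: (@continuous_compose _ _ _ f (fun M : 'rV[R]_m.+1 => M 0 i)) => //.
exact: coord_continuous.
Qed.

Lemma cont_dotp {X : topologicalType} m (f g : X -> 'rV[R]_m.+1) :
  continuous f -> continuous g -> continuous (fun x => dotp (f x) (g x)).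
Proof.
move=> cf cg; under eq_fun do rewrite dotpE.
apply: (@cont_sum R X R^o _ _ _ (fun i x => f x 0 i * g x 0 i)) => i.
by apply: cont_mul; exact: cont_coord.
Qed.

Lemma dotp0l m (u : 'rV[R]_m) : dotp 0 u = 0.
Proof. by rewrite -(scale0r 0) dotpZl mul0r. Qed.

Lemma dotp_gt0 m (u : 'rV[R]_m) : u != 0 -> 0 < dotp u u.
Proof.
move=> u0; rewrite lt_def dotp_ge0 andbT; apply: contra u0 => /eqP.
by move=> /dotp_eq0 ->.
Qed.

Lemma dotp3E (u v : 'rV[R]_3) :
  dotp u v = u 0 0 * v 0 0 + u 0 1 * v 0 1 + u 0 2 * v 0 2.
Proof.
rewrite dotpE !big_ord_recl big_ord0 addr0 addrA.
have -> : lift ord0 ord0 = 1 :> 'I_3 by apply: val_inj.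
by have -> : lift ord0 (lift ord0 ord0) = 2 :> 'I_3 by apply: val_inj.
Qed.

Definition normalize (v : 'rV[R]_3) : 'rV[R]_3 := (Num.sqrt (dotp v v))^-1 *: v.

Definition unit_sphere : set 'rV[R]_3 := [set u | dotp u u = 1].

Lemma sqrt_dotp_gt0 (v : 'rV[R]_3) : v != 0 -> 0 < Num.sqrt (dotp v v).
Proof. by move=> v0; rewrite sqrtr_gt0 dotp_gt0. Qed.

Lemma normalize_unit (v : 'rV[R]_3) : v != 0 -> unit_sphere (normalize v).
Proof.
move=> v0; rewrite /unit_sphere /= /normalize dotpZl dotpZr mulrA -expr2 exprVn.
by rewrite sqr_sqrtr ?dotp_ge0 // mulVf // gt_eqF // dotp_gt0.
Qed.

Lemma normalize_id (v : 'rV[R]_3) : unit_sphere v -> normalize v = v.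
Proof. by rewrite /unit_sphere /= /normalize => ->; rewrite sqrtr1 invr1 scale1r. Qed.

Lemma normalize_continuous {X : topologicalType} (f : X -> 'rV[R]_3) :
  continuous f -> (forall x, f x != 0) -> continuous (fun x => normalize (f x)).
Proof.
move=> cf f0; apply: cont_scale => //; apply: cont_inv.
  by move=> x; rewrite gt_eqF // sqrt_dotp_gt0.
by apply: cont_sqrt; exact: cont_dotp.
Qed.

Definition vec3 (a b c : R) : 'rV[R]_3 := \row_i [:: a; b; c]`_i.

Lemma vec3E (a b c : R) :
  (vec3 a b c 0 0 = a) * (vec3 a b c 0 1 = b) * (vec3 a b c 0 2 = c).
Proof. by rewrite !mxE. Qed.

Lemma e_xE : e_x = vec3 1 0 0.
Proof. by apply/rowP => i; rewrite !mxE; case: i => [[|[|[|i]]] ?]. Qed.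

Lemma conv_gt0 (a b t : R) : 0 <= t <= 1 -> 0 < a -> 0 < b ->
  0 < (1 - t) * a + t * b.
Proof.
move=> /andP[t0 t1] a0 b0; have [->|tn0] := eqVneq t 0.
  by rewrite subr0 mul1r mul0r addr0.
apply: ltr_wpDl; first by rewrite mulr_ge0 ?subr_ge0 // ltW.
by rewrite mulr_gt0 // lt_def tn0.
Qed.

Lemma conv_lt0 (a b t : R) : 0 <= t <= 1 -> a < 0 -> b < 0 ->
  (1 - t) * a + t * b < 0.
Proof.
move=> t01 a0 b0; have := @conv_gt0 (- a) (- b) t t01.
by rewrite !oppr_gt0 !mulrN -opprD oppr_gt0; apply.
Qed.

(** Contraction along segments towards [a], projected radially to the sphere. The cone [C] keeps the
    segments away from the origin and is not left by the projection. *)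
Lemma cone_square (S C : set 'rV[R]_3) (p : R -> 'rV[R]_3) (a : 'rV[R]_3) :
  (forall v, C v -> v != 0) -> (forall v (k : R), 0 < k -> C v -> C (k *: v)) ->
  path_in (unit_sphere `&` S) p ->
  (forall s t : R, 0 <= s <= 1 -> 0 <= t <= 1 -> C ((1 - t) *: p s + t *: a)) ->
  exists D, square_in (unit_sphere `&` C) D /\ forall s : R, 0 <= s <= 1 ->
    [/\ D (s, 0) = p s, D (s, 1) = normalize a,
        D (0, s) = normalize ((1 - s) *: p 0 + s *: a) &
        D (1, s) = normalize ((1 - s) *: p 1 + s *: a)].
Proof.
move=> C0 CZ [cp pS] HC.
pose f (z : R * R) := (1 - unitclamp z.2) *: p (unitclamp z.1) + unitclamp z.2 *: a.
have fC z : C (f z) by apply: HC; exact: unitclamp01.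
have cf : continuous f.
  apply: cont_add; last by apply: cont_scale; cont.
  by apply: cont_scale; [cont|apply: continuous_compose cp; cont].
exists (fun z => normalize (f z)); split.
  split; first by apply: normalize_continuous => // z; exact: C0.
  move=> z _; split; first by apply: normalize_unit; exact: C0.
  by apply: CZ => //; rewrite invr_gt0 sqrt_dotp_gt0 // C0.
have cl := (unitclamp_id (@unit0 R), unitclamp_id (@unit1 R)).
move=> s s01; rewrite /f /= !cl unitclamp_id //; split=> //.
  by rewrite subr0 scale1r scale0r addr0 normalize_id //; have [] := pS s s01.
by rewrite subrr scale0r add0r scale1r.
Qed.

(** On the sphere, [P] is the complement of [- e_x] and [N] the open hemisphere around [- e_x]. The
    loop is compressed into a part [A] of [P] and then contracted to [e_x] within [P]. The condition
    on the last coordinate in [A] is there because [P] and [N] meet in a punctured disk, where a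
    segment to a fixed point may hit the puncture; within half of it, segments towards
    [vec3 (-1) 0 1] do not. *)
Lemma sphere_loop (p : R -> 'rV[R]_3) : path_in unit_sphere p ->
  p 0 = e_x -> p 1 = e_x ->
  exists H, square_in unit_sphere H /\ forall s : R, 0 <= s <= 1 ->
    [/\ H (s, 0) = p s, H (s, 1) = e_x, H (0, s) = e_x & H (1, s) = e_x].
Proof.
pose P : set 'rV[R]_3 := [set v : 'rV[R]_3 | [\/ 0 < v 0 0, v 0 1 != 0 | v 0 2 != 0]].
pose N : set 'rV[R]_3 := [set v : 'rV[R]_3 | v 0 0 < 0].
pose U (b : bool) := if b then P else N.
pose A : set 'rV[R]_3 := [set v : 'rV[R]_3 | 0 <= v 0 2] `&` P.
have c i : continuous (fun v : 'rV[R]_3 => v 0 i) by apply: cont_coord; exact: cont_id.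
have oP : open P.
  have -> : P = [set v : 'rV[R]_3 | 0 < v 0 0] `|` ([set v : 'rV[R]_3 | v 0 1 != 0] `|` [set v : 'rV[R]_3 | v 0 2 != 0]).
    apply/seteqP; split => v; first by case; [left|right; left|right; right].
    by case=> [?|[?|?]]; [exact: Or31|exact: Or32|exact: Or33].
  apply: openU; last apply: openU.
  - by apply: (@lt_open R _ (fun=> 0)); [exact: cst_continuous|exact: c].
  - by apply: (@neq_open R _ _ (fun=> 0)); [exact: c|exact: cst_continuous].
  - by apply: (@neq_open R _ _ (fun=> 0)); [exact: c|exact: cst_continuous].
have oN : open N.
  by apply: (@lt_open R _ _ (fun=> 0)); [exact: c|exact: cst_continuous].
have oU b : open (U b) by case: b.
have cov v : unit_sphere v -> exists b, U b v.
  rewrite /unit_sphere /= dotp3E => v1.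
  have [x0|x0|x0] := ltgtP (v 0 0) 0; [by exists false|by exists true; exact: Or31|].
  exists true; have [y0|y0] := eqVneq (v 0 1) 0; last exact: Or32.
  apply: Or33; apply/eqP => z0; move: v1.
  by rewrite x0 y0 z0 !mul0r !addr0 => /eqP; rewrite eq_sym oner_eq0.
pose L (u a : 'rV[R]_3) (t : R) := (1 - t) *: u + t *: a.
have LE u a t i : L u a t 0 i = (1 - t) * u 0 i + t * a 0 i by rewrite !mxE.
have Z0 (v : 'rV[R]_3) i : v 0 i != 0 -> v != 0.
  by apply: contra => /eqP ->; rewrite mxE.
have P0 v : P v -> v != 0.
  case; last 2 first.
  - exact: Z0.
  - exact: Z0.
  by move=> v0; apply: (Z0 _ 0); rewrite gt_eqF.
have N0 v : N v -> v != 0.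
  by move=> v0; apply: (Z0 _ 0); rewrite lt_eqF.
have PZ v (k : R) : 0 < k -> P v -> P (k *: v).
  move=> k0; rewrite /P /= !mxE; case=> [v0|v0|v0].
  - by apply: Or31; rewrite mulr_gt0.
  - by apply: Or32; rewrite mulf_neq0 // gt_eqF.
  - by apply: Or33; rewrite mulf_neq0 // gt_eqF.
have NZ v (k : R) : 0 < k -> N v -> N (k *: v).
  by move=> k0 v0; rewrite /N /= !mxE pmulr_rlt0.
have AZ v (k : R) : 0 < k -> A v -> A (k *: v).
  by move=> k0 [v0 Pv]; split; [rewrite /= mxE mulr_ge0 // ltW|exact: PZ].
have U0 b v : U b v -> v != 0 by case: b; [exact: P0|exact: N0].
have UZ b v (k : R) : 0 < k -> U b v -> U b (k *: v).
  by case: b; [exact: PZ|exact: NZ].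
have An v : A v -> A (normalize v).
  by move=> Av; apply: AZ => //; rewrite invr_gt0 sqrt_dotp_gt0 // P0 //; case: Av.
pose UJ (J : seq bool) := unit_sphere `&` [set v | {in J, forall b, U b v}].
have reach i j : reaches R (UJ [:: i; j]) A.
  move=> u [u1 uU].
  have [Au|nAu] := pselect (A u).
    by exists (fun=> u); split => //; split; [cont|].
  have line a : A a -> (forall b (t : R), b \in [:: i; j] -> 0 <= t <= 1 ->
      U b (L u a t)) -> exists p : R -> _,
      [/\ path_in (UJ [:: i; j]) p, p 0 = u & A (p 1)].
    move=> Aa Ua.
    have [|||s t s01 t01|D [[cD DC] DE]] := @cone_square setT
        [set v | {in [:: i; j], forall b, U b v}] (fun=> u) a.
    - by move=> v /(_ i); rewrite !inE eqxx => /(_ isT); exact: U0.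
    - by move=> v k k0 Uv b bJ; apply: UZ => //; exact: Uv.
    - by split; [cont|split].
    - by move=> b bJ; exact: Ua.
    exists (fun t => D (0, t)); split.
    - split; first by apply: continuous_compose cD; cont.
      by move=> t t01; apply: DC; rewrite /usq /= unit0.
    - by have [-> _ _ _] := DE 0 (@unit0 R).
    - by have [_ -> _ _] := DE 0 (@unit0 R); exact: An.
  have [ij|/norP[]] := boolP (i || j); last first.
    case: i j uU line => [] // [] // uU line _ _.
    apply: (line (vec3 (-1) 0 1)).
      by split; rewrite /= ?vec3E ?ler01 //; apply: Or33; rewrite vec3E oner_neq0.
    move=> b t bJ t01; have := uU b bJ; have -> : b = false.
      by move: bJ; rewrite !inE => /orP[]/eqP.
    rewrite /U /N /= LE vec3E => ux.
    by apply: conv_lt0 => //; rewrite oppr_lt0.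
  have Pu : P u by apply: (uU true); rewrite !inE; case: (i) ij => //= ->.
  have z0 : u 0 2 < 0.
    by rewrite ltNge; apply/negP => z0; apply: nAu.
  (* Along this segment the last coordinate stays negative until the end, where the second one is
     nonzero; the first coordinate stays negative if it is so at the start. *)
  apply: (line (vec3 (-1) 1 0)).
    by split; rewrite /= ?vec3E //; apply: Or32; rewrite vec3E oner_neq0.
  move=> [] t bJ t01; have Ub := uU _ bJ.
    have [->|t1] := eqVneq t 1.
      by apply: Or32; rewrite LE vec3E subrr mul0r add0r mulr1 oner_neq0.
    apply: Or33; rewrite LE vec3E mulr0 addr0; apply: mulf_neq0.
      by rewrite subr_eq0 eq_sym.
    by rewrite lt_eqF.
  move: Ub; rewrite /U /N /= LE vec3E => ux.
  by apply: conv_lt0 => //; rewrite oppr_lt0.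
have compr b : compresses_paths R (UJ [:: b]) A.
  move=> q [cq qU] A0 A1.
  have qS : path_in (unit_sphere `&` setT) q by split => // t /qU[].
  pose a := if b then vec3 1 0 0 else vec3 (-1) 0 1.
  have Aa : A a.
    rewrite /a; case: b {qU qS a} ; split; rewrite /= ?vec3E //.
    - by apply: Or31; rewrite vec3E ltr01.
    - by apply: Or33; rewrite vec3E oner_neq0.
  have Ub u (t : R) : 0 <= t <= 1 -> U b u -> U b (L u a t).
    rewrite /a; case: b {qU qS a Aa} => t01 /=.
      have [->|t1] := eqVneq t 1.
        by move=> _; apply: Or31; rewrite LE vec3E subrr mul0r add0r mulr1 ltr01.
      have t1' : 1 - t != 0 by rewrite subr_eq0 eq_sym.
      case=> [x0|y0|z0].
      - by apply: Or31; rewrite LE vec3E; exact: conv_gt0.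
      - by apply: Or32; rewrite LE vec3E mulr0 addr0 mulf_neq0.
      - by apply: Or33; rewrite LE vec3E mulr0 addr0 mulf_neq0.
    by rewrite /U /N /= LE vec3E => ux; apply: conv_lt0 => //; rewrite oppr_lt0.
  have Al u (t : R) : 0 <= t <= 1 -> A u -> A (L u a t).
    move=> t01 [u0 Pu].
    have [t0|t0] := eqVneq t 0; first by rewrite /L t0 subr0 scale1r scale0r addr0; split.
    split; first by rewrite /= LE /a; case: (b); rewrite vec3E;
      rewrite addr_ge0 // mulr_ge0 // ?subr_ge0; by case/andP: t01.
    rewrite /a; case: b {qU qS a Aa Ub} => /=.
      have [->|t1] := eqVneq t 1.
        by apply: Or31; rewrite LE vec3E subrr mul0r add0r mulr1 ltr01.
      have t1' : 1 - t != 0 by rewrite subr_eq0 eq_sym.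
      case: Pu => [x0|y0|z0].
      - by apply: Or31; rewrite LE vec3E; exact: conv_gt0.
      - by apply: Or32; rewrite LE vec3E mulr0 addr0 mulf_neq0.
      - by apply: Or33; rewrite LE vec3E mulr0 addr0 mulf_neq0.
    apply: Or33; rewrite LE vec3E mulr1 gt_eqF //.
    have tp : 0 < t by rewrite lt_def t0; case/andP: t01.
    by rewrite ltr_wpDl // mulr_ge0 // subr_ge0; case/andP: t01.
  have qU' (s : R) : 0 <= s <= 1 -> U b (q s).
    by move=> /qU[_]; apply; rewrite inE.
  have [|||s t s01 t01|D [[cD DC] DE]] := @cone_square setT (U b) q a.
  - by move=> v; exact: U0.
  - by move=> v k; exact: UZ.
  - by [].
  - by apply: Ub => //; exact: qU'.
  exists D; split.
  - split => // z uz; have [? ?] := DC z uz; split => // b'.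
    by rewrite inE => /eqP ->.
  - by move=> s s01; have [-> _ _ _] := DE s s01.
  - by move=> s s01; have [_ -> _ _] := DE s s01; exact: An.
  - by move=> t t01; have [_ _ -> ->] := DE t t01; split; apply/An/Al.
have cp := compresses_paths_cover oU cov reach compr.
move=> pS p0 p1.
have ex1 : unit_sphere e_x by exact: e_x_unit.
have Aex : A e_x.
  by split; rewrite /= e_xE ?vec3E //; apply: Or31; rewrite vec3E ltr01.
have cst_in : path_in unit_sphere (fun _ : R => e_x) by split; [cont|].
have [||||D [[cD DS] DE]] := edge_square cp pS cst_in cst_in => //.
pose q (s : R) := D (unitclamp s, 1).
have qS : path_in (unit_sphere `&` setT) q.
  split; first by apply: continuous_compose cD; cont.
  by move=> s s01; split => //; apply: DS; rewrite /usq /= unitclamp01 unit1.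
have qA s : P (q s) by have [_ [_ Pq] _ _] := DE _ (unitclamp01 s); exact: Pq.
have [|||s t s01 t01|K [KS KE]] := @cone_square setT P q e_x.
- exact: P0.
- exact: PZ.
- by [].
- have [->|t1] := eqVneq t 1.
    by apply: Or31; rewrite -/(L _ _ _) LE e_xE vec3E subrr mul0r add0r mulr1 ltr01.
  have t1' : 1 - t != 0 by rewrite subr_eq0 eq_sym.
  have := qA s; rewrite e_xE -/(L _ _ _); case=> [x0|y0|z0].
  + by apply: Or31; rewrite LE vec3E; exact: conv_gt0.
  + by apply: Or32; rewrite LE vec3E mulr0 addr0 mulf_neq0.
  + by apply: Or33; rewrite LE vec3E mulr0 addr0 mulf_neq0.
have cl := (unitclamp_id (@unit0 R), unitclamp_id (@unit1 R)).
have q0 : q 0 = e_x by rewrite /q cl; have [_ _ -> _] := DE 1 (@unit1 R).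
have q1 : q 1 = e_x by rewrite /q cl; have [_ _ _ ->] := DE 1 (@unit1 R).
have le2 : (0 <= 2^-1 :> R) by rewrite invr_ge0 ler0n.
have ge2 : (1 <= 2^-1 :> R) = false by apply/negbTE; rewrite -ltNge; lra.
exists (vcat D K); split.
  apply: vcat_in => //; first by apply: square_inS KS => v [].
  by move=> t t01; have [-> _ _ _] := KE t t01; rewrite /q unitclamp_id.
have exL (t : R) : (1 - t) *: e_x + t *: e_x = e_x :> 'rV[R]_3.
  by rewrite -scalerDl subrK scale1r.
move=> s s01; rewrite /vcat /= le2 ge2 mulr0 mulr1 addrK !cl unitclamp_id //.
have [-> _ _ _] := DE s s01; have [_ -> _ _] := KE s s01.
rewrite normalize_id //; split => //; (case: ifPn => s2; last rewrite -ltNge in s2).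
- have s2' : 0 <= 2 * s <= 1 by move: s01 s2; clear; lra.
  by have [_ _ -> _] := DE _ s2'.
- have s2' : 0 <= 2 * s - 1 <= 1 by move: s01 s2; clear; lra.
  by have [_ _ -> _] := KE _ s2'; rewrite q0 exL normalize_id.
- have s2' : 0 <= 2 * s <= 1 by move: s01 s2; clear; lra.
  by have [_ _ _ ->] := DE _ s2'.
- have s2' : 0 <= 2 * s - 1 <= 1 by move: s01 s2; clear; lra.
  by have [_ _ _ ->] := KE _ s2'; rewrite q1 exL normalize_id.
Qed.

(** The segment from [u] to [e_x] may pass through the origin if the first coordinate of [u] is not
    positive. A detour through [e_y] avoids this, unless [u] is [e_y] or its opposite, from which
    the segment to [e_x] is harmless. *)
Lemma sphere_connected (u : 'rV[R]_3) : unit_sphere u ->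
  exists p : R -> _, [/\ path_in unit_sphere p, p 0 = u & p 1 = e_x].
Proof.
have line (v a : 'rV[R]_3) : unit_sphere v ->
    (forall t : R, 0 <= t <= 1 -> (1 - t) *: v + t *: a != 0) ->
    exists p : R -> _, [/\ path_in unit_sphere p, p 0 = v & p 1 = normalize a].
  move=> v1 va.
  have [|||s t s01 t01|D [[cD DC] DE]] := @cone_square setT [set v : 'rV[R]_3 | v != 0] (fun=> v) a.
  - by [].
  - by move=> w k k0 w0; rewrite /= scaler_eq0 negb_or gt_eqF.
  - by split; [cont|split].
  - exact: va.
  exists (fun t => D (0, t)); split.
  - split; first by apply: continuous_compose cD; cont.
    by move=> t t01; have [] := DC (0, t); rewrite // /usq /= unit0.
  - by have [-> _ _ _] := DE 0 (@unit0 R).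
  - by have [_ -> _ _] := DE 0 (@unit0 R).
have Z0 (v : 'rV[R]_3) i : v 0 i != 0 -> v != 0.
  by apply: contra => /eqP ->; rewrite mxE.
have ex1 : unit_sphere (e_x : 'rV[R]_3) by exact: e_x_unit.
have toex v : unit_sphere v -> 0 <= v 0 0 -> v 0 1 != 0 \/ 0 < v 0 0 ->
    exists p : R -> _, [/\ path_in unit_sphere p, p 0 = v & p 1 = e_x].
  move=> v1 x0 xy; have [|p [pS p0 p1]] := line v e_x v1.
    move=> t t01; have [->|t1] := eqVneq t 1.
      by rewrite subrr scale0r add0r scale1r e_xE; apply: (Z0 _ 0); rewrite vec3E oner_neq0.
    have t1' : 1 - t != 0 by rewrite subr_eq0 eq_sym.
    case: xy => [y0|x0'].
      by apply: (Z0 _ 1); rewrite e_xE !mxE /= mulr0 addr0 mulf_neq0.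
    by apply: (Z0 _ 0); rewrite e_xE !mxE /= gt_eqF //; exact: conv_gt0.
  by exists p; split => //; rewrite p1 normalize_id.
move=> u1; have [xp|xn] := ltP 0 (u 0 0); first by apply: toex => //; [exact: ltW|right].
pose e_y := vec3 0 1 0 : 'rV[R]_3.
have ey1 : unit_sphere e_y.
  by rewrite /unit_sphere /= dotp3E !vec3E !mulr0 !mulr1 add0r addr0.
have [xz|] := boolP ((u 0 0 != 0) || (u 0 2 != 0)).
  have [|p [pS p0 p1]] := line u e_y u1.
    move=> t t01; have [->|t1] := eqVneq t 1.
      rewrite subrr scale0r add0r scale1r; apply: (Z0 _ 1).
      by rewrite vec3E oner_neq0.
    have t1' : 1 - t != 0 by rewrite subr_eq0 eq_sym.
    case/orP: xz => y0.
      by apply: (Z0 _ 0); rewrite !mxE /= mulr0 addr0 mulf_neq0.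
    by apply: (Z0 _ 2); rewrite !mxE /= mulr0 addr0 mulf_neq0.
  have [||q [qS q0 q1]] := toex e_y ey1; first by rewrite vec3E.
    by left; rewrite vec3E oner_neq0.
  have pq : p 1 = q 0 by rewrite p1 q0 normalize_id.
  by exists (pcat p q); split; [exact: pcat_in|rewrite pcat0|rewrite pcat1].
rewrite negb_or !negbK => /andP[/eqP x0 /eqP z0].
apply: toex => //; first by rewrite x0.
left; apply/eqP => y0; move: u1; rewrite /unit_sphere /= dotp3E x0 y0 z0.
by rewrite !mul0r !addr0 => /eqP; rewrite eq_sym oner_eq0.
Qed.

End vectors.

(** * Rings as hemispheres *)

Section families.
Context {R : realType}.

Lemma cont_family {X T : topologicalType} n (f : X -> {ptws 'I_n -> T}) :
  (forall i, continuous (fun x => f x i)) -> continuous f.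
Proof.
move=> cf x; have FF : Filter (f @ x) by apply: fmap_filter; exact: nbhs_filter.
apply/cvg_sup => i; pose ev := fun u : 'I_n -> T => u i.
have c : continuous (f : X -> initial_topology ev).
  exact: (@continuous_comp_initial _ X T ev f (cf i)).
exact: c.
Qed.

Lemma cont_proj {X T : topologicalType} n (f : X -> {ptws 'I_n -> T}) i :
  continuous f -> continuous (fun x => f x i).
Proof.
move=> cf; apply: (@continuous_compose _ _ _ f (fun s : {ptws 'I_n -> T} => s i) cf).
exact: (@proj_continuous _ (fun=> T) i).
Qed.

Definition update {T : Type} n (C : 'I_n -> T) k m : 'I_n -> T :=
  fun i => if i == k then m else C i.

Lemma update_same {T : Type} n (C : 'I_n -> T) k m : update C k m k = m.
Proof. by rewrite /update eqxx. Qed.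

Lemma update_other {T : Type} n (C : 'I_n -> T) k m i : i != k ->
  update C k m i = C i.
Proof. by rewrite /update => /negbTE ->. Qed.

Lemma cont_update {X T : topologicalType} n (f : X -> {ptws 'I_n -> T}) k
    (g : X -> T) : continuous f -> continuous g ->
  continuous (fun x => update (f x) k (g x) : {ptws 'I_n -> T}).
Proof.
move=> cf cg; apply: cont_family => i; rewrite /update.
by case: (i == k) => //; exact: cont_proj.
Qed.

End families.

(* A ring by its center, the square of its radius and a unit normal; a vanishing
   radius is allowed and stands for a point. *)
Notation ring_data R := ('rV[R]_3 * R * 'rV[R]_3)%type.

Section ring_data.
Context {R : realType}.
Local Notation rdata := (ring_data R).

Definition rcenter (a : rdata) : 'rV[R]_3 := a.1.1.
Definition rsquare (a : rdata) : R := a.1.2.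
Definition rnormal (a : rdata) : 'rV[R]_3 := a.2.

(** The power of [x] with respect to the sphere that has the ring as a great circle. Where it is at
    most zero in the plane of the ring, its negative is the squared height of the hemisphere over
    [x]. *)
Definition power (a : rdata) (x : 'rV[R]_3) : R :=
  dotp (x - rcenter a) (x - rcenter a) - rsquare a.

Definition height (a : rdata) (x : 'rV[R]_3) : R := dotp (x - rcenter a) (rnormal a).

(* [x] lies below a common point of the hemispheres of the upper half-space of
   dimension 4 that are spanned by the two rings. *)
Definition meets_over (a b : rdata) (x : 'rV[R]_3) : Prop :=
  [/\ height a x = 0, height b x = 0, power a x = power b x & power a x <= 0].

Definition separated (a b : rdata) : Prop := forall x, ~ meets_over a b x.

Lemma separated_sym (a b : rdata) : separated a b -> separated b a.
Proof.
by move=> ab x [ha hb pab pa]; apply: (ab x); split; rewrite -?pab.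
Qed.

Definition with_square (a : rdata) (s : R) : rdata := (rcenter a, s, rnormal a).

Lemma power_with (a : rdata) s x : power (with_square a s) x = power a x + rsquare a - s.
Proof. by rewrite /power /with_square /rcenter /rsquare /=; ring. Qed.

(** Both powers rise by [t], so their difference is unchanged: a common point of the smaller
    hemispheres at squared height [h] comes from one of the given hemispheres at squared height
    [h + t]. *)
Lemma separated_shrink (a b : rdata) (t : R) : 0 <= t -> separated a b ->
  separated (with_square a (rsquare a - t)) (with_square b (rsquare b - t)).
Proof.
move=> t0 ab x [ha hb]; rewrite !power_with => pab pa; apply: (ab x).
by split => //; lra.
Qed.

(** A polynomial substitute for the distance to the ring, continuous in the ring as well and
    meaningful for points. *)
Definition gap (b : rdata) (x : 'rV[R]_3) : R := power b x ^+ 2 + height b x ^+ 2.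

Lemma gap_ge0 b x : 0 <= gap b x.
Proof. by rewrite addr_ge0 ?sqr_ge0. Qed.

Lemma gap_eq0 b x : gap b x = 0 <-> power b x = 0 /\ height b x = 0.
Proof.
split => [/eqP|[p0 h0]]; last by rewrite /gap p0 h0 expr0n addr0.
by rewrite paddr_eq0 ?sqr_ge0 // !sqrf_eq0 => /andP[/eqP -> /eqP ->].
Qed.

(** The hemisphere of a point is this point at height zero, where another hemisphere reduces to its
    ring. *)
Lemma separated_point (a b : rdata) : rsquare a = 0 ->
  separated a b <-> gap b (rcenter a) != 0.
Proof.
move=> a0; split => [ab|g0 x [ha hb pab pa]].
  apply/eqP => /gap_eq0[p0 h0]; apply: (ab (rcenter a)).
  by rewrite /meets_over p0 h0 /power /height subrr a0 !dotp0l subr0.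
move: pa pab; rewrite {1 2}/power a0 subr0 => pa.
have d0 : dotp (x - rcenter a) (x - rcenter a) = 0.
  by apply/eqP; rewrite eq_le pa dotp_ge0.
have /eqP := dotp_eq0 d0; rewrite subr_eq0 => /eqP xa.
rewrite d0 => p0; move/eqP: g0; apply; apply/gap_eq0.
by rewrite -xa -p0 hb.
Qed.

Section continuity.
Context {X : topologicalType}.

Lemma cont_rcenter (f : X -> rdata) : continuous f -> continuous (fun x => rcenter (f x)).
Proof. by move=> cf; rewrite /rcenter; cont. Qed.

Lemma cont_rsquare (f : X -> rdata) : continuous f -> continuous (fun x => rsquare (f x)).
Proof. by move=> cf; rewrite /rsquare; cont. Qed.

Lemma cont_rnormal (f : X -> rdata) : continuous f -> continuous (fun x => rnormal (f x)).
Proof. by move=> cf; rewrite /rnormal; cont. Qed.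

Lemma cont_with_square (f : X -> rdata) (g : X -> R) : continuous f ->
  continuous g -> continuous (fun x => with_square (f x) (g x)).
Proof.
move=> cf cg; rewrite /with_square.
by cont; [exact: cont_rcenter|exact: cont_rnormal].
Qed.

Lemma cont_power (f : X -> rdata) (g : X -> 'rV[R]_3) :
  continuous f -> continuous g -> continuous (fun x => power (f x) (g x)).
Proof.
move=> cf cg; rewrite /power; cont; last exact: cont_rsquare.
by apply: cont_dotp; cont; exact: cont_rcenter.
Qed.

Lemma cont_height (f : X -> rdata) (g : X -> 'rV[R]_3) :
  continuous f -> continuous g -> continuous (fun x => height (f x) (g x)).
Proof.
move=> cf cg; rewrite /height; apply: cont_dotp; last exact: cont_rnormal.
by cont; exact: cont_rcenter.
Qed.

Lemma cont_gap (f : X -> rdata) (g : X -> 'rV[R]_3) :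
  continuous f -> continuous g -> continuous (fun x => gap (f x) (g x)).
Proof. by move=> cf cg; rewrite /gap; cont; [exact: cont_power|exact: cont_height]. Qed.

End continuity.

Lemma box_compact (M : R) : compact [set x : 'rV[R]_3 | forall i, x 0 i \in `[- M, M]].
Proof.
have := @rV_compact R 3 (fun=> `[- M, M]%classic) (fun _ => @segment_compact _ _ _).
by congr compact; apply/seteqP; split => x /= H i; have := H i; rewrite inE.
Qed.

(** The estimate [|d| <= d ^+ 2 + 1] for the distance [d] to the center in one coordinate avoids
    square roots. *)
Lemma power_box (a : rdata) (x : 'rV[R]_3) i : power a x <= 0 ->
  `|x 0 i| <= `|rcenter a 0 i| + rsquare a + 1.
Proof.
rewrite /power subr_le0 dotpE (bigD1 i) //= => xa.
have sq : (x 0 i - rcenter a 0 i) ^+ 2 <= rsquare a.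
  apply: le_trans xa; rewrite !mxE -expr2 lerDl sumr_ge0 // => j _.
  by rewrite -expr2 sqr_ge0.
have -> : x 0 i = rcenter a 0 i + (x 0 i - rcenter a 0 i) by rewrite addrC subrK.
rewrite -addrA (le_trans (ler_normD _ _)) // lerD2l.
move: sq; set d := _ - _ => sq; rewrite ler_norml.
have := sqr_ge0 (d - 1); have := sqr_ge0 (d + 1); rewrite !expr2 in sq *; nra.
Qed.

(** Points over which rings close to [a] and [b] could meet lie in a fixed compact box, and they are
    zeros of a continuous function of the point and the two rings that has no zero for [(a, b)]. *)
Lemma separated_open : open [set ab : rdata * rdata | separated ab.1 ab.2].
Proof.
rewrite openE => -[a b] /= ab; rewrite /interior.
pose f (w : 'rV[R]_3 * (rdata * rdata)) : R :=
  `|height w.2.1 w.1| + `|height w.2.2 w.1| + `|power w.2.1 w.1 - power w.2.2 w.1|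
  + Num.max 0 (power w.2.1 w.1).
have cf : continuous f.
  rewrite /f; cont; first [apply: cont_height|apply: cont_power]; cont.
have fP a' b' x : meets_over a' b' x -> f (x, (a', b')) = 0.
  move=> [ha hb pab pa]; rewrite /f /= ha hb pab subrr !normr0 !add0r.
  by rewrite max_l // -pab.
have f0 x : f (x, (a, b)) != 0.
  apply/eqP => fx; apply: (ab x); move: fx; rewrite /f /=.
  have := normr_ge0 (height a x); have := normr_ge0 (height b x).
  have := normr_ge0 (power a x - power b x).
  have m0 : 0 <= Num.max 0 (power a x) by rewrite le_max lexx.
  move=> n1 n2 n3 s0.
  have z1 : `|height a x| = 0 by lra.
  have z2 : `|height b x| = 0 by lra.
  have z3 : `|power a x - power b x| = 0 by lra.
  have z4 : Num.max 0 (power a x) = 0 by lra.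
  split.
  - exact/eqP/normr0P.
  - exact/eqP/normr0P.
  - by apply/eqP; rewrite -subr_eq0; exact/normr0P.
  - by rewrite -[leRHS]z4 le_max lexx orbT.
(* The 3 allows for a change of the center by 1, of the squared radius by 1, and for the 1 in
   [power_box]. *)
pose M : R := \sum_i `|rcenter a 0 i| + rsquare a + 3.
have /compact_near_coveringP cov := @box_compact M.
have near1 : \forall ab' \near (a, b), forall x : 'rV[R]_3,
    (forall i, x 0 i \in `[- M, M]) -> f (x, ab') != 0.
  apply: (cov _ (nbhs (a, b)) (fun ab' x => f (x, ab') != 0)) => x _.
  have op : open [set w : 'rV[R]_3 * (rdata * rdata) | f w != 0].
    by apply: (@neq_open R _ _ (fun=> 0)) => //; exact: cst_continuous.
  have nb : nbhs (x, (a, b)) [set w | f w != 0].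
    by apply: open_nbhs_nbhs; split => //; exact: f0.
  by case: nb => -[A B] [/= nA nB] AB; exists (A, B) => // -[x' ab'] ?; exact: AB.
have near2 : \forall ab' \near (a, b),
    forall i, `|rcenter ab'.1 0 i| < `|rcenter a 0 i| + 1.
  have FF : Filter (nbhs (a, b)) by exact: nbhs_filter.
  refine (@filter_forall _ 'I_3
    (fun i (w : rdata * rdata) => `|rcenter w.1 0 i| < `|rcenter a 0 i| + 1) _ FF _) => i.
    have op : open [set w : rdata * rdata | `|rcenter w.1 0 i| < `|rcenter a 0 i| + 1].
      apply: lt_open; last exact: cst_continuous.
      by apply: cont_norm; apply: cont_coord; apply: cont_rcenter; cont.
    by apply: open_nbhs_nbhs; split => //=; rewrite ltrDl ltr01.
have near3 : \forall ab' \near (a, b), rsquare ab'.1 < rsquare a + 1.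
  have op : open [set w : rdata * rdata | rsquare w.1 < rsquare a + 1].
    by apply: lt_open; [apply: cont_rsquare; cont|exact: cst_continuous].
  by apply: open_nbhs_nbhs; split => //=; rewrite ltrDl ltr01.
apply: filterS3 near1 near2 near3 => -[a' b'] /= fx cb sb x mx.
suff /fx/eqP : forall i : 'I_3, x 0 i \in `[- M, M] by apply; exact: fP.
move=> i; rewrite in_itv /= -ler_norml.
case: mx => _ _ _ /power_box - /(_ i) /le_trans; apply.
have ci : `|rcenter a 0 i| <= \sum_i `|rcenter a 0 i|.
  by rewrite (bigD1 i) //= lerDl sumr_ge0.
have := cb i; rewrite /M; move: ci sb; clear; lra.
Qed.

End ring_data.

Section configurations.
Context {R : realType} (n : nat).
Local Notation V := {ptws 'I_n -> ring_data R}.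
Implicit Types (C : V) (P S D : {set 'I_n}).

Definition pairwise_separated P : set V := [set C |
  forall i j, i \in P -> j \in P -> i != j -> separated (C i) (C j)].

Definition unit_normals P : set V := [set C |
  forall i, i \in P -> unit_sphere (rnormal (C i))].

Definition parallel_normals P : set V := [set C |
  forall i, i \in P -> rnormal (C i) = e_x].

(* Rings indexed by [S] and points indexed by [D]; other indices are free. *)
Definition configs S D : set V := [set C |
  [/\ forall i, i \in S -> 0 < rsquare (C i), forall i, i \in D -> rsquare (C i) = 0,
      unit_normals (S :|: D) C & pairwise_separated (S :|: D) C]].

Definition degenerate_configs S D : set V := [set C |
  [/\ forall i, i \in S -> 0 <= rsquare (C i), forall i, i \in D -> rsquare (C i) = 0,
      unit_normals (S :|: D) C & pairwise_separated (S :|: D) C]].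

Lemma pairwise_separated_open P : open (pairwise_separated P).
Proof.
rewrite openE => C sC; rewrite /interior.
suff : \forall C' \near C, forall i j : 'I_n, i \in P -> j \in P -> i != j ->
    separated (C' i) (C' j) by apply: filterS.
have FF : Filter (nbhs C) by exact: nbhs_filter.
refine (@filter_forall _ 'I_n (fun i (C' : V) => forall j : 'I_n,
  i \in P -> j \in P -> i != j -> separated (C' i) (C' j)) _ FF _) => i.
refine (@filter_forall _ 'I_n (fun j (C' : V) =>
  i \in P -> j \in P -> i != j -> separated (C' i) (C' j)) _ FF _) => j.
case: (boolP [&& i \in P, j \in P & i != j]) => [/and3P[iP jP ij]|/and3P nP]; last first.
  by apply: filterE => C' iP jP ij; case: nP.
have c : continuous (fun C' : V => (C' i, C' j)).
  by apply: continuous_pairing; apply: (@cont_proj V _ n (fun C' => C')); exact: cont_id.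
have : nbhs C ((fun C' : V => (C' i, C' j)) @^-1` [set ab | separated ab.1 ab.2]).
  apply: c; apply: open_nbhs_nbhs; split; first exact: separated_open.
  exact: sC.
by apply: filterS.
Qed.

End configurations.
Arguments configs R n S D : clear implicits.
Arguments degenerate_configs R n S D : clear implicits.
Arguments parallel_normals R n P : clear implicits.

(** * Transport *)

Section transport.
Context {R : realType}.

Definition lerp (z w : R * R) (t : R) : R * R :=
  ((1 - t) * z.1 + t * w.1, (1 - t) * z.2 + t * w.2).

Lemma lerp0 z w : lerp z w 0 = z.
Proof. by case: z => a b; rewrite /lerp /= subr0 !mul1r !mul0r !addr0. Qed.

Lemma lerp1 z w : lerp z w 1 = w.
Proof. by case: w => a b; rewrite /lerp /= subrr !mul1r !mul0r !add0r. Qed.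

Lemma lerp_usq z w (t : R) : usq z -> usq w -> 0 <= t <= 1 -> usq (lerp z w t).
Proof.
move=> /andP[z1 z2] /andP[w1 w2] t01.
by apply/andP; split; rewrite /=; apply/andP; split; nra.
Qed.

Lemma cont_lerp {X : topologicalType} (f g : X -> R * R) (t : X -> R) :
  continuous f -> continuous g -> continuous t ->
  continuous (fun x => lerp (f x) (g x) (t x)).
Proof. by move=> cf cg ct; rewrite /lerp; cont. Qed.

Lemma lerp_ball z w (s t e : R) : usq z -> usq w -> `|s - t| < e ->
  ball (lerp z w s) e (lerp z w t).
Proof.
move=> /andP[z1 z2] /andP[w1 w2] ste.
have H (a b : R) : 0 <= a <= 1 -> 0 <= b <= 1 ->
    `|((1 - s) * a + s * b) - ((1 - t) * a + t * b)| < e.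
  move=> a01 b01; apply: le_lt_trans ste.
  have -> : (1 - s) * a + s * b - ((1 - t) * a + t * b) = (s - t) * (b - a) by ring.
  by rewrite normrM ler_piMr // ler_norml; lra.
by split; apply: H.
Qed.

(* Small steps preserving [ok] compose to a transport along segments. *)
Lemma transport (E : topologicalType) (ok : R * R -> E -> Prop)
    (K : R * R -> R * R -> E -> E) (e0 : R) : 0 < e0 ->
  (forall z w e, usq z -> usq w -> ball z e0 w -> ok z e -> ok w (K z w e)) ->
  (forall (X : topologicalType) (z w : X -> R * R) (e : X -> E),
    continuous z -> continuous w -> continuous e ->
    (forall x, [/\ usq (z x), usq (w x), ball (z x) e0 (w x) & ok (z x) (e x)]) ->
    continuous (fun x => K (z x) (w x) (e x))) ->
  exists T : R * R -> R * R -> E -> E, [/\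
    forall z w e, usq z -> usq w -> ok z e -> ok w (T z w e),
    forall (X : topologicalType) (z w : X -> R * R) (e : X -> E),
      continuous z -> continuous w -> continuous e ->
      (forall x, [/\ usq (z x), usq (w x) & ok (z x) (e x)]) ->
      continuous (fun x => T (z x) (w x) (e x)) &
    forall z w e, (forall s t : R, 0 <= s <= 1 -> 0 <= t <= 1 ->
      K (lerp z w s) (lerp z w t) e = e) -> T z w e = e].
Proof.
move=> e0p Kok Kc; have [k ke] := dyadic_lt e0p.
pose n := (2 ^ k)%N; rewrite -/n in ke.
have n0 : (0 < n)%N by rewrite expn_gt0.
have nR : 0 < n%:R :> R by rewrite ltr0n.
(* [go m] has covered the fraction [m / n] of the segment from [z] to [w]. Continuity is tested
   along maps from arbitrary spaces because it is asserted only where [ok] holds. *)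
pose fix go (m : nat) (z w : R * R) (e : E) {struct m} : E :=
  if m is m'.+1 then K (lerp z w (m'%:R / n%:R)) (lerp z w (m'.+1%:R / n%:R)) (go m' z w e)
  else e.
have rng (m : nat) : (m <= n)%N -> 0 <= (m%:R : R) / n%:R <= 1.
  by move=> mn; rewrite divr_ge0 ?ler0n //= ler_pdivrMr // mul1r ler_nat.
have close z w m : usq z -> usq w -> (m.+1 <= n)%N ->
    ball (lerp z w (m%:R / n%:R)) e0 (lerp z w (m.+1%:R / n%:R)).
  move=> uz uw mn; apply: lerp_ball => //; rewrite -mulrBl -natr1 opprD addNKr.
  by rewrite mulN1r normrN gtr0_norm // invr_gt0.
have gook z w e m : usq z -> usq w -> ok z e -> (m <= n)%N ->
    ok (lerp z w (m%:R / n%:R)) (go m z w e).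
  move=> uz uw oze; elim: m => [|m ih] mn; first by rewrite mul0r lerp0.
  by apply: Kok; [exact/lerp_usq/rng/ltnW|exact/lerp_usq/rng|exact: close|exact/ih/ltnW].
exists (go n); split.
- move=> z w e uz uw oze; have := gook z w e n uz uw oze (leqnn n).
  by rewrite divff ?gt_eqF // lerp1.
- move=> X z w e cz cw ce H; have : (n <= n)%N by [].
  elim: {1 3}n => [|m ih] mn //=; apply: Kc.
  + by apply: cont_lerp => //; exact: cst_continuous.
  + by apply: cont_lerp => //; exact: cst_continuous.
  + exact/ih/ltnW.
  + move=> x; have [ux uw ox] := H x.
    by split; [exact/lerp_usq/rng/ltnW|exact/lerp_usq/rng|exact: close|exact/gook/ltnW].
- move=> z w e st; have : (n <= n)%N by [].
  elim: {1 3}n => [|m ih] mn //=.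
  by rewrite (ih (ltnW mn)); apply: st; [exact/rng/ltnW|exact: rng].
Qed.

Lemma compact_pos {X : topologicalType} (K : set X) (f : X -> R) :
  compact K -> continuous f -> (forall x, K x -> 0 < f x) ->
  exists2 d : R, 0 < d & forall x, K x -> d < f x.
Proof.
move=> /compact_near_coveringP cov cf f0.
have near x : K x -> \forall x' \near x & d \near (0 : R)^'+, d < f x'.
  move=> /f0 fx; exists ([set y | f x / 2 < f y], [set d | d < f x / 2]) => /=.
    split; last by apply: nbhs_right_lt; rewrite divr_gt0.
    apply: open_nbhs_nbhs; split; last by rewrite /= ltr_pdivrMr // ltr_pMr // ltr1n.
    by apply: lt_open => //; exact: cst_continuous.
  by move=> [x' d] [/= fx' dx]; exact: lt_trans dx fx'.
have near0 : \forall d \near (0 : R)^'+, forall x, K x -> d < f x.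
  exact: (cov R _ (fun d x => d < f x)).
suff [d [Hd d0]] : exists d : R, (forall x, K x -> d < f x) /\ 0 < d by exists d.
by apply: (@filter_ex _ (0 : R)^'+); apply: filterI => //; exact: nbhs_right_gt.
Qed.

Lemma fin_pos (I : finType) (P : I -> R -> Prop) :
  (forall i (d d' : R), 0 < d' -> d' <= d -> P i d -> P i d') ->
  (forall i, exists2 d : R, 0 < d & P i d) ->
  exists2 d : R, 0 < d & forall i, P i d.
Proof.
move=> mono HP.
suff [d [Hd d0]] : exists d : R, (forall i, P i d) /\ 0 < d by exists d.
apply: (@filter_ex _ (0 : R)^'+); apply: filterI; last exact: nbhs_right_gt.
have FF : Filter (nbhs (0 : R)^'+) by exact: at_right_proper_filter.
refine (@filter_forall _ I P _ FF _) => i; have [d d0 Pd] := HP i.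
apply: filterS2 (nbhs_right_gt (0 : R)) (nbhs_right_lt d0) => d' d'0 d'd.
by apply: mono Pd => //; exact: ltW.
Qed.

End transport.

(** * Similarities that carry one ring to another *)

Section similarity.
Context {R : realType}.
Local Notation rdata := (ring_data R).
Implicit Types (u v w : 'rV[R]_3).

(* Composition of two reflections, taking [u] to [w] for unit vectors. *)
Definition rotate u w v : 'rV[R]_3 :=
  v + (2 * dotp u v) *: w - (dotp (u + w) v / Num.max (1 + dotp u w) 2^-1) *: (u + w).

Lemma rotate_id u v : unit_sphere u -> rotate u u v = v.
Proof.
rewrite /unit_sphere /= /rotate => ->.
have -> : Num.max (1 + 1) 2^-1 = 2 :> R by rewrite max_l; lra.
have -> : dotp (u + u) v / 2 = dotp u v.
  by rewrite dotpDl; lra.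
have -> : 2 * dotp u v = dotp u v + dotp u v by ring.
by rewrite scalerDr -scalerDl addrK.
Qed.

(** The bound makes the truncation of the denominator in [rotate] inactive; the truncation serves
    continuity near opposite vectors. *)
Lemma rotate_axis u w v : unit_sphere u -> unit_sphere w -> 2^-1 <= 1 + dotp u w ->
  dotp (rotate u w v) w = dotp u v /\ dotp (rotate u w v) (rotate u w v) = dotp v v.
Proof.
rewrite /unit_sphere /= => u1 w1 c; rewrite /rotate max_l //.
have c0 : 1 + dotp u w != 0 by rewrite gt_eqF // (lt_le_trans _ c) // invr_gt0 ltr0n.
set q := _ / _; have qE : q * (1 + dotp u w) = dotp u v + dotp w v.
  by rewrite /q mulfVK // dotpDl.
clearbody q; split.
  rewrite !(dotpDl, dotpNl, dotpZl) w1.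
  have -> : q * (dotp u w + 1) = dotp u v + dotp w v by rewrite addrC.
  by rewrite (dotpC v w); ring.
rewrite !(dotpDl, dotpDr, dotpNl, dotpNr, dotpZl, dotpZr) u1 w1.
rewrite (dotpC v u) (dotpC v w) (dotpC w u).
move: qE; move: (dotp u v) (dotp w v) (dotp u w) (dotp v v) => a b cc d qE.
have -> : b = q * (1 + cc) - a by rewrite qE; ring.
ring.
Qed.

(** The flag is set for rings and unset for points, whose radii have no ratio. *)
Definition similar (scaled : bool) (a b : rdata) (p : 'rV[R]_3) : 'rV[R]_3 :=
  rcenter b + (if scaled then Num.sqrt (rsquare b / rsquare a) else 1) *:
    rotate (rnormal a) (rnormal b) (p - rcenter a).

Lemma similar_id (s : bool) (a : rdata) p : (s -> 0 < rsquare a) -> unit_sphere (rnormal a) ->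
  similar s a a p = p.
Proof.
move=> sa ua; rewrite /similar rotate_id //.
have -> : (if s then Num.sqrt (rsquare a / rsquare a) else 1) = 1.
  by case: s sa => // /(_ isT) a0; rewrite divff ?gt_eqF // sqrtr1.
by rewrite scale1r addrC subrK.
Qed.

Lemma similar_gap (s : bool) (a b : rdata) p :
  (if s then 0 < rsquare a /\ 0 < rsquare b else rsquare a = 0 /\ rsquare b = 0) ->
  unit_sphere (rnormal a) -> unit_sphere (rnormal b) ->
  2^-1 <= 1 + dotp (rnormal a) (rnormal b) ->
  gap a p != 0 -> gap b (similar s a b p) != 0.
Proof.
move=> ss ua ub ab; apply: contra => /eqP/gap_eq0[].
rewrite /power /height /similar addrAC subrr add0r.
have [rh rr] := rotate_axis (p - rcenter a) ua ub ab.
rewrite !dotpZl dotpZr rh rr (dotpC (rnormal a)).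
case: s ss => [[a0 b0]|[a0 b0]]; last first.
  rewrite !mul1r b0 subr0 => p0 h0; apply/eqP/gap_eq0.
  by rewrite /power /height a0 p0 h0 subr0.
rewrite mulrA -expr2 sqr_sqrtr ?divr_ge0 ?ltW // => p0 /eqP.
rewrite mulf_eq0 gt_eqF ?sqrtr_gt0 ?divr_gt0 //= => /eqP h0.
apply/eqP/gap_eq0; rewrite /power /height h0; split => //.
set d := dotp _ _ in p0 *.
have -> : d - rsquare a =
    rsquare a / rsquare b * (rsquare b / rsquare a * d - rsquare b).
  by field; rewrite !gt_eqF.
by rewrite p0 mulr0.
Qed.

End similarity.

(** * Transport in the complement of moving rings and points *)

Section ring_transport.
Context {R : realType} (n : nat).
Local Notation rdata := (ring_data R).
Local Notation V := {ptws 'I_n -> ring_data R}.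
Implicit Types (P S D : {set 'I_n}).

Definition avoids P (C : V) (p : 'rV[R]_3) : Prop :=
  forall j, j \in P -> gap (C j) p != 0.

Lemma compact_upper {X : topologicalType} (K : set X) (f : X -> R) :
  compact K -> continuous f -> exists M : R, forall x, K x -> f x < M.
Proof.
move=> cK cf; pose g x := (1 + f x ^+ 2)^-1.
have g1 x : 0 < 1 + f x ^+ 2 by rewrite ltr_pwDl // sqr_ge0.
have cg : continuous g.
  by apply: cont_inv => [x|]; [rewrite gt_eqF|cont].
have [|d d0 Hd] := compact_pos cK cg; first by move=> x _; rewrite invr_gt0.
exists d^-1 => x /Hd H; have H' : 1 + f x ^+ 2 < d^-1.
  by rewrite -ltf_pV2 ?posrE ?invr_gt0 // invrK.
apply: lt_trans H'; have := sqr_ge0 (f x - 1); have := sqr_ge0 (f x).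
by rewrite !expr2; nra.
Qed.

Lemma cont_rotate {X : topologicalType} (f g h : X -> 'rV[R]_3) :
  continuous f -> continuous g -> continuous h ->
  continuous (fun x => rotate (f x) (g x) (h x)).
Proof.
move=> cf cg ch; rewrite /rotate; cont; try (by apply: cont_dotp; cont).
apply: cont_inv; last by cont; apply: cont_dotp.
by move=> x; rewrite gt_eqF // lt_max invr_gt0 ltr0n orbT.
Qed.

Lemma cont_similar {X : topologicalType} (s : bool) (a b : X -> rdata)
    (p : X -> 'rV[R]_3) : (s -> forall x, rsquare (a x) != 0) ->
  continuous a -> continuous b -> continuous p ->
  continuous (fun x => similar s (a x) (b x) (p x)).
Proof.
move=> sa ca cb cp; rewrite /similar; apply: cont_add; first exact: cont_rcenter.
apply: cont_scale.
  case: s sa => sa; last exact: cst_continuous.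
  apply: cont_sqrt; apply: cont_mul; first exact: cont_rsquare.
  by apply: cont_inv; [exact: sa|exact: cont_rsquare].
apply: cont_rotate; [exact: cont_rnormal|exact: cont_rnormal|].
by cont; exact: cont_rcenter.
Qed.

Lemma gap_box (a : rdata) (x : 'rV[R]_3) i : gap a x <= 1 ->
  `|x 0 i| <= `|rcenter a 0 i| + rsquare a + 2.
Proof.
move=> g1; have p1 : power a x <= 1.
  have : power a x ^+ 2 <= 1 by rewrite (le_trans _ g1) // lerDl sqr_ge0.
  by have := sqr_ge0 (power a x - 1); rewrite !expr2; nra.
have := @power_box R (with_square a (rsquare a + 1)) x i.
rewrite power_with /with_square /rcenter /rsquare /= => H.
by have := H (ltac:(move: p1; rewrite /rsquare; lra)); lra.
Qed.

Lemma ball_dist (z w : R * R) (e : R) :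
  ball z e w <-> Num.max `|z.1 - w.1| `|z.2 - w.2| < e.
Proof.
rewrite gt_max; split => [[/= b1 b2]|/andP[b1 b2]]; last by split.
by apply/andP; split.
Qed.

(** A form of isotopy extension in small steps. Near each ring a step is the similarity that carries
    it to its new place; bump functions interpolate with the identity outside. By compactness, a
    small step does not throw a point that is farther away onto a ring. Along a segment on which [W]
    is constant every step is the identity, which gives the last property. *)
Lemma ring_transport S D (W : R * R -> V) :
  square_in (configs R n S D) W ->
  exists T : R * R -> R * R -> 'rV[R]_3 -> 'rV[R]_3, [/\
    forall z w p, usq z -> usq w -> avoids (S :|: D) (W z) p ->
      avoids (S :|: D) (W w) (T z w p),
    forall (X : topologicalType) (z w : X -> R * R) (p : X -> 'rV[R]_3),
      continuous z -> continuous w -> continuous p ->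
      (forall x, [/\ usq (z x), usq (w x) & avoids (S :|: D) (W (z x)) (p x)]) ->
      continuous (fun x => T (z x) (w x) (p x)) &
    forall z w p, usq z -> usq w ->
      (forall t : R, 0 <= t <= 1 -> W (lerp z w t) = W z) -> T z w p = p].
Proof.
move=> WQ; pose P := S :|: D; rewrite -/P.
pose W' := W \o clamp2; have [cW WQ'] := square_clamp WQ.
rewrite -/W' in cW.
have W'E z : usq z -> W' z = W z by move=> uz; rewrite /W' /= clamp2_id.
have W'Q z : configs R n S D (W' z) by apply: WQ.2; exact: clamp2_usq.
have cWj j : continuous (fun z => W' z j) by apply: cont_proj.
have SP j : j \in S -> j \in P by move=> jS; rewrite inE jS.
have usqK : compact [set z : R * R | usq z] := usq_compact.
have [M HM] : exists M : R, forall j z, usq z -> forall i : 'I_3,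
    `|rcenter (W' z j) 0 i| + rsquare (W' z j) + 2 < M.
  have Hj (ji : 'I_n * 'I_3) : exists M : R, forall z, [set z | usq z] z ->
      `|rcenter (W' z ji.1) 0 ji.2| + rsquare (W' z ji.1) + 2 < M.
    apply: compact_upper => //; cont.
      by apply: cont_coord; exact: cont_rcenter.
    exact: cont_rsquare.
  have /choice[m mP] := Hj.
  exists (\sum_ji `|m ji|) => j z uz i; have := mP (j, i) z uz => /= H.
  apply: lt_le_trans H _; rewrite (bigD1 (j, i)) //=.
  by rewrite (le_trans (ler_norm _)) // lerDl sumr_ge0.
pose B := [set x : 'rV[R]_3 | forall i, x 0 i \in `[- M, M]].
have cB : compact B := @box_compact R M.
have inB j z p : usq z -> gap (W' z j) p <= 1 -> B p.
  move=> uz g1 i; rewrite in_itv /= -ler_norml.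
  by apply: le_trans (gap_box i g1) _; apply/ltW/HM.
(* The supports of the bump functions, where [gap] is at most [2 * th], are disjoint for different
   rings; as [2 * th <= 1], they lie in the box [B]. *)
have [th th0 [th1 Hth]] : exists2 th : R, 0 < th & th <= 2^-1 /\
    forall i j z p, i \in P -> j \in P -> i != j -> usq z ->
      gap (W' z i) p <= 2 * th -> gap (W' z j) p <= 2 * th -> False.
  have [|ij|d d0 Hd] := @fin_pos R ('I_n * 'I_n)%type (fun ij d =>
      ij.1 \in P -> ij.2 \in P -> ij.1 != ij.2 -> forall z p, usq z -> B p ->
      d < gap (W' z ij.1) p + gap (W' z ij.2) p).
  - by move=> ij d d' _ dd' H i1 i2 i12 z p uz Bp; exact: le_lt_trans dd' (H i1 i2 i12 z p uz Bp).
  - have [/and3P[iP jP ij']|/and3P nP] := boolP [&& ij.1 \in P, ij.2 \in P & ij.1 != ij.2]; last first.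
      by exists 1 => // iP jP ij'; case: nP.
    pose f (zp : (R * R) * 'rV[R]_3) := gap (W' zp.1 ij.1) zp.2 + gap (W' zp.1 ij.2) zp.2.
    have cWf j : continuous (fun zp : (R * R) * 'rV[R]_3 => W' zp.1 j).
      by apply: (@continuous_compose _ _ _ fst (fun z => W' z j)) => // zp; exact: cvg_fst.
    have cf : continuous f by rewrite /f; apply: cont_add; apply: cont_gap => //; cont.
    have [|d d0 Hd] := compact_pos (compact_setX usqK cB) cf.
      move=> [z p] _; rewrite /f /= lt_def addr_ge0 ?gap_ge0 // andbT.
      rewrite paddr_eq0 ?gap_ge0 //; apply/negP => /andP[/eqP/gap_eq0[p1 h1] /eqP/gap_eq0[p2 h2]].
      have [_ _ _ sep] := W'Q z; apply: (sep _ _ iP jP ij' p).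
      by split; rewrite ?p1.
    by exists d => // _ _ _ z p uz Bp; exact: (Hd (z, p)).
  exists (Num.min (d / 4) 2^-1); first by rewrite lt_min divr_gt0 //= invr_gt0.
  split; first by rewrite ge_min lexx orbT.
  move=> i j z p iP jP ij uz gi gj.
  have m1 : Num.min (d / 4) 2^-1 <= d / 4 by rewrite ge_min lexx.
  have m2 : Num.min (d / 4) 2^-1 <= 2^-1 by rewrite ge_min lexx orbT.
  have Bp : B p by apply: inB uz _; apply: le_trans gi _; move: m2; clear; lra.
  by have := Hd (i, j) iP jP ij z p uz Bp; rewrite /=; move: gi gj m1; clear; lra.
pose phi j z p := unitclamp (2 - gap (W' z j) p / th).
pose g j z w p := similar (j \in S) (W' z j) (W' w j) p.
pose K z w p := p + \sum_(j in P) phi j z p *: (g j z w p - p).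
have rS j z : j \in S -> 0 < rsquare (W' z j) by have [h _ _ _] := W'Q z; exact: h.
have rD j z : j \in D -> rsquare (W' z j) = 0 by have [_ h _ _] := W'Q z; exact: h.
have un j z : j \in P -> unit_sphere (rnormal (W' z j)) by have [_ _ h _] := W'Q z; exact: h.
have cK (X : topologicalType) (z w : X -> R * R) (p : X -> 'rV[R]_3) :
    continuous z -> continuous w -> continuous p ->
    continuous (fun x => K (z x) (w x) (p x)).
  move=> cz cw cp; apply: cont_add => //; apply: cont_sum => j.
  have c1 : continuous (fun x => W' (z x) j) by exact: (continuous_compose cz (cWj j)).
  have c2 : continuous (fun x => W' (w x) j) by exact: (continuous_compose cw (cWj j)).
  apply: cont_scale; first by rewrite /phi; cont; exact: cont_gap.
  apply: cont_add; last exact: cont_opp.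
  by apply: cont_similar => // jS x; rewrite gt_eqF // rS.
have phi0 j z p : 2 * th < gap (W' z j) p -> phi j z p = 0.
  move=> gj; apply: unitclamp_le0; rewrite subr_le0 ler_pdivlMr //.
  exact: ltW.
have phi1 j z p : gap (W' z j) p <= th -> phi j z p = 1.
  move=> gj; apply: unitclamp_ge1; rewrite lerBrDr -lerBrDl.
  by rewrite (_ : 2 - 1 = 1) ?ler_pdivrMr ?mul1r //; clear; lra.
have Kid z w p : W' z = W' w -> K z w p = p.
  move=> zw; rewrite /K big1 ?addr0 // => j jP; rewrite /g -zw similar_id.
  - by rewrite subrr scaler0.
  - by move=> jS; exact: rS.
  - exact: un.
pose dist (z w : R * R) := Num.max `|z.1 - w.1| `|z.2 - w.2|.
have dist0 z w : dist z w <= 0 -> z = w.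
  rewrite /dist ge_max !normr_le0 !subr_eq0 => /andP[/eqP e1 /eqP e2].
  by case: z w e1 e2 => [? ?] [? ?] /= -> ->.
have cdist (X : topologicalType) (z w : X -> R * R) : continuous z -> continuous w ->
    continuous (fun x => dist (z x) (w x)) by move=> cz cw; rewrite /dist; cont.
(* The length of a step is bounded so that normals never come close to opposite ones, and so that
   points of the box outside the inner neighborhood of a ring do not land on it. *)
have [|j|e0 e00 He0] := @fin_pos R 'I_n (fun j e => j \in P -> forall z w, usq z -> usq w ->
    ball z e w -> 2^-1 <= 1 + dotp (rnormal (W' z j)) (rnormal (W' w j)) /\
    forall p, B p -> th <= gap (W' z j) p -> 0 < gap (W' w j) (K z w p)).
- move=> j d d' _ dd' H jP z w uz uw zw; apply: H => //.
  exact: le_ball zw.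
- have [jP|jP] := boolP (j \in P); last by exists 1.
  (* Here and in [h2], the maximum with [dist] turns a property that holds on the diagonal, where a
     step is the identity, into positivity on a compact set. *)
  pose h1 (zw : (R * R) * (R * R)) :=
    Num.max (2^-1 + dotp (rnormal (W' zw.1 j)) (rnormal (W' zw.2 j))) (dist zw.1 zw.2).
  have cf1 : continuous (fun zw : (R * R) * (R * R) => W' zw.1 j).
    by apply: (@continuous_compose _ _ _ fst (fun z => W' z j)) => // zp; exact: cvg_fst.
  have cf2 : continuous (fun zw : (R * R) * (R * R) => W' zw.2 j).
    by apply: (@continuous_compose _ _ _ snd (fun z => W' z j)) => // zp; exact: cvg_snd.
  have ch1 : continuous h1.
    apply: cont_max; last by apply: cdist; cont.
    by cont; apply: cont_dotp; [exact: (cont_rnormal cf1)|exact: (cont_rnormal cf2)].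
  have [|d1 d10 Hd1] := compact_pos (compact_setX usqK usqK) ch1.
    move=> [z w] _; rewrite /h1 /= lt_max; have [//|/dist0 ->] := ltP 0 (dist z w).
      by rewrite orbT.
    by rewrite orbF; have := un j w jP; rewrite /unit_sphere /= => ->; rewrite addr_gt0 ?invr_gt0.
  pose h2 (y : ((R * R) * (R * R)) * 'rV[R]_3) :=
    Num.max (gap (W' y.1.2 j) (K y.1.1 y.1.2 y.2))
            (Num.max (th - gap (W' y.1.1 j) y.2) (dist y.1.1 y.1.2)).
  have ch2 : continuous h2.
    have c1 : continuous (fun y : ((R * R) * (R * R)) * 'rV[R]_3 => W' y.1.1 j).
      by apply: (@continuous_compose _ _ _ (fun y => y.1.1) (fun z => W' z j)) => //; cont.
    have c2 : continuous (fun y : ((R * R) * (R * R)) * 'rV[R]_3 => W' y.1.2 j).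
      by apply: (@continuous_compose _ _ _ (fun y => y.1.2) (fun z => W' z j)) => //; cont.
    apply: cont_max; first by apply: cont_gap; [exact: c2|apply: cK; cont].
    apply: cont_max; last by apply: cdist; cont.
    by cont; apply: cont_gap; [exact: c1|cont].
  have [|d2 d20 Hd2] := compact_pos (compact_setX (compact_setX usqK usqK) cB) ch2.
    move=> [[z w] p] _; rewrite /h2 /= 2!lt_max.
    have [_|/dist0 zw] := ltP 0 (dist z w); first by rewrite !orbT.
    rewrite zw Kid // orbF; have [//|gp] := ltP 0 (gap (W' w j) p).
    by rewrite /= subr_gt0 (le_lt_trans gp).
  exists (Num.min d1 d2); first by rewrite lt_min d10.
  move=> _ z w uz uw /ball_dist; rewrite -/(dist z w) lt_min => /andP[zw1 zw2].
  split.
    have := Hd1 (z, w) (conj uz uw); rewrite /h1 /= lt_max [d1 < dist _ _]ltNge ltW //= orbF.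
    by move: d10; clear; lra.
  move=> p Bp thp; have := Hd2 ((z, w), p) (conj (conj uz uw) Bp).
  rewrite /h2 /= 2!lt_max [d2 < dist _ _]ltNge (ltW zw2) /= orbF => /orP[H|H].
    exact: lt_trans d20 H.
  by exfalso; move: H d20 thp; clear; lra.
have Kok z w p : usq z -> usq w -> ball z e0 w -> avoids P (W' z) p ->
    avoids P (W' w) (K z w p).
  move=> uz uw zw zp j jP; have [uu far] := He0 j jP z w uz uw zw.
  have [gth|gth] := leP (gap (W' z j) p) th.
    have -> : K z w p = g j z w p.
      rewrite /K (bigD1 j) //= phi1 // scale1r big1 ?addr0.
        by rewrite addrC subrK.
      move=> i /andP[iP ij]; rewrite phi0 ?scale0r // ltNge; apply/negP => gi.
      apply: (Hth i j z p iP jP ij uz gi); apply: le_trans gth _.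
      by move: th0; clear; lra.
    apply: similar_gap; [|exact: un|exact: un|exact: uu|exact: zp].
    case: ifPn => jS; first by split; exact: rS.
    by have jD : j \in D by [move: jP; rewrite inE (negbTE jS)]; rewrite !rD.
  have [g1|g1] := leP (gap (W' z j) p) 1.
    by rewrite gt_eqF // far ?ltW //; exact: inB uz g1.
  (* Outside the box every bump function vanishes, and all rings are inside it. *)
  have [Bp|nBp] := pselect (B p); first by rewrite gt_eqF // far ?ltW.
  have -> : K z w p = p.
    rewrite /K big1 ?addr0 // => i iP; rewrite phi0 ?scale0r // ltNge; apply/negP => gi.
    apply: nBp; apply: inB uz _; apply: le_trans gi _.
    by move: th1; clear; lra.
  apply/eqP => gw; apply: nBp; apply: (@inB j _ _ uw); rewrite gw; exact: ler01.
have [T [T1 T2 T3]] := @transport R _ (fun z p => avoids P (W' z) p) K e0 e00 Kok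
  (fun X z w p cz cw cp _ => cK X z w p cz cw cp).
exists T; split.
- by move=> z w p uz uw; rewrite -!W'E //; exact: T1.
- move=> X z w p cz cw cp H; apply: T2 => // x; have [ux uw] := H x.
  by rewrite -W'E.
- move=> z w p uz uw st; apply: T3 => s t s01 t01; apply: Kid.
  by rewrite !W'E ?lerp_usq // !st.
Qed.

End ring_transport.

(** * Adding a point *)

Section add_point.
Context {R : realType} (n : nat).
Local Notation V := {ptws 'I_n -> ring_data R}.
Variables (S D : {set 'I_n}) (k : 'I_n).
Hypothesis kP : k \notin S :|: D.
Let P := S :|: D.
Let P' := S :|: (k |: D).
Let Q := configs R n S D.
Let Q' := configs R n S (k |: D).
Let A := parallel_normals R n P.
Let A' := parallel_normals R n P'.

Let inP' i : (i \in P') = (i == k) || (i \in P).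
Proof. by rewrite !inE orbCA. Qed.

Let kNP i : i \in P -> i != k.
Proof. by move=> iP; apply: contra kP => /eqP <-. Qed.

Let configs_dep (C C' : V) : (forall i, i \in P -> C i = C' i) -> Q C -> Q C'.
Proof.
move=> CC' [h1 h2 h3 h4]; split.
- by move=> i iS; rewrite -(CC' i) ?h1 // inE iS.
- by move=> i iD; rewrite -(CC' i) ?h2 // inE iD orbT.
- by move=> i iP; rewrite -(CC' i iP); exact: (h3 i iP).
- by move=> i j iP jP ij; rewrite -(CC' i iP) -(CC' j jP); exact: (h4 i j iP jP).
Qed.

Let avoids_dep (C C' : V) p : (forall i, i \in P -> C i = C' i) ->
  avoids P C p -> avoids P C' p.
Proof. by move=> CC' Cp i iP; rewrite -(CC' i iP); exact: Cp. Qed.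

Let configs_addP (C : V) : Q' C <-> [/\ Q C, rsquare (C k) = 0,
  unit_sphere (rnormal (C k)) & avoids P C (rcenter (C k))].
Proof.
split=> [[h1 h2 h3 h4]|[[h1 h2 h3 h4] k0 ku ka]].
  have kP' : k \in P' by rewrite inP' eqxx.
  have PP' i : i \in P -> i \in P' by rewrite inP' => ->; rewrite orbT.
  have k0 : rsquare (C k) = 0 by apply: h2; rewrite !inE eqxx.
  split => //; last 2 first.
  - exact: (h3 k kP').
  - move=> j jP; apply/separated_point => //; apply: h4 => //; first exact: PP'.
    by rewrite eq_sym kNP.
  split=> //.
  - by move=> i iD; apply: h2; rewrite inE iD orbT.
  - by move=> i /PP'; exact: h3.
  - by move=> i j /PP' iP /PP' jP; exact: h4.
split=> //.
- by move=> i; rewrite in_setU1 => /predU1P[->|/h2].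
- by move=> i; rewrite inP' => /predU1P[->|/h3].
- move=> i j; rewrite !inP' => /predU1P[->|iP] /predU1P[->|jP] ij.
  + by rewrite eqxx in ij.
  + by apply/separated_point => //; exact: ka.
  + by apply/separated_sym/separated_point => //; exact: ka.
  + exact: h4.
Qed.

Let parallel_addP (C : V) : A' C <-> A C /\ rnormal (C k) = e_x.
Proof.
split=> [h|[h hk]].
  split=> [i iP|]; first by apply: h; rewrite inP' iP orbT.
  by apply: h; rewrite inP' eqxx.
by move=> i; rewrite inP' => /predU1P[->|/h].
Qed.

(** Membership in [Q] and [A] ignores the coordinate [k]. A configuration without the new point is
    thus a full family with an arbitrary entry at [k], and adding the point overwrites this
    entry. *)
Definition place (C : V) (p u : 'rV[R]_3) : V := update C k (p, 0, u).

Let place_dep C p u i : i \in P -> C i = place C p u i.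
Proof. by move=> iP; rewrite /place update_other // kNP. Qed.

Let place_k C p u : place C p u k = (p, 0, u).
Proof. exact: update_same. Qed.

Let place_in (C : V) p u : Q C -> avoids P C p -> unit_sphere u -> Q' (place C p u).
Proof.
move=> QC Cp u1; apply/configs_addP; rewrite place_k; split => //.
  by apply: configs_dep QC => i; exact: place_dep.
by apply: avoids_dep Cp => i; exact: place_dep.
Qed.

Let place_par (C : V) p : A C -> A' (place C p e_x).
Proof.
move=> AC; apply/parallel_addP; rewrite place_k; split => // i iP.
by rewrite -place_dep // AC.
Qed.

Let place_id (C : V) : Q' C -> place C (rcenter (C k)) (rnormal (C k)) = C.
Proof.
move=> /configs_addP[_ k0 _ _]; apply/funext => i; rewrite /place /update.
case: eqP => // ->; rewrite -k0 /rcenter /rsquare /rnormal.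
by case: (C k) => -[].
Qed.

Let place_place (C : V) p u q v : place (place C p u) q v = place C q v.
Proof. by apply/funext => i; rewrite /place /update; case: eqP. Qed.

Let Q'Q : Q' `<=` Q.
Proof. by move=> C /configs_addP[]. Qed.

Let A'A : A' `<=` A.
Proof. by move=> C /parallel_addP[]. Qed.

Let ex1 : unit_sphere (e_x : 'rV[R]_3). Proof. exact: e_x_unit. Qed.

Let cont_place {X : topologicalType} (C : X -> V) (p u : X -> 'rV[R]_3) :
  continuous C -> continuous p -> continuous u ->
  continuous (fun x => place (C x) (p x) (u x)).
Proof. by move=> cC cp cu; apply: cont_update => //; cont. Qed.

Let cont_center {X : topologicalType} (C : X -> V) : continuous C ->
  continuous (fun x => rcenter (C x k)).
Proof. by move=> cC; apply: cont_rcenter; exact: cont_proj. Qed.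

Let lerp_same (z : R * R) t : lerp z z t = z.
Proof. by case: z => a b; rewrite /lerp /=; congr pair; ring. Qed.

Let usq00 : usq ((0, 0) : R * R). Proof. by rewrite /usq /= unit0. Qed.

(** The path of the other rings drags the point along; afterwards its normal is turned to [e_x] with
    everything else at rest. *)
Let add_reaches : reaches R Q A -> reaches R Q' A'.
Proof.
move=> r0 C Q'C; have /configs_addP[QC k0 ku ka] := Q'C.
have [g [gQ g0 g1]] := r0 C QC.
pose W (z : R * R) := g (unitclamp z.1).
have cW : continuous W by apply: (@continuous_compose _ _ _ (fun z : R * R => unitclamp z.1) g); [cont|exact: gQ.1].
have WQ : square_in Q W by split => // z _; apply: gQ.2; exact: unitclamp01.
have [T [T1 T2 T3]] := ring_transport WQ.
have [u [[cu uS] u0 u1]] := sphere_connected ku.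
pose p0 := rcenter (C k).
have W0 : W (0, 0) = C by rewrite /W /= unitclamp_id ?unit0.
have uz (t : R) : usq (unitclamp t, 0) by rewrite /usq /= unitclamp01 unit0.
pose c (t : R) := T (0, 0) (unitclamp t, 0) p0.
have ka0 : avoids P (W (0, 0)) p0 by rewrite W0.
have cc : continuous c.
  apply: T2; [cont|cont|cont|].
  by move=> t; split.
have ca t : avoids P (g (unitclamp t)) (c t).
  by have := T1 _ _ _ usq00 (uz t) ka0; rewrite /W /= unitclampK.
have c0 : c 0 = p0.
  rewrite /c unitclamp_id ?unit0 //; apply: T3 => // t _.
  by rewrite lerp_same.
pose q1 (t : R) := place (g (unitclamp t)) (c t) (rnormal (C k)).
pose q2 (t : R) := place (g 1) (c 1) (u (unitclamp t)).
have q1Q : path_in Q' q1.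
  split.
    apply: cont_place; [|exact: cc|cont].
    by apply: (continuous_compose _ gQ.1); cont.
  move=> t _; apply: place_in => //.
  by apply: gQ.2; exact: unitclamp01.
have e1 : unitclamp 1 = 1 :> R by rewrite unitclamp_id ?unit1.
have e0 : unitclamp 0 = 0 :> R by rewrite unitclamp_id ?unit0.
have q2Q : path_in Q' q2.
  split.
    apply: cont_place; [cont|cont|].
    by apply: (continuous_compose _ cu); cont.
  move=> t _; apply: place_in.
  - by apply: gQ.2; exact: unit1.
  - by have := ca 1; rewrite e1.
  - by apply: uS; exact: unitclamp01.
exists (pcat q1 q2); split.
- by apply: pcat_in => //; rewrite /q1 /q2 e1 e0 u0.
- by rewrite pcat0 /q1 e0 g0 c0 place_id.
- by rewrite pcat1 /q2 e1 u1; apply: place_par.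
Qed.

(** Over a compression of the other rings, the point is transported from the bottom side to the
    whole square, and its normal follows a contraction of a loop on the sphere. The position of the
    point is not constrained by [A']. *)
Let add_compresses_paths : compresses_paths R Q A -> compresses_paths R Q' A'.
Proof.
move=> c1 g gQ' g0 g1; have [cg gQ'2] := gQ'.
have [F [FQ Fb Ft Flr]] := c1 _ (path_inS Q'Q gQ') (A'A g0) (A'A g1).
have [cF FQ2] := FQ.
have [T [T1 T2 T3]] := ring_transport FQ.
have /parallel_addP[_ n0] := g0; have /parallel_addP[_ n1] := g1.
have e1 : unitclamp 1 = 1 :> R by rewrite unitclamp_id ?unit1.
have e0 : unitclamp 0 = 0 :> R by rewrite unitclamp_id ?unit0.
have gkP (s : R) := (configs_addP (g (unitclamp s))).1 (gQ'2 _ (unitclamp01 s)).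
pose G s := g (unitclamp s).
have cG : continuous G by apply: (continuous_compose _ cg); cont.
have [|||U [[cU US] UE]] := @sphere_loop R (fun s => rnormal (G s k)).
- split; first by apply: cont_rnormal; exact: cont_proj.
  by move=> t _; have [] := gkP t.
- by rewrite /G e0.
- by rewrite /G e1.
pose z0 (z : R * R) : R * R := (unitclamp z.1, 0).
have cz0 : continuous z0 by rewrite /z0; cont.
have uz0 z : usq (z0 z) by rewrite /usq /= unitclamp01 unit0.
pose c z := T (z0 z) (clamp2 z) (rcenter (G z.1 k)).
have av0 z : avoids P (F (z0 z)) (rcenter (G z.1 k)).
  by rewrite /z0 Fb ?unitclamp01 //; have [] := gkP z.1.
have cc : continuous c.
  apply: T2 => //; first exact: clamp2_continuous.
  - apply: (@cont_center _ (fun z : R * R => G z.1)).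
    by apply: (continuous_compose _ cG); cont.
  - by move=> z; split; [exact: uz0|exact: clamp2_usq|exact: av0].
have ca z : avoids P (F (clamp2 z)) (c z) by apply: T1 (av0 z); [exact: uz0|exact: clamp2_usq].
pose H z := place (F (clamp2 z)) (c z) (U (clamp2 z)).
have HA z : A (F (clamp2 z)) -> U (clamp2 z) = e_x -> A' (H z).
  by move=> AF UF; rewrite /H UF; exact: place_par.
exists H; split.
- split.
    apply: cont_place; [|exact: cc|].
      by apply: (continuous_compose _ cF); exact: clamp2_continuous.
    by apply: (continuous_compose _ cU); exact: clamp2_continuous.
  move=> z _; apply: place_in => //; first by apply: FQ2; exact: clamp2_usq.
  by apply: US; exact: clamp2_usq.
- move=> s s01; have uz : usq (s, 0) by rewrite /usq /= s01 unit0.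
  have Gs : G s = g s by rewrite /G unitclamp_id.
  rewrite /H clamp2_id // Fb //; have [-> _ _ _] := UE s s01.
  have -> : c (s, 0) = rcenter (g s k).
    rewrite /c clamp2_id // /z0 /= unitclamp_id // Gs; apply: T3 => // t _.
    by rewrite lerp_same.
  by rewrite Gs place_id //; exact: gQ'2.
- move=> s s01; have uz : usq (s, 1) by rewrite /usq /= s01 unit1.
  by apply: HA; rewrite clamp2_id //; [exact: Ft|have [] := UE s s01].
- move=> t t01; have uz : usq (0, t) by rewrite /usq /= t01 unit0.
  have uz' : usq (1, t) by rewrite /usq /= t01 unit1.
  have [A0 A1] := Flr t t01; have [_ _ U0 U1] := UE t t01.
  by split; apply: HA; rewrite clamp2_id.
Qed.

(** The section announced above: by [power_box], the plane through this point orthogonal to the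
    x-axis lies beyond all rings and points of [P]. It depends continuously on them and on nothing
    else. *)
Definition far_point (C : V) : 'rV[R]_3 :=
  vec3 (1 + \sum_(j in P) (`|rcenter (C j) 0 0| + `|rsquare (C j)| + 1)) 0 0.

Let far_avoids (C : V) (p : 'rV[R]_3) : p 0 0 = far_point C 0 0 -> avoids P C p.
Proof.
rewrite /far_point vec3E => p0 j jP; apply/eqP => /gap_eq0[pw _].
have : `|p 0 0| <= `|rcenter (C j) 0 0| + rsquare (C j) + 1.
  by apply: power_box; rewrite pw.
move=> /(le_trans (ler_norm _)); rewrite p0 (bigD1 j) //=; set s := \sum_(_ | _) _.
have s0 : 0 <= s by apply: sumr_ge0 => i _; rewrite !addr_ge0.
have := ler_norm (rsquare (C j)); have := normr_ge0 (rcenter (C j) 0 0).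
have := normr_ge0 (rsquare (C j)).
by lra.
Qed.

Let far_dep (C C' : V) : (forall i, i \in P -> C i = C' i) -> far_point C = far_point C'.
Proof.
by move=> CC'; rewrite /far_point; congr vec3; congr (_ + _); apply: eq_bigr => j jP; rewrite CC'.
Qed.

Let cont_far {X : topologicalType} (C : X -> V) : continuous C ->
  continuous (fun x => far_point (C x)).
Proof.
move=> cC; rewrite /far_point.
have -> : (fun x => vec3 (1 + \sum_(j in P) (`|rcenter (C x j) 0 0| + `|rsquare (C x j)| + 1)) 0 0)
  = (fun x => (1 + \sum_(j in P) (`|rcenter (C x j) 0 0| + `|rsquare (C x j)| + 1)) *: e_x).
  apply/funext => x; rewrite e_xE; apply/rowP => -[[|[|[|i]]] hi] //; rewrite !mxE /=.
  - by rewrite mulr1.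
  - by rewrite mulr0.
  - by rewrite mulr0.
apply: cont_scale; last exact: cst_continuous.
apply: cont_add; first exact: cst_continuous.
apply: (@cont_sum R X R^o) => j.
have cj : continuous (fun x => C x j) by exact: cont_proj.
cont; last by apply: cont_rsquare.
by apply: cont_coord; exact: cont_rcenter.
Qed.

Let segment (C : V) p q : Q C -> A C ->
  (forall t : R, 0 <= t <= 1 -> avoids P C ((1 - t) *: p + t *: q)) ->
  path_in (Q' `&` A') (fun t : R => place C ((1 - unitclamp t) *: p + unitclamp t *: q) e_x).
Proof.
move=> QC AC pq; split; first by apply: cont_place; cont.
by move=> t _; split; [apply: place_in => //; apply/pq/unitclamp01|exact: place_par].
Qed.

(* Rings parallel to the yz-plane are avoided by moving along the x-axis, after a
   small perturbation of the other coordinates. *)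
Let to_far (C : V) : Q' C -> A' C -> exists c : R -> V,
  [/\ path_in (Q' `&` A') c, c 0 = C & rcenter (c 1 k) = far_point (c 1)].
Proof.
move=> Q'C A'C; have /configs_addP[QC k0 _ ka] := Q'C.
have /parallel_addP[AC nk] := A'C.
pose p := rcenter (C k); pose ey : 'rV[R]_3 := vec3 0 1 0.
have [h1 h2 _ _] := QC.
(* Projected along the x-axis, a parallel ring becomes a circle or a point. A zero of [f j] means
   that the line in this direction through [p + t *: ey] meets it. *)
pose f j (t : R) := (p 0 1 - rcenter (C j) 0 1 + t) ^+ 2 +
  (p 0 2 - rcenter (C j) 0 2) ^+ 2 - rsquare (C j).
have gapP j (q : 'rV[R]_3) : j \in P -> gap (C j) q = 0 -> (q 0 1 - rcenter (C j) 0 1) ^+ 2 +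
    (q 0 2 - rcenter (C j) 0 2) ^+ 2 - rsquare (C j) = 0.
  move=> jP /gap_eq0[]; rewrite /power /height AC // e_xE !dotp3E !mxE /=.
  rewrite !mulr0 !addr0 mulr1 => + x0; rewrite x0 mulr0 add0r => <-.
  by rewrite !expr2.
have [|j|d d0 Hd] := @fin_pos R 'I_n (fun j d => j \in P ->
    (forall t : R, 0 <= t <= d -> gap (C j) (p + t *: ey) != 0) /\
    (forall t : R, 0 < t <= d -> f j t != 0)).
- move=> j d d' d'0 dd' H jP; have [H1 H2] := H jP; split => t /andP[t0 td].
    by apply: H1; rewrite t0 (le_trans td).
  by apply: H2; rewrite t0 (le_trans td).
- have [jP|jP] := boolP (j \in P); last by exists 1.
  have [d1 d10 Hd1] : exists2 d : R, 0 < d & forall t : R, 0 <= t <= d -> gap (C j) (p + t *: ey) != 0.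
    have op : open [set t : R | gap (C j) (p + t *: ey) != 0].
      apply: (@neq_open R _ _ (fun=> 0)); last exact: cst_continuous.
      by apply: cont_gap; cont.
    have /nbhs_ballP[e e0 He] : nbhs (0 : R) [set t : R | gap (C j) (p + t *: ey) != 0].
      by apply: open_nbhs_nbhs; split => //=; rewrite scale0r addr0; exact: ka.
    exists (e / 2); first by rewrite divr_gt0.
    move=> t /andP[t0 te]; apply: He; rewrite /ball /= sub0r normrN ger0_norm //.
    by apply: le_lt_trans te _; rewrite ltr_pdivrMr // ltr_pMr // ltr1n.
  (* A monic quadratic polynomial has isolated zeros, so a small positive [t] is good even if 0 is a
     zero. *)
  have [d2 d20 Hd2] : exists2 d : R, 0 < d & forall t : R, 0 < t <= d -> f j t != 0.
    rewrite /f; set b := p 0 1 - _; set c := (p 0 2 - _) ^+ 2; set r := rsquare _.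
    have [e0|e0] := eqVneq (b ^+ 2 + c - r) 0.
      have fE t : (b + t) ^+ 2 + c - r = t * (2 * b + t).
        by rewrite -[RHS]addr0 -e0; ring.
      have [b0|b0] := eqVneq b 0.
        exists 1 => // t /andP[t0 _]; rewrite fE b0 mulr0 add0r.
        by rewrite mulf_neq0 // gt_eqF.
      exists `|b|; first by rewrite normr_gt0.
      move=> t /andP[t0 tb]; rewrite fE mulf_neq0 //; first by rewrite gt_eqF.
      apply/eqP => bt; move: tb; have -> : b = - (t / 2) by lra.
      rewrite normrN ger0_norm ?divr_ge0 ?(ltW t0) // => tb.
      by move: t0; apply/negP; rewrite -leNgt; lra.
    have op : open [set t : R | (b + t) ^+ 2 + c - r != 0].
      apply: (@neq_open R _ _ (fun=> 0)); last exact: cst_continuous.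
      by cont.
    have /nbhs_ballP[e e1 He] : nbhs (0 : R) [set t : R | (b + t) ^+ 2 + c - r != 0].
      by apply: open_nbhs_nbhs; split => //=; rewrite addr0.
    exists (e / 2); first by rewrite divr_gt0.
    move=> t /andP[t0 te]; apply: He; rewrite /ball /= sub0r normrN gtr0_norm //.
    by apply: le_lt_trans te _; rewrite ltr_pdivrMr // ltr_pMr // ltr1n.
  exists (Num.min d1 d2); first by rewrite lt_min d10.
  move=> _; split => t /andP[t0]; rewrite le_min => /andP[td1 td2].
    by apply: Hd1; rewrite t0.
  by apply: Hd2; rewrite t0.
(* The perturbed point travels along the x-axis into the far plane, then within this plane to the
   far point. *)
pose q1 := p + d *: ey; pose q2 := vec3 (far_point C 0 0) (q1 0 1) (q1 0 2).
pose q3 := far_point C.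
have dd : 0 < d <= d by rewrite d0 lexx.
have s1 := @segment C p q1 QC AC; have s2 := @segment C q1 q2 QC AC.
have s3 := @segment C q2 q3 QC AC.
have {}s1 : path_in (Q' `&` A') (fun t : R => place C ((1 - unitclamp t) *: p + unitclamp t *: q1) e_x).
  apply: s1 => t /andP[t0 t1] j jP.
  have -> : (1 - t) *: p + t *: q1 = p + (t * d) *: ey.
    by rewrite /q1 scalerDr addrA -scalerDl subrK scale1r scalerA.
  have [H _] := Hd j jP; apply: H.
  by rewrite mulr_ge0 ?(ltW d0) //= ler_piMl // ltW.
have {}s2 : path_in (Q' `&` A') (fun t : R => place C ((1 - unitclamp t) *: q1 + unitclamp t *: q2) e_x).
  apply: s2 => t t01 j jP; apply/eqP => /(gapP j _ jP).
  have [_ /(_ d dd)] := Hd j jP; rewrite /f => /eqP H.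
  have e1 : q1 0 1 = p 0 1 + d by rewrite !mxE /= mulr1.
  have e2 : q1 0 2 = p 0 2 by rewrite !mxE /= mulr0 addr0.
  have q21 : ((1 - t) *: q1 + t *: q2) 0 1 = p 0 1 + d.
    by rewrite mxE [(_ *: q1) 0 1]mxE [(_ *: q2) 0 1]mxE /q2 vec3E e1; ring.
  have q22 : ((1 - t) *: q1 + t *: q2) 0 2 = p 0 2.
    by rewrite mxE [(_ *: q1) 0 2]mxE [(_ *: q2) 0 2]mxE /q2 vec3E e2; ring.
  rewrite q21 q22 => fz; apply: H; rewrite -fz; ring.
have {}s3 : path_in (Q' `&` A') (fun t : R => place C ((1 - unitclamp t) *: q2 + unitclamp t *: q3) e_x).
  apply: s3 => t t01; apply: far_avoids.
  by rewrite mxE [(_ *: q2) 0 0]mxE [(_ *: q3) 0 0]mxE /q2 vec3E /q3; ring.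
have e1 : unitclamp 1 = 1 :> R by rewrite unitclamp_id ?unit1.
have e0 : unitclamp 0 = 0 :> R by rewrite unitclamp_id ?unit0.
have ends (a b : 'rV[R]_3) : (1 - unitclamp 0) *: a + unitclamp 0 *: b = a /\
    (1 - unitclamp 1) *: a + unitclamp 1 *: b = b.
  by rewrite e0 e1 subr0 subrr !scale0r !scale1r addr0 add0r.
have [p1 p2] := ends p q1; have [p3 p4] := ends q1 q2; have [p5 p6] := ends q2 q3.
have s23 := pcat_in s2 s3.
have {}s23 := s23 (etrans (congr1 (fun q => place C q e_x) p4) (esym (congr1 (fun q => place C q e_x) p5))).
eexists; split; first apply: (pcat_in s1 s23).
- by rewrite pcat0 p2 p3.
- rewrite pcat0 p1 /p -nk; exact: place_id.
- rewrite !pcat1 p6 place_k /q3; apply: far_dep => i; exact: place_dep.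
Qed.

(** A filling [K] of the other rings in [A] serves to slide the boundary into the fiber over one
    configuration [a]. There it is a loop that bounds in the total space, and it has to bound in the
    fiber. The base of the bounding square is a sphere in [Q] whose monodromy could obstruct this;
    the far point undergoes the same monodromy and is used to cancel it. *)
Let add_compresses_squares : compresses_squares R Q A -> compresses_squares R Q' A'.
Proof.
move=> c2; apply: (compresses_squares_base
  (S := [set C : {ptws 'I_n -> ring_data R} | rcenter (C k) = far_point C])) => [|H HQ' HA' /= Hfar Hconst].
  exact: to_far.
have [cH HQ'2] := HQ'.
have e1 : unitclamp 1 = 1 :> R by rewrite unitclamp_id ?unit1.
have e0 : unitclamp 0 = 0 :> R by rewrite unitclamp_id ?unit0.
have fr := (frameP (@frame R)).2 (fun z Hz => Hz).
have [||K [KQA KH]] := c2 H.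
- by apply: square_inS HQ'; exact: Q'Q.
- by move=> z fz; apply/A'A/HA'.
have KQ : square_in Q K by apply: square_inS KQA => C [].
have KA z : usq z -> A (K z) by move=> /KQA.2[].
have [T [T1 T2 T3]] := ring_transport KQ.
pose o : R * R := (1, 1).
have uo : usq o by rewrite /usq /= unit1.
have fo : frame o by split => //; exact: Or42.
have Ko : K o = H o by exact: KH.
pose a := K o.
have Ha : H (1, 1) = a by rewrite -Ko.
have pP z : frame z -> avoids P (K z) (rcenter (H z k)).
  by move=> fz; rewrite KH //; have /configs_addP[_ _ _] := HQ'2 z (frame_usq fz).
(* The other rings follow [K] along the segment from [z] to the corner [(1, 1)] and drag the point
   along. *)
pose Dz (z : R * R) (t : R) := place (K (lerp z o t)) (T z (lerp z o t) (rcenter (H z k))) e_x.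
pose DD (g : R * R -> R * R) (z : R * R) := Dz (g z) (unitclamp z.2).
have DDin g : continuous g -> (forall z, frame (g z)) -> square_in (Q' `&` A') (DD g).
  move=> cg fg; have ug z : usq (g z) by apply/frame_usq.
  have ul z : usq (lerp (g z) o (unitclamp z.2)) by apply: lerp_usq => //; exact: unitclamp01.
  have cl : continuous (fun z => lerp (g z) o (unitclamp z.2)).
    by apply: cont_lerp => //; cont.
  split.
    apply: cont_place; last exact: cst_continuous.
      exact: (continuous_compose cl KQ.1).
    apply: T2 => //; last by move=> z; split => //; exact: pP.
    apply: (@cont_center _ (fun z => H (g z))).
    exact: (continuous_compose cg cH).
  move=> z _; split; last by apply: place_par; exact: KA.
  apply: place_in => //; first exact: KQ.2.
  by apply: T1 => //; exact: pP.
pose sb (z : R * R) : R * R := (unitclamp z.1, 0).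
pose st (z : R * R) : R * R := (unitclamp z.1, 1).
pose sl (z : R * R) : R * R := (0, unitclamp z.1).
pose sr (z : R * R) : R * R := (1, unitclamp z.1).
have Dz0 z : frame z -> Dz z 0 = H z.
  move=> fz; have uz := frame_usq fz.
  rewrite /Dz lerp0 T3 // => [|t _]; last by rewrite lerp_same.
  have /parallel_addP[_ nk] := HA' z fz.
  have Hz := place_id (HQ'2 z uz); rewrite -{2}Hz nk.
  by rewrite KH.
pose g z := T z o (rcenter (H z k)).
have Dz1 z : Dz z 1 = place a (g z) e_x by rewrite /Dz lerp1.
have DDE (s t : R) : 0 <= s <= 1 -> 0 <= t <= 1 ->
  [/\ DD sb (s, t) = Dz (s, 0) t, DD st (s, t) = Dz (s, 1) t,
      DD sl (s, t) = Dz (0, s) t & DD sr (s, t) = Dz (1, s) t].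
  by move=> s01 t01; rewrite /DD /sb /st /sl /sr /= !unitclamp_id.
have csb : continuous sb by rewrite /sb; cont.
have cst : continuous st by rewrite /st; cont.
have csl : continuous sl by rewrite /sl; cont.
have csr : continuous sr by rewrite /sr; cont.
have fr1 (s : R) := fr _ (unitclamp01 s).
have fsb z : frame (sb z) by have [] := fr1 z.1.
have fst' z : frame (st z) by have [] := fr1 z.1.
have fsl z : frame (sl z) by have [] := fr1 z.1.
have fsr z : frame (sr z) by have [] := fr1 z.1.
apply: (refill HQ' (DDin _ csb fsb) (DDin _ cst fst') (DDin _ csl fsl) (DDin _ csr fsr)).
- move=> s s01; have [-> -> -> ->] := DDE s 0 s01 (@unit0 R).
  by have [? ? ? ?] := fr s s01; rewrite !Dz0.
- move=> s s01; have [b0 t0 l0 r0] := DDE 0 s (@unit0 R) s01.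
  by have [b1 t1 l1 r1] := DDE 1 s (@unit1 R) s01; rewrite b0 t0 l0 r0 b1 t1 l1 r1.
move=> B BQ' BD.
have BE z : frame z -> B z = place a (g z) e_x.
  apply: (frameP (fun z => B z = place a (g z) e_x)).1 => s s01.
  have [-> -> -> ->] := BD s s01.
  by have [-> -> -> ->] := DDE s 1 s01 (@unit1 R); rewrite !Dz1.
have gav z : frame z -> avoids P a (g z).
  by move=> fz; apply: T1 => //; [exact: frame_usq|exact: pP].
have Qa : Q a by exact: KQ.2.
have Aa : A a by exact: KA.
(* The loop [g] lies in the fiber over [a] and bounds in the total space. *)
have gfar z : frame z -> (z.1 = 1 \/ z.2 = 1) -> g z = far_point a.
  case: z => s t fz z1; have uz := frame_usq fz; have /andP[/= s01 t01] := uz.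
  have Hz : H (s, t) = a.
    by case: z1 => /= ->; have [H1 H2] := Hconst _ s01; have [H3 H4] := Hconst _ t01;
      rewrite ?H1 ?H4.
  rewrite /g T3 // ?Hz; first by rewrite -Ha.
  move=> u u01; have fl : frame (lerp (s, t) o u).
    split; first exact: lerp_usq.
    case: z1 => /= ->; first by apply: Or42; rewrite /lerp /=; ring.
    by apply: Or44; rewrite /lerp /=; ring.
  rewrite !KH // Hz; have /andP[/= l1 l2] := frame_usq fl.
  case: z1 => /= z1; rewrite z1 in Hz fl l1 l2 *.
    have -> : lerp (1, t) o u = (1, (1 - u) * t + u * 1).
      by rewrite /lerp /=; congr pair; ring.
    by have [_ ->] := Hconst _ l2.
  have -> : lerp (s, 1) o u = ((1 - u) * s + u * 1, 1).
    by rewrite /lerp /=; congr pair; ring.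
  by have [-> _] := Hconst _ l1.
(* Erasing the point from [B] leaves a square of the other rings that is constant on the frame. *)
pose W z := place (B z) 0 0.
have WB z i : i \in P -> B z i = W z i by move=> iP; exact: place_dep.
have WQ : square_in Q W.
  split; first by apply: cont_place; [exact: BQ'.1|cont|cont].
  move=> z uz; apply: (configs_dep (C := B z)); first by move=> i; exact: WB.
  exact/Q'Q/BQ'.2.
have Wfr z : frame z -> W z = place a 0 0.
  by move=> fz; rewrite /W BE // place_place.
have [T' [T'1 T'2 T'3]] := ring_transport WQ.
have WaP z p : frame z -> avoids P (W z) p <-> avoids P a p.
  move=> fz; rewrite Wfr //; split; apply: avoids_dep => i iP; last exact: place_dep.
  by apply/esym; exact: place_dep.
pose foot (z : R * R) : R * R := (unitclamp z.1, 0).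
have cfoot : continuous foot by rewrite /foot; cont.
have ufoot z : usq (foot z) by rewrite /usq /= unitclamp01 unit0.
have ffoot z : frame (foot z) by have [] := fr1 z.1.
(* The point is brought down to the bottom side, hence into the fiber over [a]. On the bottom, left
   and right sides this changes nothing; on the top, where [g] is the far point, it leaves the
   monodromy of [W]. *)
pose tt z := T' (clamp2 z) (foot z) (rcenter (B (clamp2 z) k)).
have Bav z : usq z -> avoids P (W z) (rcenter (B z k)).
  move=> uz; have /configs_addP[_ _ _] := BQ'.2 z uz; apply: avoids_dep => i; exact: WB.
have ctt : continuous tt.
  apply: T'2 => //; first exact: clamp2_continuous.
    apply: (@cont_center _ (fun z => B (clamp2 z))).
    exact: (continuous_compose clamp2_continuous BQ'.1).
  by move=> z; split => //; [exact: clamp2_usq|apply/Bav/clamp2_usq].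
have ttav z : avoids P a (tt z).
  have uz := clamp2_usq z.
  exact: ((WaP (foot z) (tt z) (ffoot z)).1 (T'1 (clamp2 z) (foot z) _ uz (ufoot z) (Bav (clamp2 z) uz))).
(* The same descent applied to the section. It agrees with [tt] on the top and is constant on the
   other sides, so attaching it upside down to the top of [tt] makes the top side constant. *)
pose ff z := T' (clamp2 z) (foot z) (far_point (W (clamp2 z))).
have cff : continuous ff.
  apply: T'2 => //; first exact: clamp2_continuous.
    apply: (@cont_far _ (fun z => W (clamp2 z))).
    exact: (continuous_compose clamp2_continuous WQ.1).
  by move=> z; split => //; [exact: clamp2_usq|exact: far_avoids].
have ffav z : avoids P a (ff z).
  have uz := clamp2_usq z.
  have fz := far_avoids (C := W (clamp2 z)) (erefl (far_point (W (clamp2 z)) 0 0)).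
  exact: ((WaP (foot z) (ff z) (ffoot z)).1 (T'1 (clamp2 z) (foot z) _ uz (ufoot z) fz)).
have inQA (w : R * R -> 'rV[R]_3) : continuous w -> (forall z, avoids P a (w z)) ->
    square_in (Q' `&` A') (fun z => place a (w z) e_x).
  move=> cw wa; split; first by apply: cont_place; cont.
  by move=> z _; split; [exact: place_in|exact: place_par].
have far_a : far_point (place a 0 0) = far_point a.
  by apply: far_dep => i iP; apply/esym; exact: place_dep.
have T'side (s t : R) p : 0 <= s <= 1 -> 0 <= t <= 1 -> (s = 0 \/ s = 1 \/ t = 0) ->
    T' (s, t) (s, 0) p = p.
  move=> s01 t01 st0; apply: T'3 => //; [by rewrite /usq /= s01|by rewrite /usq /= s01 unit0|].
  move=> u /andP[u0 u1].
  have lE : lerp (s, t) (s, 0) u = (s, (1 - u) * t).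
    by rewrite /lerp /=; congr pair; ring.
  have ut : 0 <= (1 - u) * t <= 1.
    by case/andP: t01 => t0 t1; rewrite mulr_ge0 ?subr_ge0 //= mulr_ile1 ?subr_ge0 // lerBlDr lerDl.
  rewrite lE; case: st0 => [->|[->|->]].
  - by rewrite !Wfr //; [have [] := fr _ t01|have [] := fr _ ut].
  - by rewrite !Wfr //; [have [] := fr _ t01|have [] := fr _ ut].
  - by rewrite mulr0.
have Bk z : frame z -> rcenter (B z k) = g z by move=> fz; rewrite BE // place_k.
have Wfar z : frame z -> far_point (W z) = far_point a by move=> fz; rewrite Wfr.
have clE (s t : R) : 0 <= s <= 1 -> 0 <= t <= 1 ->
    clamp2 (s, t) = (s, t) /\ foot (s, t) = (s, 0).
  by move=> s01 t01; rewrite /clamp2 /foot /= !unitclamp_id.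
have u0 := @unit0 R; have u1 := @unit1 R.
have ttb s : 0 <= s <= 1 -> tt (s, 0) = g (s, 0).
  move=> s01; have [c1 c3] := clE s 0 s01 u0; rewrite /tt c1 c3 T'side //; last by right; right.
  by rewrite Bk //; have [] := fr _ s01.
have ttl s : 0 <= s <= 1 -> tt (0, s) = g (0, s).
  move=> s01; have [c1 c3] := clE 0 s u0 s01; rewrite /tt c1 c3 T'side //; last by left.
  by rewrite Bk //; have [] := fr _ s01.
have ttr s : 0 <= s <= 1 -> tt (1, s) = g (1, s).
  move=> s01; have [c1 c3] := clE 1 s u1 s01; rewrite /tt c1 c3 T'side //; last by right; left.
  by rewrite Bk //; have [] := fr _ s01.
have ffb s : 0 <= s <= 1 -> ff (s, 0) = far_point a.
  move=> s01; have [c1 c3] := clE s 0 s01 u0; rewrite /ff c1 c3 T'side //; last by right; right.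
  by rewrite Wfar //; have [] := fr _ s01.
have ffl s : 0 <= s <= 1 -> ff (0, s) = far_point a.
  move=> s01; have [c1 c3] := clE 0 s u0 s01; rewrite /ff c1 c3 T'side //; last by left.
  by rewrite Wfar //; have [] := fr _ s01.
have ffr s : 0 <= s <= 1 -> ff (1, s) = far_point a.
  move=> s01; have [c1 c3] := clE 1 s u1 s01; rewrite /ff c1 c3 T'side //; last by right; left.
  by rewrite Wfar //; have [] := fr _ s01.
have fft s : 0 <= s <= 1 -> ff (s, 1) = tt (s, 1).
  move=> s01; have [c1 c3] := clE s 1 s01 u1; rewrite /ff /tt c1 c3.
  have f1 : frame (s, 1) by have [] := fr _ s01.
  by rewrite Wfar // Bk // gfar //; right.
have ctt' (h : R * R -> R * R) : continuous h -> continuous (fun z => tt (h z)).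
  by move=> ch; exact: (continuous_compose ch ctt).
have [||||||L LQA LE] := collar (X := Q' `&` A') (inQA _ ctt ttav)
  (Db := fun z => place a (tt (sb z)) e_x) (Dl := fun z => place a (tt (sl z)) e_x)
  (Dr := fun z => place a (tt (sr z)) e_x)
  (Dt := fun z => place a (ff (z.1, 1 - z.2)) e_x).
- by apply: inQA => [|z]; [exact: ctt'|exact: ttav].
- apply: inQA => [|z]; last exact: ffav.
  by apply: (@continuous_compose _ _ _ (fun z : R * R => (z.1, 1 - z.2)) ff) => //; cont.
- by apply: inQA => [|z]; [exact: ctt'|exact: ttav].
- by apply: inQA => [|z]; [exact: ctt'|exact: ttav].
- by move=> s s01; rewrite /= /sb /sl /sr /= unitclamp_id // subr0 fft.
- move=> s s01; have s01' : 0 <= 1 - s <= 1 by move: s01; lra.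
  rewrite /= /sb /sl /sr /= e0 e1 ffl // ffr // !ttl // !ttr //.
  have [_ f2 f1 _] := fr 1 u1.
  by rewrite (gfar _ f1) ?(gfar _ f2) //; right.
exists L; split => //.
apply/frameP => s s01; have [-> -> -> ->] := LE s s01.
rewrite /= /sb /sl /sr /= unitclamp_id // subrr ttb // ttl // ttr // ffb //.
have [f1 f2 f3 f4] := fr s s01; rewrite !BE //; split => //.
by rewrite [g (s, 1)]gfar //; right.
Qed.

Lemma add_point_good : good R Q A -> good R Q' A'.
Proof.
by move=> [r0 c1 c2]; split; [exact: add_reaches|exact: add_compresses_paths|
  exact: add_compresses_squares].
Qed.

End add_point.

(** * Induction on the number of rings *)

Section rings_good.
Context {R : realType} (n : nat).
Local Notation V := {ptws 'I_n -> ring_data R}.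
Implicit Types (C : V) (B S D J : {set 'I_n}).

Definition sink B (t : R) C : V := fun i =>
  if i \in B then with_square (C i) (Num.max 0 (rsquare (C i) - t)) else C i.

Definition inflate B (t : R) C : V := fun i =>
  if i \in B then with_square (C i) (rsquare (C i) + t) else C i.

Lemma cont_sink {X : topologicalType} B (t : X -> R) (f : X -> V) :
  continuous t -> continuous f -> continuous (fun x => sink B (t x) (f x)).
Proof.
move=> ct cf; apply: cont_family => i; rewrite /sink; have ci := @cont_proj X _ n f i cf.
case: (i \in B) => //; apply: cont_with_square => //.
apply: cont_max; first exact: cst_continuous.
by cont; exact: cont_rsquare.
Qed.

Lemma cont_inflate {X : topologicalType} B (t : X -> R) (f : X -> V) :
  continuous t -> continuous f -> continuous (fun x => inflate B (t x) (f x)).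
Proof.
move=> ct cf; apply: cont_family => i; rewrite /inflate; have ci := @cont_proj X _ n f i cf.
case: (i \in B) => //; apply: cont_with_square => //.
by cont; exact: cont_rsquare.
Qed.

Lemma sink_square B t C i : i \in B ->
  rsquare (sink B t C i) = Num.max 0 (rsquare (C i) - t).
Proof. by rewrite /sink => ->. Qed.

Lemma sink_normal B t C i : rnormal (sink B t C i) = rnormal (C i).
Proof. by rewrite /sink; case: ifP. Qed.

Lemma inflate_square B t C i : i \in B -> rsquare (inflate B t C i) = rsquare (C i) + t.
Proof. by rewrite /inflate => ->. Qed.

Lemma inflate_normal B t C i : rnormal (inflate B t C i) = rnormal (C i).
Proof. by rewrite /inflate; case: ifP. Qed.

Lemma with_square_id (a : ring_data R) : with_square a (rsquare a) = a.
Proof. by case: a => -[]. Qed.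

Lemma inflate0 B C : inflate B 0 C = C.
Proof. by apply/funext => i; rewrite /inflate; case: ifP; rewrite ?addr0 ?with_square_id. Qed.

Lemma sink0 B C : (forall i, i \in B -> 0 <= rsquare (C i)) -> sink B 0 C = C.
Proof.
move=> C0; apply/funext => i; rewrite /sink; case: ifP => // iB.
by rewrite subr0 max_r ?with_square_id // C0.
Qed.

Lemma sink_sink B s t C : 0 <= s -> sink B s (sink B t C) = sink B (t + s) C.
Proof.
move=> s0; apply/funext => i; rewrite /sink; case: ifP => iB; rewrite ?iB //.
rewrite /with_square /rsquare /rcenter /rnormal /=; congr (_, _, _).
case: (leP 0 ((C i).1.2 - t)) => h.
  by congr Num.max; rewrite opprD addrA.
rewrite sub0r max_l ?max_l //; lra.
Qed.

Lemma cont_bigmax {X : topologicalType} (r : seq 'I_n) (P : pred 'I_n) (f : 'I_n -> X -> R) :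
  (forall i, continuous (f i)) -> continuous (fun x => \big[Num.max/0]_(i <- r | P i) f i x).
Proof.
move=> cf; elim: r => [|i r ih].
  by under eq_fun do rewrite big_nil; exact: cst_continuous.
by under eq_fun do rewrite big_cons; case: (P i) => //; apply: cont_max.
Qed.

(** Separation is an open condition and the square is compact, so a common positive amount can be
    added to the squared radii of [S] all along the square. *)
Lemma inflate_pushes S D (A : set V) :
  (forall C C', (forall i, rnormal (C i) = rnormal (C' i)) -> A C -> A C') ->
  [disjoint S & D]%B ->
  pushes R (degenerate_configs R n S D) (configs R n S D) A.
Proof.
move=> A_normal SD g [cg gX].
have [e e0 He] : exists2 e : R, 0 < e & forall z (t : R), usq z -> 0 <= t <= e ->
    pairwise_separated (S :|: D) (inflate S t (g z)).
  have /compact_near_coveringP cov := @usq_compact R.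
  have near1 : \forall t \near (0 : R), forall z, usq z ->
      pairwise_separated (S :|: D) (inflate S t (g z)).
    apply: (cov _ (nbhs (0 : R)) (fun t z => pairwise_separated (S :|: D) (inflate S t (g z)))).
    move=> z uz.
    have c : continuous (fun w : (R * R) * R => inflate S w.2 (g w.1)).
      by apply: cont_inflate; [cont|apply: (continuous_compose _ cg); cont].
    have : nbhs (z, 0 : R) ((fun w : (R * R) * R => inflate S w.2 (g w.1)) @^-1`
        pairwise_separated (S :|: D)).
      apply: c; apply: open_nbhs_nbhs; split; first exact: pairwise_separated_open.
      by rewrite /= inflate0; have [] := gX z uz.
    by case=> -[U W] [/= nU nW] UW; exists (U, W) => // -[z' t] ?; exact: UW.
  case/nbhs_ballP: near1 => e /= e0 He; exists (e / 2); first by rewrite divr_gt0.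
  move=> z t uz /andP[t0 te]; apply: He => //.
  rewrite /ball /= sub0r normrN ger0_norm // (le_lt_trans te) //.
  by rewrite ltr_pdivrMr // ltr_pMr // ltr1n.
have cG : continuous (fun w : (R * R) * R => inflate S (w.2 * e) (g w.1)).
  by apply: cont_inflate; [cont|apply: (continuous_compose _ cg); cont].
exists (fun w => inflate S (w.2 * e) (g w.1)); split => //.
move=> z u uz /andP[u0 u1] /=; have [h1 h2 h3 h4] := gX z uz.
have ue t : 0 <= t <= 1 -> 0 <= t * e <= e.
  by move=> /andP[t0 t1]; rewrite mulr_ge0 ?(ltW e0) //= ler_piMl // ltW.
have nD t i : i \in D -> inflate S t (g z) i = g z i.
  by move=> iD; rewrite /inflate (disjointFl SD).
have un t : unit_normals (S :|: D) (inflate S t (g z)).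
  by move=> i iP; rewrite inflate_normal; exact: h3.
have dD t i : i \in D -> rsquare (inflate S t (g z) i) = 0.
  by move=> iD; rewrite nD // h2.
have s0 t : 0 <= t <= 1 -> 0 <= t * e by move=> /ue /andP[].
split.
- split; [|exact: dD|exact: un|].
    by move=> i iS; rewrite inflate_square // addr_ge0 ?h1 // s0 // u0.
  by apply: He => //; apply: ue; rewrite u0.
- by rewrite /= mul0r inflate0.
- split; [|exact: dD|exact: un|].
    by move=> i iS; rewrite inflate_square //= mul1r ltr_wpDl // h1.
  by apply: He => //; apply: ue; exact: unit1.
- move=> [p1 _ _ _]; split; [|exact: dD|exact: un|].
    by move=> i iS; rewrite inflate_square // ltr_wpDr ?p1 // s0 // u0.
  by apply: He => //; apply: ue; rewrite u0.
- by apply: A_normal => i; rewrite inflate_normal.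
Qed.

Lemma parallel_normals_eq P C C' : (forall i, rnormal (C i) = rnormal (C' i)) ->
  parallel_normals R n P C -> parallel_normals R n P C'.
Proof. by move=> CC' CP i iP; rewrite -CC' CP. Qed.

Lemma degenerate_good S D P : [disjoint S & D]%B ->
  good R (degenerate_configs R n S D) (parallel_normals R n P) <->
  good R (configs R n S D) (parallel_normals R n P).
Proof.
move=> SD; apply: pushes_good.
  by move=> C [h1 h2 h3 h4]; split => // i /h1/ltW.
by apply: inflate_pushes => // C C'; exact: parallel_normals_eq.
Qed.

Lemma points_good S : good R (configs R n S finset.set0) (parallel_normals R n S) ->
  forall D, [disjoint S & D]%B -> good R (configs R n S D) (parallel_normals R n (S :|: D)).
Proof.
move=> gS D; move: {2}#|D| (erefl #|D|) => m; elim: m D => [|m ih] D cD SD.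
  by move/eqP: cD; rewrite cards_eq0 => /eqP ->; rewrite finset.setU0.
have /card_gt0P[k kD] : (0 < #|D|)%N by rewrite cD.
rewrite -(finset.setD1K kD); apply: add_point_good.
  by rewrite !inE eqxx /= orbF (disjointFl SD).
apply: ih; first by move: cD; rewrite (cardsD1 k) kD => -[].
by apply: disjointWr SD; exact: finset.subsetDl.
Qed.

(** The members of the open cover: ring [i] can be shrunk to a point together with a lowering of all
    others. Unlike being a smallest ring, this is an open condition. *)
Definition sinkable B i : set V := [set C | forall t : R, 0 <= t <= 1 ->
  pairwise_separated B (sink B (t * rsquare (C i)) C)].

Lemma sinkable_open B i : open (sinkable B i).
Proof.
rewrite openE => C HC; rewrite /interior.
have /compact_near_coveringP cov := @segment_compact R 0 1.
have c : continuous (fun w : R * V => sink B (w.1 * rsquare (w.2 i)) w.2).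
  apply: cont_sink; last exact: cont_snd (@cont_id _).
  cont; apply: cont_rsquare; apply: (@cont_proj (R * V)%type _ n snd).
  exact: cont_snd (@cont_id _).
have : \forall C' \near C, forall t : R, `[0, 1]%classic t ->
    pairwise_separated B (sink B (t * rsquare (C' i)) C').
  apply: (cov _ (nbhs C) (fun C' t => pairwise_separated B (sink B (t * rsquare (C' i)) C'))).
  move=> t; rewrite /= in_itv /= => t01.
  have : nbhs (t, C) ((fun w : R * V => sink B (w.1 * rsquare (w.2 i)) w.2) @^-1`
      pairwise_separated B).
    by apply: c; apply: open_nbhs_nbhs; split; [exact: pairwise_separated_open|exact: HC].
  by case=> -[U W] [/= nU nW] UW; exists (U, W) => // -[t' C'] ?; exact: UW.
by apply: filterS => C' HC' t t01; apply: HC'; rewrite /= in_itv.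
Qed.

(* Lowering all squared radii equally keeps rings separated, so that the smallest
   ring can be shrunk to a point first. *)
Lemma sinkable_cover B C : B != finset.set0 -> degenerate_configs R n B finset.set0 C ->
  exists2 i, i \in B & sinkable B i C.
Proof.
move=> /finset.set0Pn[b bB] [h1 _ _ h4]; rewrite finset.setU0 in h4.
pose i0 := [arg min_(i < b in B) rsquare (C i)]%O.
have [iB imin] : i0 \in B /\ forall j, j \in B -> rsquare (C i0) <= rsquare (C j).
  by rewrite /i0; case: Order.TotalTheory.arg_minP.
exists i0 => // t /andP[t0 t1] i j iP jP ij; rewrite /sink iP jP.
have e k : k \in B -> Num.max 0 (rsquare (C k) - t * rsquare (C i0)) =
    rsquare (C k) - t * rsquare (C i0).
  move=> kB; rewrite max_r // subr_ge0 (le_trans _ (imin k kB)) //.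
  by rewrite ler_piMl // h1.
rewrite !e //; apply: separated_shrink; last exact: h4.
by rewrite mulr_ge0 // h1.
Qed.

(** All rings sink together by [m], the largest squared radius in [J]; this keeps them separated
    because a ring of [J] that attains [m] is sinkable. The motion stays in [X], since a further
    sinking by a ring of [J] still adds up to at most [m]. *)
Lemma sink_pushes B J P : J \subset B -> J != finset.set0 ->
  let X := degenerate_configs R n B finset.set0 `&` [set C | forall i, i \in J -> sinkable B i C] in
  let Y := degenerate_configs R n (B :\: J) J in
  Y `<=` X /\ pushes R X Y (parallel_normals R n P).
Proof.
move=> JB J0 X Y; have BJ : B :\: J :|: J = B.
  apply/setP => i; rewrite !inE.
  by case: (boolP (i \in J)) => [/(fintype.subsetP JB) ->|]; rewrite ?orbT ?orbF.
have YX : Y `<=` X.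
  move=> C [h1 h2]; rewrite BJ => h3 h4.
  have C0 i : i \in B -> 0 <= rsquare (C i).
    by move=> iB; case: (boolP (i \in J)) => [/h2 ->//|iJ]; apply: h1; rewrite inE iJ.
  split; first by split => //; rewrite ?finset.setU0 // => i; rewrite inE.
  by move=> i iJ t _; rewrite h2 // mulr0 sink0.
split => // g [cg gX].
pose m C := \big[Num.max/0]_(i in J) rsquare (C i).
have cm (Z : topologicalType) (f : Z -> V) : continuous f -> continuous (fun z => m (f z)).
  by move=> cf; apply: cont_bigmax => i; apply: cont_rsquare; exact: cont_proj.
have mge C i : i \in J -> rsquare (C i) <= m C.
  by move=> iJ; rewrite /m (bigD1 i) //= le_max lexx.
have m0 C : 0 <= m C.
  by rewrite /m; elim/big_rec: _ => // k x _ x0; rewrite le_max x0 orbT.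
have mE C : (forall i, i \in B -> 0 <= rsquare (C i)) -> exists2 i, i \in J & m C = rsquare (C i).
  move=> C0; have /finset.set0Pn[j jJ] := J0.
  pose i0 := [arg max_(i > j in J) rsquare (C i)]%O.
  have [iJ imax] : i0 \in J /\ forall k, k \in J -> rsquare (C k) <= rsquare (C i0).
    by rewrite /i0; case: Order.TotalTheory.arg_maxP.
  exists i0 => //; apply/eqP; rewrite eq_le mge // andbT.
  rewrite /m; elim/big_rec: _ => [|k x kJ x0]; first by apply/C0/(fintype.subsetP JB).
  by rewrite ge_max imax.
have Xsep C s : X C -> 0 <= s <= m C -> pairwise_separated B (sink B s C).
  move=> [[h1 _ _ h4] hU] /andP[s0 sm]; have [i iJ mi] := mE C h1.
  have [z|mn] := eqVneq (m C) 0.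
    have -> : s = 0 by apply/eqP; rewrite eq_le s0 -z sm.
    by rewrite sink0 //; rewrite finset.setU0 in h4.
  have mp : 0 < m C by rewrite lt_neqAle eq_sym mn m0.
  have -> : s = s / m C * rsquare (C i) by rewrite -mi mulfVK.
  by apply: hU => //; rewrite divr_ge0 // ler_pdivrMr // mul1r.
exists (fun w => sink B (w.2 * m (g w.1)) (g w.1)); split.
  have c1 : continuous (fun w : (R * R) * R => g w.1) by apply: (continuous_compose _ cg); cont.
  by apply: cont_sink => //; apply: cont_mul; [cont|exact: cm].
move=> z u uz /andP[u0 u1] /=; have gz := gX z uz; have [[h1 h2 h3 h4] hU] := gz.
rewrite finset.setU0 in h3.
have um : 0 <= u * m (g z) <= m (g z) by rewrite mulr_ge0 //= ler_piMl.
have un t : unit_normals B (sink B t (g z)).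
  by move=> i iB; rewrite sink_normal; exact: h3.
have sq t i : i \in B -> 0 <= rsquare (sink B t (g z) i).
  by move=> iB; rewrite sink_square // le_max lexx.
split.
- split.
    split; rewrite ?finset.setU0; [by move=> i; exact: sq|by move=> i; rewrite inE| |].
      exact: un.
    exact: Xsep.
  move=> i iJ t /andP[t0 t1]; have iB := fintype.subsetP JB i iJ.
  rewrite sink_sink ?mulr_ge0 ?sq //; apply: Xsep => //.
  rewrite sink_square //; have := mge (g z) i iJ; have := m0 (g z).
  move: um; set M := m _; set r := rsquare _; set v := u * M => /andP[v0 vM] M0 rM.
  have w0 : 0 <= Num.max 0 (r - v) by rewrite le_max lexx.
  have wM : Num.max 0 (r - v) <= M - v by rewrite ge_max; lra.
  by rewrite addr_ge0 ?mulr_ge0 //= -lerBrDl (le_trans _ wM) // ler_piMl.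
- by rewrite /= mul0r sink0.
- split; rewrite ?BJ; [| |exact: un|by apply: Xsep => //; rewrite /= mul1r m0 lexx].
  + by move=> i; rewrite inE => /andP[_ iB]; exact: sq.
  + move=> i iJ; have iB := fintype.subsetP JB i iJ.
    by rewrite sink_square //= mul1r max_l // subr_le0 mge.
- move=> Yg; have [_ y2 _ _] := Yg; have [i iJ mi] := mE (g z) h1.
  by rewrite mi y2 // mulr0 sink0.
- by apply: parallel_normals_eq => i; rewrite sink_normal.
Qed.

Lemma trivial_good {T : topologicalType} (X : set T) : good R X setT.
Proof.
split.
- by move=> x Xx; exists (fun=> x); split => //; split => //; exact: cst_continuous.
- move=> p [cp pX] _ _; exists (fun z => p z.1); split => //.
  split; first by apply: (continuous_compose _ cp); cont.
  by move=> z /andP[/pX].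
- by move=> H HX _; exists H; rewrite setIT.
Qed.

Lemma rings_good B : good R (configs R n B finset.set0) (parallel_normals R n B).
Proof.
move: {2}#|B|.+1 (ltnSn #|B|) => m; elim: m B => // m ih B; rewrite ltnS => Bm.
have [->|B0] := eqVneq B finset.set0.
  have -> : parallel_normals R n finset.set0 = setT.
    by apply/seteqP; split => // C _ i; rewrite inE.
  exact: trivial_good.
apply/degenerate_good; first by rewrite -finset.setI_eq0 finset.setI0.
have /finset.set0Pn[b bB] := B0.
(* The cover is indexed by all of ['I_n]; indices outside [B] repeat the member of [b]. *)
pose nu i := if i \in B then i else b.
have nuB i : nu i \in B by rewrite /nu; case: ifP.
apply: (@good_cover R V _ _ _ (fun i => sinkable B (nu i))).
- by move=> i; exact: sinkable_open.
- move=> C /(sinkable_cover B0)[i iB Ci]; exists i.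
  by rewrite /nu iB.
move=> r r0; pose J : {set 'I_n} := [set nu i | i in r]%SET.
have JB : J \subset B by apply/fintype.subsetP => j /imsetP[i _ ->].
have J0 : J != finset.set0.
  case: r r0 @J JB => // a r _ J _; apply/finset.set0Pn; exists (nu a).
  by apply/imsetP; exists a; rewrite ?mem_head.
have -> : [set v | {in r, forall i, sinkable B (nu i) v}] =
    [set C | forall i, i \in J -> sinkable B i C].
  apply/seteqP; split => C /= HC i; first by case/imsetP => k kr ->; exact: HC.
  by move=> ir; apply: HC; apply/imsetP; exists i.
have [YX push] := @sink_pushes B J B JB J0.
apply/(pushes_good YX push).
have dBJ : [disjoint B :\: J & J]%B 
  by rewrite -finset.setI_eq0; apply/eqP/setP => i; rewrite !inE; case: (i \in J); rewrite ?andbF.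
apply/degenerate_good => //.
have BJ : B :\: J :|: J = B.
  apply/setP => i; rewrite !inE.
  by case: (boolP (i \in J)) => [/(fintype.subsetP JB) ->|]; rewrite ?orbT ?orbF.
rewrite -{2}BJ; apply: points_good => //; apply: ih; apply: leq_trans Bm.
apply: proper_card; rewrite properE finset.subsetDl /=; have /finset.set0Pn[j jJ] := J0.
by apply/negP => /fintype.subsetP/(_ j (fintype.subsetP JB j jJ)); rewrite inE jJ.
Qed.

End rings_good.

(** * Links *)

Section unlinked_separated.
Context {R : realType}.
Local Notation rdata := (ring_data R).
Implicit Types (u x y : 'rV[R]_3) (a b : rdata).

Definition cross u (v : 'rV[R]_3) : 'rV[R]_3 :=
  vec3 (u 0 1 * v 0 2 - u 0 2 * v 0 1) (u 0 2 * v 0 0 - u 0 0 * v 0 2)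
       (u 0 0 * v 0 1 - u 0 1 * v 0 0).

Lemma orthonormal_frame u : unit_sphere u -> exists e1 e2 : 'rV[R]_3,
  (forall p q k : R, let w := p *: e1 + q *: e2 + k *: u in
     [/\ dotp w e1 = p, dotp w e2 = q, dotp w u = k &
         dotp w w = p ^+ 2 + q ^+ 2 + k ^+ 2]) /\
  forall w, w = dotp w e1 *: e1 + dotp w e2 *: e2 + dotp w u *: u.
Proof.
rewrite /unit_sphere /= => u1; have [v v0 vu] := orthogonal_neq0 u.
pose e1 := normalize v; pose e2 := cross u e1; exists e1, e2.
have e11 : dotp e1 e1 = 1 := normalize_unit v0.
have e1u : dotp e1 u = 0 by rewrite /e1 /normalize dotpZl vu mulr0.
clearbody e1; have e21 : dotp e2 e1 = 0 by rewrite dotp3E /e2 /cross !vec3E; ring.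
have e2u : dotp e2 u = 0 by rewrite dotp3E /e2 /cross !vec3E; ring.
have e22 : dotp e2 e2 = 1.
  have -> : dotp e2 e2 = dotp u u * dotp e1 e1 - dotp e1 u ^+ 2.
    by rewrite !dotp3E /e2 /cross !vec3E; ring.
  by rewrite u1 e11 e1u expr0n subr0 mulr1.
have e12 : dotp e1 e2 = 0 by rewrite dotpC.
have ue1 : dotp u e1 = 0 by rewrite dotpC.
have ue2 : dotp u e2 = 0 by rewrite dotpC.
split => [p q k|w].
  by split; rewrite !(dotpDl, dotpDr, dotpZl, dotpZr) ?e11 ?e22 ?u1 ?e12 ?e21 ?e1u ?e2u ?ue1 ?ue2; ring.
pose M : 'M[R]_3 := \matrix_i [:: e1; e2; u]`_i.
have rowM (i : 'I_3) : row i M = [:: e1; e2; u]`_i by rewrite rowK.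
have ME (i j : 'I_3) : (M *m M^T) i j = dotp (row i M) (row j M).
  by rewrite dotpE mxE; apply: eq_bigr => k _; rewrite !mxE.
(* A one-sided inverse of a square matrix is two-sided, which turns orthonormality into the
   expansion of [w]. *)
have /mulmx1C MM : M *m M^T = 1%:M.
  apply/matrixP => i j; rewrite ME !rowM mxE.
  by case: i => [[|[|[|//]]] ?]; case: j => [[|[|[|//]]] ?] /=.
rewrite -{1}[w]mulmx1 -MM mulmxA; apply/rowP => j; rewrite !mxE.
rewrite !big_ord_recl big_ord0 addr0 addrA.
have wM (i : 'I_3) : (w *m M^T) 0 i = dotp w [:: e1; e2; u]`_i.
  by rewrite -rowM dotpE mxE; apply: eq_bigr => k _; rewrite !mxE.
by rewrite !wM !mxE.
Qed.

(* [k = 0] gives the flat disk and [k = 1], [k = -1] give the hemispheres. *)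
Lemma ring_disk a (k : R) : 0 < rsquare a -> unit_sphere (rnormal a) ->
  exists D, bounds_disk [set x | power a x = 0 /\ height a x = 0] D /\
  forall x, D x -> exists2 h : R, 0 <= h &
    height a x = k * h /\ power a x = (k ^+ 2 - 1) * h ^+ 2.
Proof.
move=> a0 u1; have [e1 [e2 [comb span]]] := orthonormal_frame u1.
set u := rnormal a in u1 comb span; pose r := Num.sqrt (rsquare a).
have r0 : 0 < r by rewrite sqrtr_gt0.
have rr : r ^+ 2 = rsquare a by rewrite sqr_sqrtr // ltW.
pose s (v : 'rV[R]_2) : R := r * Num.sqrt (1 - dotp v v).
pose w (v : 'rV[R]_2) := (r * v 0 0) *: e1 + (r * v 0 1) *: e2 + (k * s v) *: u.
have dE (v : 'rV[R]_2) : dotp v v = v 0 0 ^+ 2 + v 0 1 ^+ 2.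
  rewrite dotpE !big_ord_recl big_ord0 addr0 !expr2.
  by have -> : lift ord0 ord0 = 1 :> 'I_2 by apply: val_inj.
have cf : continuous (fun v => rcenter a + w v).
  rewrite /w /s; apply: cont_add; first exact: cst_continuous.
  have c0 : continuous (fun v : 'rV[R]_2 => r * v 0 0).
    by apply: cont_mul; [exact: cst_continuous|apply: cont_coord; exact: cont_id].
  have c1 : continuous (fun v : 'rV[R]_2 => r * v 0 1).
    by apply: cont_mul; [exact: cst_continuous|apply: cont_coord; exact: cont_id].
  have c2 : continuous (fun v : 'rV[R]_2 => k * (r * Num.sqrt (1 - dotp v v))).
    apply: cont_mul; first exact: cst_continuous.
    apply: cont_mul; first exact: cst_continuous.
    apply: cont_sqrt; apply: cont_add; first exact: cst_continuous.
    by apply: cont_opp; apply: cont_dotp; exact: cont_id.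
  by apply: cont_add; [apply: cont_add|]; apply: cont_scale => //; exact: cst_continuous.
have cw v : rcenter a + w v - rcenter a = w v by rewrite addrC addKr.
have hE v : height a (rcenter a + w v) = k * s v.
  by rewrite /height cw; have [] := comb (r * v 0 0) (r * v 0 1) (k * s v).
have sE v : unit_disk v -> s v ^+ 2 = rsquare a - rsquare a * dotp v v.
  by move=> v1; rewrite exprMn rr sqr_sqrtr ?subr_ge0 // mulrBr mulr1.
have pE v : unit_disk v -> power a (rcenter a + w v) = (k ^+ 2 - 1) * s v ^+ 2.
  move=> v1; rewrite /power cw; have [_ _ _ ->] := comb (r * v 0 0) (r * v 0 1) (k * s v).
  rewrite [(r * v 0 0) ^+ 2]exprMn [(r * v 0 1) ^+ 2]exprMn [(k * _) ^+ 2]exprMn rr sE // dE; ring.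
exists ((fun v => rcenter a + w v) @` unit_disk); split; last first.
  move=> x [v v1 <-]; exists (s v); first by rewrite mulr_ge0 ?sqrtr_ge0 // ltW.
  by rewrite hE pE.
exists (fun v => rcenter a + w v); split => //.
- exact: continuous_subspaceT.
- move=> v v' _ _ /addrI vv'; apply/rowP => i.
  have [f1 f2 _ _] := comb (r * v 0 0) (r * v 0 1) (k * s v).
  have [g1 g2 _ _] := comb (r * v' 0 0) (r * v' 0 1) (k * s v').
  have h1 : r * v 0 0 = r * v' 0 0 by rewrite -f1 -g1 -/(w v) -/(w v') vv'.
  have h2 : r * v 0 1 = r * v' 0 1 by rewrite -f2 -g2 -/(w v) -/(w v') vv'.
  have rn : r != 0 by rewrite gt_eqF.
  case: i => [[|[|//]] ?].
    by have := mulfI rn h1; congr (v _ _ = v' _ _); exact: val_inj.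
  by have := mulfI rn h2; congr (v _ _ = v' _ _); exact: val_inj.
apply/seteqP; split => [x [v v1 <-]|x [px hx]].
  have sv : s v = 0 by rewrite /s v1 subrr sqrtr0 mulr0.
  by rewrite /= hE pE ?sv ?expr0n ?mulr0 // /unit_disk /= v1.
pose y := x - rcenter a.
pose v : 'rV[R]_2 := \row_i [:: dotp y e1 / r; dotp y e2 / r]`_i.
have rn : r != 0 by rewrite gt_eqF.
have v0E : r * v 0 0 = dotp y e1 by rewrite mxE /= mulrC mulfVK.
have v1E : r * v 0 1 = dotp y e2 by rewrite mxE /= mulrC mulfVK.
have yy : dotp y y = (r * v 0 0) ^+ 2 + (r * v 0 1) ^+ 2.
  rewrite {1 2}(span y) v0E v1E; have [_ _ _ ->] := comb (dotp y e1) (dotp y e2) (dotp y u).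
  by have -> : dotp y u = 0 := hx; rewrite expr0n addr0.
have vv : dotp v v = 1.
  have : r ^+ 2 * dotp v v = r ^+ 2.
    rewrite dE mulrDr -!exprMn -yy rr; apply/eqP; rewrite -subr_eq0.
    by apply/eqP; exact: px.
  by rewrite -{2}[r ^+ 2]mulr1; apply: mulfI; rewrite expf_neq0.
exists v => //; rewrite /w v0E v1E /s vv subrr sqrtr0 !mulr0.
have -> : (0 : R) = dotp y u by rewrite -[LHS]hx.
by rewrite -(span y) /y addrC subrK.
Qed.

Lemma affine_height a x y (t : R) :
  height a (x + t *: (y - x)) = (1 - t) * height a x + t * height a y.
Proof.
rewrite /height.
have -> : x + t *: (y - x) - rcenter a = (1 - t) *: (x - rcenter a) + t *: (y - rcenter a).
  by apply/rowP => i; rewrite !mxE; ring.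
by rewrite [LHS]dotpDl ![dotp (_ *: _) _]dotpZl.
Qed.

Lemma affine_power a x y (t : R) : power a (x + t *: (y - x)) =
  (1 - t) * power a x + t * power a y - t * (1 - t) * dotp (y - x) (y - x).
Proof.
rewrite /power.
have -> : x + t *: (y - x) - rcenter a = (1 - t) *: (x - rcenter a) + t *: (y - rcenter a).
  by apply/rowP => i; rewrite !mxE; ring.
have -> : y - x = (y - rcenter a) - (x - rcenter a) by rewrite opprB addrA subrK.
move: (x - _) (y - _) => p q.
rewrite !(dotpDl, dotpDr, dotpNl, dotpNr, dotpZl, dotpZr) (dotpC q p); ring.
Qed.

(* The point [x0] of the disk of [a] is the one whose image under the affine map
   [(l1, height b)] is closest to the origin. By convexity it yields an affine
   function that is positive on this disk, and the signs of its coefficients tell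
   which of the two rings to span by a hemisphere, the other one being spanned by
   its flat disk. *)
Lemma separated_unlinked a b : 0 < rsquare a -> unit_sphere (rnormal a) ->
  0 < rsquare b -> unit_sphere (rnormal b) -> separated a b ->
  unlinked [set x | power a x = 0 /\ height a x = 0] [set x | power b x = 0 /\ height b x = 0].
Proof.
move=> a0 ua b0 ub ab.
(* The quadratic terms cancel, so [l1] is affine. *)
pose l1 x := power b x - power a x.
pose F := [set x | height a x = 0 /\ power a x <= 0].
pose N x := l1 x ^+ 2 + height b x ^+ 2.
have cN : continuous N.
  by rewrite /N /l1; cont; first [apply: cont_power|apply: cont_height]; cont.
have cF : compact F.
  pose M : R := \sum_i `|rcenter a 0 i| + rsquare a + 1.
  have -> : F = [set x : 'rV[R]_3 | forall i, x 0 i \in `[- M, M]] `&`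
      [set x : 'rV[R]_3 | `|height a x| + Num.max 0 (power a x) <= 0].
    apply/seteqP; split => [x [hx px]|x [_ /= hp]].
      split; last by rewrite /= hx normr0 add0r max_l.
      move=> i; rewrite in_itv /= -ler_norml (le_trans (power_box i px)) // /M.
      by rewrite -!addrA lerD2r (bigD1 i) //= lerDl sumr_ge0.
    have := normr_ge0 (height a x) => n0.
    have m0 : 0 <= Num.max 0 (power a x) by rewrite le_max lexx.
    have h0 : `|height a x| = 0 by lra.
    split; first exact/eqP/normr0P.
    by apply: (@le_trans _ _ (Num.max 0 (power a x))); [rewrite le_max lexx orbT|lra].
  apply: compact_closedI; first exact: box_compact.
  apply: le_closed; last exact: cst_continuous.
  by cont; first [apply: cont_power|apply: cont_height]; cont.
have F0 : F !=set0.
  exists (rcenter a); rewrite /F /= /height /power subrr !dotp0l; split => //.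
  by rewrite sub0r oppr_le0 ltW.
have [|x0 x0F minN] := @compact_EVT_min _ R N F F0 cF; first exact: continuous_subspaceT.
move: x0F; rewrite inE => x0F.
pose al := l1 x0; pose be := height b x0.
have N0 : 0 < N x0.
  rewrite lt_neqAle addr_ge0 ?sqr_ge0 // andbT eq_sym; apply/eqP => /eqP.
  rewrite paddr_eq0 ?sqr_ge0 // !sqrf_eq0 => /andP[/eqP l0 /eqP h0].
  have [ha pa] := x0F; apply: (ab x0); split => //.
  by apply/eqP; rewrite eq_sym -subr_eq0; exact/eqP.
have pos x : F x -> 0 < al * l1 x + be * height b x.
  move=> xF; rewrite ltNge; apply/negP => neg.
  pose d := (l1 x - al) ^+ 2 + (height b x - be) ^+ 2.
  have d0 : 0 <= d by rewrite addr_ge0 ?sqr_ge0.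
  (* For this [t] the quadratic term [t ^+ 2 * d] is at most [t * N x0], half of the decrease
     [2 * t * N x0] of the linear term, so [N] would drop below its minimum. *)
  pose t := N x0 / (N x0 + d).
  have t0 : 0 < t by rewrite divr_gt0 // ltr_wpDr.
  have Nd : 0 < N x0 + d by rewrite ltr_wpDr.
  have t1 : t <= 1 by rewrite /t ler_pdivrMr // mul1r lerDl.
  have xt : F (x0 + t *: (x - x0)).
    have [h0 p0] := x0F; have [h p] := xF; rewrite /F /= affine_height affine_power h0 h !mulr0 addr0.
    split => //; have dd := dotp_ge0 (x - x0).
    have q1 : (1 - t) * power a x0 <= 0 by rewrite mulr_ge0_le0 ?subr_ge0.
    have q2 : t * power a x <= 0 by rewrite mulr_ge0_le0 // ltW.
    have q3 : 0 <= t * (1 - t) * dotp (x - x0) (x - x0).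
      by rewrite mulr_ge0 // mulr_ge0 ?subr_ge0 // ltW.
    by lra.
  have := minN _ (mem_set xt).
  have -> : N (x0 + t *: (x - x0)) = N x0 + 2 * t * (al * (l1 x - al) + be * (height b x - be)) + t ^+ 2 * d.
    rewrite /N /l1 !affine_power affine_height /d /al /be /l1; ring.
  have td : t * (N x0 + d) = N x0 by rewrite mulfVK // gt_eqF.
  have : 2 * t * (al * (l1 x - al) + be * (height b x - be)) <= - 2 * t * N x0.
    have -> : al * (l1 x - al) + be * (height b x - be) =
      (al * l1 x + be * height b x) - N x0 by rewrite /N -/al -/be; ring.
    have : t * (al * l1 x + be * height b x) <= 0 by rewrite mulr_ge0_le0 // ltW.
    by lra.
  have : t ^+ 2 * d <= t * N x0.
    rewrite expr2 -mulrA ler_pM2l //; have := mulr_ge0 (ltW t0) (ltW N0).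
    by move: td; rewrite mulrDr; lra.
  have : 0 < t * N x0 by rewrite mulr_gt0.
  by lra.
(* For [al <= 0] the flat disk of [a] is used, and the hemisphere on [b] on the side where
   [be * height b] is at most zero. At a common point [power b] vanishes, so [l1] is nonnegative and
   the affine function is not positive. *)
have [al0|al0] := lerP al 0.
  pose k : R := if 0 <= be then - 1 else 1.
  have k2 : k ^+ 2 = 1 by rewrite /k; case: ifP; rewrite ?sqrrN expr1n.
  have [D [AD HD]] := ring_disk 0 a0 ua; have [E [BE HE]] := ring_disk k b0 ub.
  exists D, E; split => //; rewrite -subset0 => x [/HD[h h0 [ha pa]] /HE[g g0 [hb pb]]].
  have xF : F x.
    split; first by rewrite ha mul0r.
    by rewrite pa expr0n sub0r mulN1r oppr_le0 sqr_ge0.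
  have := pos x xF; rewrite /l1 pb k2 subrr mul0r sub0r hb.
  have : 0 <= - power a x by rewrite oppr_ge0; case: xF.
  move: (- power a x) => q q0.
  have : al * q <= 0 by rewrite mulr_le0_ge0.
  have : be * (k * g) <= 0.
    rewrite mulrA mulr_le0_ge0 // /k; case: ifP => [b1|/negbT].
      by rewrite mulrN1 oppr_le0.
    by rewrite -ltNge mulr1 => /ltW.
  by lra.
(* The slope of the affine function along the normal of [a]. The hemisphere on [a] is put on the
   side to which the function does not decrease, so it stays positive there; on the flat disk of [b]
   within this hemisphere it would be at most zero. *)
pose mu := al * dotp ((- 2) *: (rcenter b - rcenter a)) (rnormal a) + be * dotp (rnormal a) (rnormal b).
pose k : R := if 0 <= mu then 1 else - 1.
have k2 : k ^+ 2 = 1 by rewrite /k; case: ifP; rewrite ?sqrrN expr1n.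
have [D [AD HD]] := ring_disk k a0 ua; have [E [BE HE]] := ring_disk 0 b0 ub.
exists D, E; split => //; rewrite -subset0 => x [/HD[h h0 [ha pa]] /HE[g g0 [hb pb]]].
pose y := x - (k * h) *: rnormal a.
have yF : F y.
  have ya : y - rcenter a = (x - rcenter a) - (k * h) *: rnormal a by rewrite /y addrAC.
  move: ha pa; rewrite /F /= /height /power ya k2 subrr mul0r.
  move: (x - rcenter a) => z; rewrite !(dotpDl, dotpDr, dotpNl, dotpNr, dotpZl, dotpZr).
  rewrite ua (dotpC (rnormal a) z) => -> pz; split; first by rewrite mulr1 subrr.
  by move: pz; have := sqr_ge0 (k * h); rewrite expr2; lra.
have := pos y yF.
have yE : al * l1 y + be * height b y = al * l1 x + be * height b x - k * h * mu.
  rewrite /l1 /power /height /mu.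
  have -> : y - rcenter b = (x - rcenter b) - (k * h) *: rnormal a by rewrite /y addrAC.
  have -> : y - rcenter a = (x - rcenter a) - (k * h) *: rnormal a by rewrite /y addrAC.
  have -> : rcenter b - rcenter a = (x - rcenter a) - (x - rcenter b).
    by apply/rowP => i; rewrite !mxE; ring.
  move: (x - rcenter a) (x - rcenter b) => p q.
  rewrite !(dotpDl, dotpDr, dotpNl, dotpNr, dotpZl, dotpZr).
  rewrite (dotpC (rnormal a) p) (dotpC (rnormal a) q); ring.
rewrite yE hb mul0r mulr0 addr0 /l1 pa k2 subrr mul0r subr0 pb expr0n sub0r mulN1r.
have : 0 <= k * h * mu.
  rewrite mulrAC mulr_ge0 // /k; case: ifP => [|/negbT]; first by rewrite mul1r.
  by rewrite -ltNge mulN1r oppr_ge0 => /ltW.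
have : 0 <= al * g ^+ 2 by rewrite mulr_ge0 ?sqr_ge0 // ltW.
by rewrite mulrN; lra.
Qed.

End unlinked_separated.

(** * Continuous square roots of directions in the plane *)

Section square_roots.
Context {R : realType}.
Implicit Types (p q e : R * R).

Definition norm2 p : R := p.1 ^+ 2 + p.2 ^+ 2.
(** Squaring of complex numbers, written for pairs. *)
Definition csquare p : R * R := (p.1 ^+ 2 - p.2 ^+ 2, 2 * p.1 * p.2).
Definition direction p : R * R := (p.1 / Num.sqrt (norm2 p), p.2 / Num.sqrt (norm2 p)).

Lemma norm2_ge0 p : 0 <= norm2 p.
Proof. by rewrite addr_ge0 ?sqr_ge0. Qed.

Lemma norm2_csquare p : norm2 (csquare p) = norm2 p ^+ 2.
Proof. by rewrite /norm2 /=; ring. Qed.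

Lemma norm2_direction p : 0 < norm2 p -> norm2 (direction p) = 1.
Proof.
move=> p0; rewrite {1}/norm2 /= !exprMn -mulrDl exprVn sqr_sqrtr ?norm2_ge0 //.
by rewrite divff // gt_eqF.
Qed.

Lemma norm2_root e p : csquare e = p -> norm2 p = 1 -> norm2 e = 1.
Proof.
move=> <-; rewrite norm2_csquare => /eqP; rewrite sqrf_eq1 => /orP[/eqP//|/eqP e1].
by have := norm2_ge0 e; rewrite e1; lra.
Qed.

Lemma direction_scale p (t : R) : norm2 p = 1 -> 0 < t -> direction (t * p.1, t * p.2) = p.
Proof.
move=> p1 t0; rewrite /direction.
have -> : norm2 (t * p.1, t * p.2) = t ^+ 2.
  by rewrite /norm2 /= !exprMn -mulrDr -/(norm2 p) p1 mulr1.
have tn : t != 0 by rewrite gt_eqF.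
rewrite sqrtr_sqr gtr0_norm //; case: p p1 => a b _ /=.
by rewrite ![t * _]mulrC !mulfK.
Qed.

Lemma direction_eq p q : 0 < norm2 p -> 0 < norm2 q -> direction p = direction q ->
  exists2 k : R, 0 < k & p = (k * q.1, k * q.2).
Proof.
move=> p0 q0 [e1 e2]; pose a := Num.sqrt (norm2 p); pose b := Num.sqrt (norm2 q).
have a0 : 0 < a by rewrite sqrtr_gt0.
have b0 : 0 < b by rewrite sqrtr_gt0.
exists (a / b); first by rewrite divr_gt0.
rewrite -/a -/b in e1 e2; case: p q {p0 q0} @a @b a0 b0 e1 e2 => [p1 p2] [q1 q2] a b a0 b0 /= e1 e2.
have an : a != 0 by rewrite gt_eqF.
congr pair.
  by rewrite mulrAC -mulrA -e1 mulrC mulfVK.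
by rewrite mulrAC -mulrA -e2 mulrC mulfVK.
Qed.

Lemma csquare_eq e e' : csquare e = csquare e' -> e = e' \/ e = (- e'.1, - e'.2).
Proof.
case: e e' => [a b] [c d] [/= h1 h2].
(* The squared modulus of [(e - e') (e + e')], a difference of complex squares. *)
have z1 : ((a - c) ^+ 2 + (b - d) ^+ 2) * ((a + c) ^+ 2 + (b + d) ^+ 2) = 0.
  have -> : ((a - c) ^+ 2 + (b - d) ^+ 2) * ((a + c) ^+ 2 + (b + d) ^+ 2) =
    (a ^+ 2 - b ^+ 2 - (c ^+ 2 - d ^+ 2)) ^+ 2 + (2 * a * b - 2 * c * d) ^+ 2 by ring.
  by rewrite h1 h2 !subrr expr0n addr0.
move/eqP: z1; rewrite mulf_eq0 => /orP[]; rewrite paddr_eq0 ?sqr_ge0 // !sqrf_eq0 => /andP[].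
  by rewrite !subr_eq0 => /eqP -> /eqP ->; left.
by rewrite !addr_eq0 => /eqP -> /eqP ->; right.
Qed.

(** The half-angle formulas, with the sign of [p.2] put on the second coordinate. *)
Lemma csquare_surj p : norm2 p = 1 -> exists e, csquare e = p.
Proof.
case: p => p1 p2; rewrite /norm2 /= => n1.
have p11 : - 1 <= p1 <= 1.
  by have := sqr_ge0 p2; have := sqr_ge0 (p1 - 1); have := sqr_ge0 (p1 + 1); nra.
have u0 : 0 <= (1 + p1) / 2 by lra.
have v0 : 0 <= (1 - p1) / 2 by lra.
have uv : 2 * Num.sqrt ((1 + p1) / 2) * Num.sqrt ((1 - p1) / 2) = `|p2|.
  rewrite -mulrA -sqrtrM // -sqrtr_sqr.
  have -> : p2 ^+ 2 = 2 ^+ 2 * ((1 + p1) / 2 * ((1 - p1) / 2)) by move: n1; rewrite !expr2; lra.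
  by rewrite [RHS]sqrtrM ?sqr_ge0 // sqrtr_sqr ger0_norm.
have [p20|p20] := leP 0 p2.
  exists (Num.sqrt ((1 + p1) / 2), Num.sqrt ((1 - p1) / 2)); rewrite /csquare /=.
  by rewrite uv ger0_norm // !sqr_sqrtr //; congr pair; lra.
exists (Num.sqrt ((1 + p1) / 2), - Num.sqrt ((1 - p1) / 2)); rewrite /csquare /=.
by rewrite mulrN uv ltr0_norm // opprK sqrrN !sqr_sqrtr //; congr pair; lra.
Qed.

Lemma cont_norm2 {X : topologicalType} (f : X -> R * R) : continuous f ->
  continuous (fun x => norm2 (f x)).
Proof. by move=> cf; rewrite /norm2; cont. Qed.

Lemma cont_direction {X : topologicalType} (f : X -> R * R) : continuous f ->
  (forall x, 0 < norm2 (f x)) -> continuous (fun x => direction (f x)).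
Proof.
move=> cf f0; have ci : continuous (fun x => (Num.sqrt (norm2 (f x)))^-1).
  by apply: cont_inv => [x|]; [rewrite gt_eqF // sqrtr_gt0|apply: cont_sqrt; exact: cont_norm2].
by rewrite /direction; apply: continuous_pairing; apply: cont_mul => //; cont.
Qed.

(* For unit [z], [w] that are not opposite, [(z + w) conj(e) / |z + w|] is the
   square root of [w] that is close to the square root [e] of [z]. *)
Definition root_step z w e : R * R :=
  let m := Num.max (Num.sqrt (norm2 (z.1 + w.1, z.2 + w.2))) 1 in
  (((z.1 + w.1) * e.1 + (z.2 + w.2) * e.2) / m, ((z.2 + w.2) * e.1 - (z.1 + w.1) * e.2) / m).

Lemma root_stepP z w e : norm2 z = 1 -> norm2 w = 1 -> 1 <= norm2 (z.1 + w.1, z.2 + w.2) ->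
  csquare e = z -> csquare (root_step z w e) = w.
Proof.
move=> z1 w1 zw ez; rewrite /root_step max_l; last by rewrite -sqrtr1 ler_wsqrtr.
set m := Num.sqrt _; have m1 : m ^+ 2 = norm2 (z.1 + w.1, z.2 + w.2).
  by rewrite sqr_sqrtr ?norm2_ge0.
have mn : m != 0 by apply/eqP => m0; move: zw; rewrite -m1 m0 expr0n /=; lra.
clearbody m; move: z1 w1 zw m1; rewrite -ez; case: w e {ez} => [w1 w2] [e1 e2].
rewrite /norm2 /csquare /=.
set z1 := e1 ^+ 2 - e2 ^+ 2; set z2 := 2 * e1 * e2 => z11 w11 _ m1.
have eq1 : z1 ^+ 2 + z2 ^+ 2 - (w1 ^+ 2 + w2 ^+ 2) = 0 by rewrite z11 w11 subrr.
have m2 : m ^+ 2 != 0 by rewrite expf_neq0.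
congr pair; rewrite ?exprMn ?exprVn.
  rewrite -mulrBl; apply: (mulIf m2); rewrite mulfVK // m1 -[RHS]addr0 -(mulr0 (z1 + w1)) -eq1.
  by rewrite /z1 /z2; ring.
apply: (mulIf m2).
transitivity (2 * ((z1 + w1) * e1 + (z2 + w2) * e2) * ((z2 + w2) * e1 - (z1 + w1) * e2)).
  by field.
rewrite m1 -[RHS]addr0 -(mulr0 (z2 + w2)) -eq1 /z1 /z2; ring.
Qed.

(** Lifting through the double cover of the circle: [transport] carries square roots of [U z] from
    the corner [(0, 0)] to every point of the square. *)
Lemma square_root_lift (G : R * R -> R * R) : continuous G -> (forall z, 0 < norm2 (G z)) ->
  exists2 h : R * R -> R * R, continuous h & forall z, usq z -> csquare (h z) = direction (G z).
Proof.
move=> cG G0; pose U z := direction (G z).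
have cU : continuous U by exact: cont_direction.
have U1 z : norm2 (U z) = 1 by exact: norm2_direction.
pose far (w : (R * R) * (R * R)) := norm2 ((U w.1).1 + (U w.2).1, (U w.1).2 + (U w.2).2).
have cfar : continuous far.
  have c1 : continuous (fun w : (R * R) * (R * R) => U w.1) by apply: (continuous_compose _ cU); cont.
  have c2 : continuous (fun w : (R * R) * (R * R) => U w.2) by apply: (continuous_compose _ cU); cont.
  by apply: cont_norm2; apply: continuous_pairing; apply: cont_add; cont.
pose dist (w : (R * R) * (R * R)) : R := Num.max `|w.1.1 - w.2.1| `|w.1.2 - w.2.2|.
have cdist : continuous dist by rewrite /dist; cont.
(* On the diagonal [far] is 4, so this set has a positive distance from it. *)
have cK : compact ([set w : (R * R) * (R * R) | usq w.1 /\ usq w.2] `&` [set w | far w <= 1]).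
  apply: compact_closedI; last by apply: le_closed => //; exact: cst_continuous.
  have := compact_setX (@usq_compact R) (@usq_compact R).
  by congr compact; apply/seteqP; split => w.
have [|e0 e00 He] := compact_pos cK cdist.
  move=> [z w] [/= [uz uw] zw]; rewrite /dist /= lt_max !normr_gt0.
  case: (eqVneq (z.1 - w.1) 0) => //= /eqP; rewrite subr_eq0 => /eqP h1.
  rewrite subr_eq0; apply/eqP => h2; have zwE : z = w by case: z w h1 h2 {uz uw zw} => [? ?] [? ?] /= -> ->.
  move: zw; rewrite zwE /far /norm2 /= -!mulr2n !exprMn_n -mulrnDl; have := U1 w; rewrite /norm2 => ->.
  by rewrite -[1 *+ _]/(_%:R : R); lra.
have Hnear z w : usq z -> usq w -> ball z e0 w ->
    1 <= norm2 ((U z).1 + (U w).1, (U z).2 + (U w).2).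
  move=> uz uw /ball_dist zw; case: (lerP 1 (norm2 ((U z).1 + (U w).1, (U z).2 + (U w).2))) => // fz.
  have /lt_trans/(_ zw) : e0 < dist (z, w) by apply: He; split => //; exact: ltW.
  by rewrite ltxx.
have [] := @transport R (R * R)%type (fun z e => csquare e = U z)
  (fun z w e => root_step (U z) (U w) e) e0 e00.
- by move=> z w e uz uw zw ez; apply: root_stepP => //; exact: Hnear.
- move=> X z w e cz cw ce _; have c1 := continuous_compose cz cU; have c2 := continuous_compose cw cU.
  have s1 : continuous (fun x => (U (z x)).1 + (U (w x)).1) by cont.
  have s2 : continuous (fun x => (U (z x)).2 + (U (w x)).2) by cont.
  have cm : continuous (fun x => (Num.max (Num.sqrt (norm2 ((U (z x)).1 + (U (w x)).1,
      (U (z x)).2 + (U (w x)).2))) 1)^-1).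
    apply: cont_inv => [x|]; first by rewrite gt_eqF // lt_max ltr01 orbT.
    apply: cont_max; last exact: cst_continuous.
    by apply: cont_sqrt; apply: cont_norm2; exact: continuous_pairing.
  by apply: continuous_pairing; apply: cont_mul => //; cont.
move=> T [T1 T2 _]; have [e ee] := csquare_surj (U1 (0, 0)).
have u0 : usq ((0, 0) : R * R) by rewrite /usq /= unit0.
exists (fun z => T (0, 0) (clamp2 z) e).
  apply: T2; [exact: cst_continuous|exact: clamp2_continuous|exact: cst_continuous|].
  by move=> x; split => //; exact: clamp2_usq.
by move=> z uz; rewrite clamp2_id //; exact: T1.
Qed.

End square_roots.

(** * Rings whose hemispheres meet are linked *)

Section linked.
Context {R : realType}.
Local Notation rdata := (ring_data R).

Lemma within_compose {X Y Z : topologicalType} (D : set Y) (r : X -> Y) (f : Y -> Z) :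
  {within D, continuous f} -> continuous r -> (forall x, D (r x)) ->
  continuous (fun x => f (r x)).
Proof.
move=> cf cr Dr x U nU; have H : within D (nbhs (r x)) (f @^-1` U).
  by rewrite (nbhs_subspace_in (Dr x)); exact: cf.
have H' : nbhs x (fun y => D (r y) -> U (f (r y))) := cr x _ H.
by apply: filterS H' => y; apply; exact: Dr.
Qed.

(** The square with corners at coordinates 1 and -1 contains the disk and retracts onto it by radial
    projection; [w] and [q] are the affine changes to and from the unit square. *)
Lemma disk_square_root (g : 'rV[R]_2 -> R * R) : {within unit_disk, continuous g} ->
  (forall v, unit_disk v -> 0 < norm2 (g v)) ->
  exists2 h : 'rV[R]_2 -> R * R, continuous h &
    forall v, unit_disk v -> csquare (h v) = direction (g v).
Proof.
move=> cg g0; pose s (v : 'rV[R]_2) : R := (Num.max (Num.sqrt (dotp v v)) 1)^-1.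
have s0 v : 0 < Num.max (Num.sqrt (dotp v v)) 1 by rewrite lt_max ltr01 orbT.
pose w (z : R * R) : 'rV[R]_2 := \row_i [:: 2 * z.1 - 1; 2 * z.2 - 1]`_i.
have cw : continuous w.
  have -> : w = fun z => (2 * z.1 - 1) *: delta_mx 0 0 + (2 * z.2 - 1) *: delta_mx 0 1.
    apply/funext => z; apply/rowP => i; rewrite !mxE /=.
    by case: i => [[|[|//]] ?] /=; rewrite ?mulr1 ?mulr0 ?addr0 ?add0r.
  by apply: cont_add; apply: cont_scale; cont.
have cs : continuous (fun z => s (w z)).
  apply: cont_inv => [z|]; first by rewrite gt_eqF // s0.
  by apply: cont_max; [apply: cont_sqrt; exact: cont_dotp|exact: cst_continuous].
have cr : continuous (fun z => s (w z) *: w z) by exact: cont_scale.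
have dr z : unit_disk (s (w z) *: w z).
  rewrite /unit_disk /= dotpZl dotpZr mulrA -expr2 exprVn.
  rewrite mulrC ler_pdivrMr ?mul1r; last by rewrite exprn_gt0 // s0.
  rewrite -{1}[dotp _ _]sqr_sqrtr ?dotp_ge0 // !expr2.
  by apply: ler_pM; rewrite ?sqrtr_ge0 // le_max lexx.
have [H cH HE] := square_root_lift (within_compose cg cr dr) (fun z => g0 _ (dr z)).
pose q (v : 'rV[R]_2) : R * R := ((v 0 0 + 1) / 2, (v 0 1 + 1) / 2).
have cq : continuous q.
  have c0 : continuous (fun v : 'rV[R]_2 => v 0 0) by apply: cont_coord; exact: cont_id.
  have c1 : continuous (fun v : 'rV[R]_2 => v 0 1) by apply: cont_coord; exact: cont_id.
  by rewrite /q; cont.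
exists (fun v => H (q v)); first exact: (continuous_compose cq cH).
move=> v v1; have dE : dotp v v = v 0 0 ^+ 2 + v 0 1 ^+ 2.
  rewrite dotpE !big_ord_recl big_ord0 addr0 !expr2.
  by have -> : lift ord0 ord0 = 1 :> 'I_2 by apply: val_inj.
have bnd (x y : R) : x ^+ 2 + y ^+ 2 <= 1 -> - 1 <= x <= 1.
  by have := sqr_ge0 y; have := sqr_ge0 (x - 1); have := sqr_ge0 (x + 1); nra.
have v1' : v 0 0 ^+ 2 + v 0 1 ^+ 2 <= 1 by rewrite -dE.
have b0 := bnd _ _ v1'; rewrite addrC in v1'; have b1 := bnd _ _ v1'.
have uq : usq (q v) by rewrite /usq /=; apply/andP; split; lra.
rewrite HE //; congr (direction (g _)).
have -> : w (q v) = v.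
  apply/rowP => i; rewrite mxE /=.
  case: i => [[|[|//]] ?] /=.
    have -> : 2 * ((v 0 0 + 1) / 2) - 1 = v 0 0 by lra.
    by congr (v _ _); exact: val_inj.
  have -> : 2 * ((v 0 1 + 1) / 2) - 1 = v 0 1 by lra.
  by congr (v _ _); exact: val_inj.
rewrite /s max_r ?invr1 ?scale1r //.
by rewrite -[leRHS]sqrtr1 ler_wsqrtr.
Qed.

Let circle_compact : compact (unit_circle : set 'rV[R]_2).
Proof.
have cd : continuous (fun v : 'rV[R]_2 => dotp v v) by apply: cont_dotp; exact: cont_id.
have := @rV_compact R 2 (fun=> `[- 1, 1]%classic) (fun _ => @segment_compact _ _ _).
have cc : closed [set v : 'rV[R]_2 | `|dotp v v - 1| <= 0].
  apply: le_closed; last exact: cst_continuous.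
  by apply: cont_norm; apply: cont_add => //; exact: cst_continuous.
move=> /compact_closedI/(_ cc); congr compact; apply/seteqP; split => v /=.
  by move=> [_]; rewrite normr_le0 subr_eq0 => /eqP.
move=> v1; rewrite v1 subrr normr0; split => // i; rewrite in_itv /=.
move: v1; rewrite /unit_circle /= dotpE (bigD1 i) //=; set t := \sum_(_ | _) _ => e.
have t0 : 0 <= t by rewrite sumr_ge0 // => j _; rewrite -expr2 sqr_ge0.
move: (v 0 i) e => x e.
by have := sqr_ge0 (x - 1); have := sqr_ge0 (x + 1); nra.
Qed.

(* A square root of the direction of [G] along the disk would cut the connected
   double cover of the circle of directions into two closed halves. *)
Lemma circle_not_filled (f : 'rV[R]_2 -> 'rV[R]_3) (G : 'rV[R]_3 -> R * R) :
  {within unit_disk, continuous f} -> set_inj unit_disk f -> continuous G ->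
  (forall v, unit_disk v -> 0 < norm2 (G (f v))) ->
  (forall p : R * R, norm2 p = 1 -> exists2 v, unit_circle v & direction (G (f v)) = p) ->
  (forall v w, unit_circle v -> unit_circle w ->
    direction (G (f v)) = direction (G (f w)) -> f v = f w) -> False.
Proof.
move=> cf injf cG G0 surj inj.
have cGf : {within unit_disk, continuous (fun v => G (f v))}.
  by move=> v; apply: continuous_comp; [exact: cf|exact: cG].
have [h ch hE] := disk_square_root cGf G0.
have cd (v : 'rV[R]_2) : unit_circle v -> unit_disk v by rewrite /unit_circle /unit_disk /= => ->.
have h1 v : unit_circle v -> norm2 (h v) = 1.
  by move=> /cd v1; apply: norm2_root (hE v v1) _; exact/norm2_direction/G0.
pose opp (e : R * R) : R * R := (- e.1, - e.2).
have cov e : norm2 e = 1 -> exists2 v, unit_circle v & (e = h v \/ e = opp (h v)).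
  move=> e1; have [|v v1 Gv] := surj (csquare e); first by rewrite norm2_csquare e1 expr1n.
  exists v => //; apply: csquare_eq; rewrite hE //; exact: cd.
have disj v w : unit_circle v -> unit_circle w -> h v = opp (h w) -> False.
  move=> v1 w1 vw.
  have e : v = w.
    apply: injf; rewrite ?inE; [exact: cd|exact: cd|].
    apply: inj => //; rewrite -!hE; [|exact: cd|exact: cd].
    by rewrite vw /csquare /opp /=; congr pair; ring.
  have := h1 w w1; rewrite e in vw; move: vw; case: (h w) => a b [ha hb].
  have -> : a = 0 by lra.
  have -> : b = 0 by lra.
  by rewrite /norm2 /= !expr2; lra.
pose v0 : 'rV[R]_2 := delta_mx 0 0.
have v01 : unit_circle v0 by rewrite /unit_circle /= /dotp -rowE !mxE !eqxx.
pose e0 := h v0; have e01 : norm2 e0 = 1 := h1 v0 v01.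
(* A path from [e0] to its opposite; the term in [t * (1 - t)], a quarter turn of [e0], avoids the
   origin at half time. *)
pose bend (t : R) : R * R :=
  ((1 - 2 * t) * e0.1 - t * (1 - t) * e0.2, (1 - 2 * t) * e0.2 + t * (1 - t) * e0.1).
have bend0 t : 0 < norm2 (bend t).
  have -> : norm2 (bend t) = ((1 - 2 * t) ^+ 2 + (t * (1 - t)) ^+ 2) * norm2 e0.
    by rewrite /norm2 /bend /=; ring.
  rewrite e01 mulr1 lt_neqAle addr_ge0 ?sqr_ge0 // andbT eq_sym paddr_eq0 ?sqr_ge0 //.
  rewrite !sqrf_eq0; apply/negP => /andP[/eqP t2 /eqP t1].
  have t12 : t = 2^-1 by lra.
  by move: t1; rewrite t12; lra.
have cbend : continuous bend by rewrite /bend; cont.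
pose e (t : R) := direction (bend t).
have ce : continuous e by exact: cont_direction.
have eE (t : R) : norm2 (e t) = 1 by exact: norm2_direction.
have dir1 p : norm2 p = 1 -> direction p = p.
  by move=> p1; rewrite -{2}(direction_scale p1 ltr01) !mul1r; case: (p).
have ee0 : e 0 = h v0.
  rewrite /e /bend.
  have -> : ((1 - 2 * 0) * e0.1 - 0 * (1 - 0) * e0.2, (1 - 2 * 0) * e0.2 + 0 * (1 - 0) * e0.1) = e0.
    by rewrite !mulr0 !mul0r !subr0 !mul1r addr0; case: (e0).
  exact: dir1.
have ee1 : e 1 = opp (h v0).
  rewrite /e /bend.
  have -> : ((1 - 2 * 1) * e0.1 - 1 * (1 - 1) * e0.2, (1 - 2 * 1) * e0.2 + 1 * (1 - 1) * e0.1) = opp e0.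
    by rewrite /opp; congr pair; ring.
  by apply: dir1; rewrite /norm2 /opp /= !sqrrN.
have hd : hausdorff_space (R * R)%type by exact: norm_hausdorff.
pose Z1 := h @` unit_circle; pose Z2 := (fun v => opp (h v)) @` unit_circle.
have cZ (k : 'rV[R]_2 -> R * R) : continuous k -> closed (k @` unit_circle).
  move=> ck; apply: compact_closed => //; apply: continuous_compact circle_compact.
  exact: continuous_subspaceT.
have cl1 : closed Z1 by exact: cZ.
have cl2 : closed Z2 by apply: cZ; rewrite /opp; cont.
pose B := `[0, 1]%classic `&` (e @^-1` Z1).
have := @segment_connected R 0 1.
rewrite /connected => /(_ B) conn.
have i0 : `[0, 1]%classic (0 : R) by rewrite /= in_itv /= lexx ler01.
have i1 : `[0, 1]%classic (1 : R) by rewrite /= in_itv /= lexx ler01.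
have BE : B = `[0, 1]%classic.
  apply: conn.
  - by exists 0; split => //; exists v0.
  - exists (e @^-1` ~` Z2); first by apply: open_comp => //; exact: closed_openC.
    apply/seteqP; split => t [t01].
      by move=> [v v1 hv]; split => //= -[w w1 hw]; apply: (disj v w) => //; rewrite hv hw.
    move=> nZ; split => //; have [v v1 [ev|ev]] := cov _ (eE t); first by exists v.
    by exfalso; apply: nZ; exists v.
  - exists (e @^-1` Z1) => //; apply: closed_comp => // t _; exact: ce.
have [_ [v v1 hv]] : B 1 by rewrite BE.
by apply: (disj v v0) => //; rewrite hv.
Qed.

(** The polynomial in [t] is the power along a ray from an inner point. The product of its roots has
    the sign of [P * W], so exactly one of them is positive: the ray leaves the sphere once. *)
Lemma chord (P B W : R) : P < 0 -> 0 < W ->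
  exists2 t : R, 0 < t & P + 2 * t * B + t ^+ 2 * W = 0.
Proof.
move=> P0 W0; pose d := Num.sqrt (B ^+ 2 - P * W).
have PW : P * W < 0 by rewrite nmulr_rlt0.
have d2 : d ^+ 2 = B ^+ 2 - P * W by rewrite sqr_sqrtr //; have := sqr_ge0 B; lra.
have dB : `|B| < d.
  rewrite -(@ltr_pXn2r _ 2) ?nnegrE ?sqrtr_ge0 // d2 real_normK ?num_real //; lra.
exists ((d - B) / W).
  by rewrite divr_gt0 // subr_gt0 (le_lt_trans (ler_norm _)).
have Wn : W != 0 by rewrite gt_eqF.
apply: (mulIf Wn); rewrite mul0r.
transitivity (P * W - B ^+ 2 + d ^+ 2); first by field.
by rewrite d2; ring.
Qed.

Lemma chord_unique (P B W t s : R) : P < 0 -> 0 < t -> 0 < s ->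
  P + 2 * t * B + t ^+ 2 * W = 0 -> P + 2 * s * B + s ^+ 2 * W = 0 -> 0 < W -> t = s.
Proof.
move=> P0 t0 s0 et es W0; apply/eqP; rewrite -subr_eq0; apply/negPn/negP => ts.
have : (t - s) * (P - t * s * W) = 0.
  transitivity (t * (P + 2 * s * B + s ^+ 2 * W) - s * (P + 2 * t * B + t ^+ 2 * W)); first by ring.
  by rewrite et es !mulr0 subrr.
move/eqP; rewrite mulf_eq0 (negbTE ts) /= subr_eq0 => /eqP e.
have : 0 < t * s * W by rewrite !mulr_gt0.
by rewrite -e; lra.
Qed.

(** [G] sends the complement of ring [a] to the punctured plane. The difference of the two powers is
    affine and vanishes at [x], so at a point [x + t *: w] of ring [b] the value of [G] is [t] times
    the linear map [l] at [w]. As [l] is injective on the plane of [b], the direction of [G] runs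
    once around the circle as ring [b] is traversed, which cannot extend to a disk. *)
Lemma linked_not_bounded (a b : rdata) x E : unit_sphere (rnormal b) ->
  meets_over a b x -> power a x < 0 ->
  bounds_disk [set y | power b y = 0 /\ height b y = 0] E ->
  (forall y, E y -> ~ (power a y = 0 /\ height a y = 0)) -> False.
Proof.
move=> ub [ha hb pab _] pa0 [f [cf injf fE fB]] EA.
pose G y : R * R := (power a y, height a y).
pose l (w : 'rV[R]_3) : R * R := (2 * dotp w (rcenter b - rcenter a), dotp w (rnormal a)).
have pb0 : power b x < 0 by rewrite -pab.
have powE w (t : R) : power b (x + t *: w) = power b x + 2 * t * dotp w (x - rcenter b) + t ^+ 2 * dotp w w.
  rewrite /power -addrA [t *: w + _]addrC addrA; move: (x - rcenter b) => y.
  by rewrite !(dotpDl, dotpDr, dotpZl, dotpZr) (dotpC y w); ring.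
have GE w (t : R) : power b (x + t *: w) = 0 -> G (x + t *: w) = (t * (l w).1, t * (l w).2).
  move=> p0; rewrite /G /l /=; congr pair.
    rewrite -[LHS]subr0 -{1}p0; move: pab; rewrite /power.
    have -> : rcenter b - rcenter a = (x - rcenter a) - (x - rcenter b).
      by apply/rowP => i; rewrite !mxE; ring.
    have eqx (c : 'rV[R]_3) : x + t *: w - c = (x - c) + t *: w by rewrite addrAC.
    rewrite !eqx; move: (x - rcenter a) (x - rcenter b) => y z.
    by rewrite !(dotpDl, dotpDr, dotpNl, dotpNr, dotpZl, dotpZr) (dotpC y w) (dotpC z w); lra.
  move: ha; rewrite /height addrAC (dotpDl (x - rcenter a)) dotpZl => ->.
  by rewrite add0r.
have hE w (t : R) : dotp w (rnormal b) = 0 -> height b (x + t *: w) = 0.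
  by move=> w0; move: hb; rewrite /height addrAC (dotpDl (x - rcenter b)) dotpZl w0 mulr0 addr0.
have cd (v : 'rV[R]_2) : unit_circle v -> unit_disk v by rewrite /unit_circle /unit_disk /= => ->.
have G0 v : unit_disk v -> 0 < norm2 (G (f v)).
  move=> v1; rewrite lt_neqAle norm2_ge0 andbT eq_sym; apply/eqP => /eqP.
  rewrite /norm2 paddr_eq0 ?sqr_ge0 // !sqrf_eq0 /= => /andP[/eqP p0 /eqP h0].
  by apply: (EA (f v)) => //; rewrite -fE; exists v.
have on_circle y : power b y = 0 -> height b y = 0 -> exists2 v, unit_circle v & f v = y.
  by move=> py hy; have : [set y | power b y = 0 /\ height b y = 0] y by []; rewrite -fB.
(* The ray in the direction of a nonzero kernel vector would hit ring [b] at a point of ring [a]. *)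
have l_inj w : dotp w (rnormal b) = 0 -> l w = 0 -> w = 0.
  move=> wb [l1 l2]; apply/eqP/negPn/negP => w0.
  have [t t0 et] := chord (dotp w (x - rcenter b)) pb0 (dotp_gt0 w0).
  rewrite -powE in et; have [v v1 fv] := on_circle _ et (hE _ t wb).
  by have := G0 v (cd v v1); rewrite fv GE // /l /= l1 l2 /norm2 /= !mulr0 expr0n addr0 ltxx.
apply: (circle_not_filled cf injf _ G0).
- by rewrite /G; apply: continuous_pairing; [apply: cont_power|apply: cont_height]; cont.
- move=> p p1; have [e1 [e2 [comb _]]] := orthonormal_frame ub.
  pose D := (l e1).1 * (l e2).2 - (l e1).2 * (l e2).1.
  have lD (s t : R) : l (s *: e1 + t *: e2) = (s * (l e1).1 + t * (l e2).1, s * (l e1).2 + t * (l e2).2).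
    by rewrite /l /= !dotpDl !dotpZl; congr pair; ring.
  have wb (s t : R) : dotp (s *: e1 + t *: e2) (rnormal b) = 0.
    by have [_ _] := comb s t 0; rewrite scale0r addr0.
  have ll (s t : R) : s *: e1 + t *: e2 = 0 -> s = 0 /\ t = 0.
    move=> st; have [] := comb s t 0; rewrite scale0r addr0 st !dotp0l => <- <- _ _.
    by [].
  have D0 : D != 0.
    apply/eqP => D0.
    have h1 : (l e2).1 *: e1 + (- (l e1).1) *: e2 = 0.
      apply: l_inj => //; rewrite lD; congr pair; first by ring.
      by rewrite -[RHS]oppr0 -D0 /D; ring.
    have h2 : (l e2).2 *: e1 + (- (l e1).2) *: e2 = 0.
      apply: l_inj => //; rewrite lD; congr pair; last by ring.
      by rewrite -[RHS]D0 /D; ring.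
    have [_ /eqP] := ll _ _ h1; rewrite oppr_eq0 => /eqP z1.
    have [_ /eqP] := ll _ _ h2; rewrite oppr_eq0 => /eqP z2.
    have e10 : e1 = 0.
      apply: l_inj; first by have := wb 1 0; rewrite scale1r scale0r addr0.
      by rewrite [LHS]surjective_pairing z1 z2.
    by have [] := ll 1 0; rewrite ?e10 ?scale0r ?scaler0 ?addr0 // => /eqP; rewrite oner_eq0.
  pose s := (p.1 * (l e2).2 - p.2 * (l e2).1) / D.
  pose t := ((l e1).1 * p.2 - (l e1).2 * p.1) / D.
  pose w := s *: e1 + t *: e2.
  have lw : l w = p.
    rewrite lD [RHS]surjective_pairing /s /t /D; congr pair; field; exact: D0.
  have w0 : w != 0.
    apply/eqP => w0; move: p1; rewrite -lw w0 /l !dotp0l mulr0 /norm2 /= expr0n addr0.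
    by move/eqP; rewrite eq_sym oner_eq0.
  have [k k0 ek] := chord (dotp w (x - rcenter b)) pb0 (dotp_gt0 w0).
  rewrite -powE in ek; have [v v1 fv] := on_circle _ ek (hE _ k (wb s t)).
  by exists v => //; rewrite fv GE // lw direction_scale.
move=> v v' v1 v'1 /(direction_eq (G0 _ (cd _ v1)) (G0 _ (cd _ v'1)))[k k0 Gvv].
have onb z : unit_circle z -> exists w,
    [/\ f z = x + 1 *: w, power b (f z) = 0 & dotp w (rnormal b) = 0].
  move=> z1; have : (f @` unit_circle) (f z) by exists z.
  rewrite fB => -[p0 h0]; exists (f z - x); split => //; first by rewrite scale1r addrC subrK.
  have -> : f z - x = (f z - rcenter b) - (x - rcenter b) by rewrite opprB addrA subrK.
  by rewrite dotpDl dotpNl; move: h0 hb; rewrite /height => -> ->; rewrite subr0.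
have [w [fE1 p0 wb]] := onb v v1; have [w' [fE1' p0' wb']] := onb v' v'1.
have ww : w = k *: w'.
  apply/eqP; rewrite -subr_eq0; apply/eqP; apply: l_inj.
    by rewrite dotpDl dotpNl dotpZl wb wb' mulr0 subr0.
  move: Gvv; rewrite fE1 in p0 *; rewrite fE1' in p0' *; rewrite !GE // !mul1r /l => -[g1 g2].
  rewrite !(dotpDl w) !dotpNl !dotpZl -[RHS]/(0, 0).
  by congr pair; [move: g1; rewrite /=; lra|move: g2; rewrite /=; lra].
have e1 : power b (x + k *: w') = 0 by rewrite -ww -[w]scale1r -fE1.
have e2 : power b (x + 1 *: w') = 0 by rewrite -fE1'.
have [w0|w0] := eqVneq w' 0; first by rewrite fE1 fE1' ww w0 !scaler0.
rewrite !powE in e1 e2.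
have k1 := chord_unique pb0 k0 ltr01 e1 e2 (dotp_gt0 w0).
by rewrite fE1 fE1' ww k1 scale1r.
Qed.

(** A common point of the hemispheres at height zero lies on both rings, hence on both disks. At
    positive height, the disk of [b], which misses ring [a], is impossible by the winding
    argument. *)
Lemma unlinked_separated (a b : rdata) : unit_sphere (rnormal b) ->
  unlinked [set y | power a y = 0 /\ height a y = 0] [set y | power b y = 0 /\ height b y = 0] ->
  separated a b.
Proof.
move=> ub [D [E [AD BE DE]]] x mx.
have circle_sub (A K : set 'rV[R]_3) : bounds_disk A K -> A `<=` K.
  move=> [f [_ _ <- <-]] y [v v1 <-]; exists v => //.
  by move: v1; rewrite /unit_circle /unit_disk /= => ->.
have EA y : E y -> ~ (power a y = 0 /\ height a y = 0).
  move=> Ey ay; have : (D `&` E) y by split => //; exact: (circle_sub _ _ AD).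
  by rewrite DE.
have [ha hb pab pa] := mx.
have [pa0|pa0] := eqVneq (power a x) 0.
  by apply: (EA x) => //; apply: (circle_sub _ _ BE); rewrite /= -pab.
by apply: (linked_not_bounded ub mx _ BE EA); rewrite lt_neqAle pa0.
Qed.

End linked.

(** * Ordering configurations *)

Section unordered_lift.
Context {R : realType} (n : nat) {T : topologicalType} {N : normedModType R}.
Local Notation W := {ptws 'I_n -> T}.
Variable v : T -> N.
Hypotheses (cv : continuous v) (v_inj : injective v).

(** An unordered tuple has at most one ordering [t] with this property for a given [e]. The property
    is open and holds between an injective tuple and itself, so that nearby configurations inherit
    an order. Distances are measured after the injection [v] into a normed space. *)
Let close (e t : 'I_n -> T) : Prop :=
  forall i j, i != j -> `|v (e i) - v (t i)| < `|v (e i) - v (t j)|.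

Let close_perm (g : 'S_n) e t : close e t -> close (e \o g) (t \o g).
Proof. by move=> et i j ij; apply: et; rewrite (inj_eq perm_inj). Qed.

Let close_unique e t t' : close e t -> close e t' -> unorder t = unorder t' -> t = t'.
Proof.
move=> et et' /unorderP[g tg]; suff g1 : g = 1%g by rewrite tg g1; apply/funext => i /=; rewrite perm1.
apply/permP => i; rewrite perm1; apply/eqP/negPn/negP => gi.
have h1 := et i (g i); have h2 := et' i (g^-1%g i).
have gi' : i != g^-1%g i by apply: contra gi => /eqP gi; rewrite {1}gi permKV.
have := h2 gi'; rewrite tg /= permKV => /(lt_trans (h1 _)); rewrite eq_sym gi => /(_ isT).
by rewrite ltxx.
Qed.

Let close_self e : injective e -> close e e.
Proof.
move=> ie i j ij; rewrite subrr normr0 normr_gt0 subr_eq0.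
by apply: contra ij => /eqP/v_inj/ie ->.
Qed.

Let close_open : open [set w : W * W | close w.1 w.2].
Proof.
rewrite openE => -[e t] et; rewrite /interior.
have FF : Filter (nbhs (e, t)) by exact: nbhs_filter.
refine (@filter_forall _ 'I_n (fun i (w : W * W) => forall j, i != j ->
  `|v (w.1 i) - v (w.2 i)| < `|v (w.1 i) - v (w.2 j)|) _ FF _) => i.
refine (@filter_forall _ 'I_n (fun j (w : W * W) => i != j ->
  `|v (w.1 i) - v (w.2 i)| < `|v (w.1 i) - v (w.2 j)|) _ FF _) => j.
have [->|ij] := eqVneq i j; first by apply: filterE => w; rewrite ?eqxx.
have c1 k : continuous (fun w : W * W => v (w.1 k)).
  apply: (@continuous_compose _ _ _ (fun w : W * W => w.1 k) v _ cv).
  by apply: (@cont_proj (W * W)%type _ n fst); exact: cont_fst (@cont_id _).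
have c2 k : continuous (fun w : W * W => v (w.2 k)).
  apply: (@continuous_compose _ _ _ (fun w : W * W => w.2 k) v _ cv).
  by apply: (@cont_proj (W * W)%type _ n snd); exact: cont_snd (@cont_id _).
have op : open [set w : W * W | `|v (w.1 i) - v (w.2 i)| < `|v (w.1 i) - v (w.2 j)|].
  by apply: lt_open; apply: cont_norm; apply: cont_add => //; exact: cont_opp.
have := open_nbhs_nbhs (conj op (et i j ij) : open_nbhs (e, t) _).
by apply: filterS => w.
Qed.

Lemma unorder_open (O : set W) : open O -> open (@unorder n T @` O).
Proof.
move=> oO; suff : open ((@unorder n T : W -> _) @^-1` (@unorder n T @` O)) by [].
have -> : (@unorder n T : W -> _) @^-1` (@unorder n T @` O) =
    \bigcup_(g in [set: 'S_n]) [set t : W | O (t \o g : W)].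
  apply/seteqP; split => t /=.
    by move=> [s Os /unorderP[g tg]]; exists g^-1%g => //=; rewrite tg;
      congr (O _): Os; apply/funext => i /=; rewrite permKV.
  by move=> [g _ Og]; exists (t \o g) => //; apply/esym/unorderP; exists g.
apply: bigcup_open => g _; apply: (@open_comp W W (fun t => t \o g)) => // t _.
have c : continuous (fun t : W => t \o g : W).
  by apply: cont_family => i; apply: (@cont_proj W _ n (fun t => t)); exact: cont_id.
exact: c.
Qed.

(** Over injective tuples, forgetting the order is a covering. [transport] carries an order of
    [G (0, 0)] to the whole square, each small step passing to the close order. *)
Lemma unordered_lift (G : R * R -> unordered n T) : continuous G ->
  (forall z s, usq z -> unorder s = G z -> injective s) ->
  exists2 h : R * R -> W, continuous h & forall z, usq z -> unorder (h z) = G z.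
Proof.
move=> cG G_inj.
pose P (B : set (R * R)) := forall z w e, B z -> B w -> unorder e = G z ->
  exists t, unorder t = G w /\ close e t.
have [||e0 e00 He] := @lebesgue_number R P.
- by move=> A B AB PB z w e /AB Bz /AB Bw; exact: PB.
- move=> z uz; pose s : W := repr (G z).
  have sG : unorder s = G z by exact: unorder_repr.
  have : nbhs (s, s) [set w : W * W | close w.1 w.2].
    apply: open_nbhs_nbhs; split; first exact: close_open.
    exact/close_self/(G_inj z).
  case=> -[A B] [/= nA nB] AB.
  have [O [oO Os] OAB] : exists2 O : set W, open_nbhs s O & O `<=` A `&` B.
    exists (A `&` B)^°; last exact: interior_subset.
    by split; [exact: open_interior|exact: filterI].
  have : nbhs z (G @^-1` (@unorder n T @` O)).
    by apply: cG; apply: open_nbhs_nbhs; split; [exact: unorder_open|by exists s].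
  move=> /nbhs_ballP[e e_gt0 He]; exists e => // z' w e' /He[t Ot tG] /He[t' Ot' t'G] e'G.
  have [g e'E] : exists g : 'S_n, e' = t \o g by apply/unorderP; rewrite tG e'G.
  exists (t' \o g); split; first by rewrite -t'G; apply/esym/unorderP; exists g.
  rewrite e'E; apply: close_perm; apply: (AB (t, t')).
  by split; [case: (OAB t Ot)|case: (OAB t' Ot')].
(* The choice is made pointwise; [close_unique] makes it agree with the orders that nearby tuples
   inherit, which gives continuity. *)
pose K (z w : R * R) (e : W) : W := xget e [set t : W | unorder t = G w /\ close e t].
have KP z w e : usq z -> ball z e0 w -> unorder e = G z ->
    unorder (K z w e) = G w /\ close e (K z w e).
  move=> uz zw ez; rewrite /K; case: xgetP => [t _ //|noK].
  have [t tP] := He z uz z w e (ballxx z e00) zw ez.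
  by case: (noK t).
have [] := @transport R W (fun z e => unorder e = G z) K e0 e00.
- by move=> z w e uz _ zw /(KP z w e uz zw)[].
- move=> X z w e cz cw ce H x U nU.
  have [uz uw zw ez] := H x; have [tG tc] := KP _ _ _ uz zw ez.
  have : nbhs (e x, K (z x) (w x) (e x)) [set w : W * W | close w.1 w.2].
    by apply: open_nbhs_nbhs; split; [exact: close_open|].
  case=> -[A B] [/= nA nB] AB.
  have [O [oO Ot] OUB] : exists2 O : set W, open_nbhs (K (z x) (w x) (e x)) O & O `<=` U `&` B.
    exists (U `&` B)^°; last exact: interior_subset.
    by split; [exact: open_interior|exact: filterI].
  have n1 : nbhs x (e @^-1` A) by exact: ce.
  have cGw : continuous (fun x => G (w x)) by exact: (continuous_compose cw cG).
  have n2 : nbhs x ((fun x => G (w x)) @^-1` (@unorder n T @` O)).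
    by apply: cGw; apply: open_nbhs_nbhs; split; [exact: unorder_open|by exists (K (z x) (w x) (e x))].
  apply: filterS2 n1 n2 => y Ay [t Oy tGy] /=.
  have [uzy uwy zwy ezy] := H y; have [tG' tc'] := KP _ _ _ uzy zwy ezy.
  have [Ut Bt] := OUB t Oy.
  have et : close (e y) t by exact: (AB (e y, t)).
  by rewrite (close_unique tc' et) // tG' tGy.
move=> Tr [T1 T2 _]; have u0 : usq ((0, 0) : R * R) by rewrite /usq /= unit0.
pose s : W := repr (G (0, 0)).
have sG : unorder s = G (0, 0) by exact: unorder_repr.
exists (fun z => Tr (0, 0) (clamp2 z) s).
  apply: T2; [exact: cst_continuous|exact: clamp2_continuous|exact: cst_continuous|].
  by move=> x; split => //; exact: clamp2_usq.
by move=> z uz; rewrite clamp2_id //; exact: T1.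
Qed.

End unordered_lift.

(** * Configurations of oriented rings *)

Section oriented_rings.
Context {R : realType} (n : nat).
Local Notation T := (@oriented_ring R).
Local Notation W := {ptws 'I_n -> T}.
Local Notation V := {ptws 'I_n -> ring_data R}.
Local Notation all_rings := [set: 'I_n]%SET.
Local Notation Q := (configs R n all_rings finset.set0).
Local Notation A := (parallel_normals R n all_rings).

Definition to_data (C : T) : ring_data R := (ring_center C, ring_radius C ^+ 2, ring_normal C).

Definition to_configs (s : W) : V := fun i => to_data (s i).

Lemma to_data_square C : 0 < rsquare (to_data C).
Proof. by rewrite /rsquare /= exprn_gt0 // ring_radius_gt0. Qed.

Lemma to_data_normal C : unit_sphere (rnormal (to_data C)).
Proof. exact: ring_normal_unit. Qed.

Lemma to_data_inj : injective to_data.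
Proof.
move=> C D [cc /eqP rr nn]; apply: val_inj.
have rE : ring_radius C = ring_radius D.
  by apply/eqP; move: rr; rewrite eqrXn2 ?ltW ?ring_radius_gt0.
move: cc rE nn; rewrite /ring_center /ring_radius /ring_normal /set_val /=.
by case: (val C) (val D) => [[? ?] ?] [[? ?] ?] /= -> -> ->.
Qed.

Lemma to_configs_inj : injective to_configs.
Proof. by move=> s t st; apply/funext => i; apply: to_data_inj; exact: (congr1 (fun f => f i) st). Qed.

Lemma set_val_oriented_continuous : continuous (set_val : T -> ring_data R).
Proof. exact: initial_continuous. Qed.

Lemma cont_to_configs {X : topologicalType} (f : X -> W) : continuous f ->
  continuous (fun x => to_configs (f x)).
Proof.
move=> cf; apply: cont_family => i.
have c : continuous (fun x => set_val (f x i) : ring_data R).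
  by apply: continuous_compose set_val_oriented_continuous; exact: cont_proj.
rewrite /to_configs /to_data /ring_center /ring_radius /ring_normal.
apply: continuous_pairing; last exact: cont_snd.
apply: continuous_pairing; first exact: cont_fst (cont_fst c).
by apply: cont_exp; exact: cont_snd (cont_fst c).
Qed.

Lemma ocarrier_data C : ocarrier C = [set x | power (to_data C) x = 0 /\ height (to_data C) x = 0].
Proof.
apply/seteqP; split => x [h1 h2]; split => //.
  by rewrite /power; apply/eqP; rewrite subr_eq0; apply/eqP; exact: h1.
by apply/eqP; rewrite /= -subr_eq0; apply/eqP; exact: h1.
Qed.

Lemma oriented_configsP (s : W) :
  oriented_ring_configs R n (unorder s) <-> Q (to_configs s).
Proof.
rewrite /oriented_ring_configs /= unordered_mapE; split; last first.
  move=> [_ _ _ sep]; exists (forget_orientation \o s) => // i j ij.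
  have sij : separated (to_data (s i)) (to_data (s j)) by apply: sep; rewrite // !inE.
  rewrite /= !carrierE !ocarrier_data; split.
    rewrite -subset0 => x [[p1 h1] [p2 h2]]; apply: (sij x).
    by split; rewrite // p1 // p2.
  by apply: separated_unlinked sij; [exact: to_data_square|exact: to_data_normal|
    exact: to_data_square|exact: to_data_normal].
move=> [C /unorderP[g CE] CU]; split.
- by move=> i _; exact: to_data_square.
- by move=> i; rewrite inE.
- by move=> i _; exact: to_data_normal.
move=> i j _ _ ij; have gij : g^-1%g i != g^-1%g j by rewrite (inj_eq perm_inj).
have [_] := CU _ _ gij; rewrite CE /= !permKV !carrierE !ocarrier_data.
by apply: unlinked_separated; exact: to_data_normal.
Qed.

Lemma oriented_configs_inj (s : W) : Q (to_configs s) -> injective s.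
Proof.
move=> [_ _ _ sep] i j sij; apply/eqP/negPn/negP => ij.
apply: (sep i j _ _ ij (ring_center (s i))); rewrite ?inE //.
rewrite /to_configs -sij /meets_over /height /power /rcenter /= subrr !dotp0l; split => //.
by rewrite sub0r oppr_le0 ltW // to_data_square.
Qed.

(** Continuity of the inverse of [to_configs] on [Q], stated along maps because [Q] is only a subset
    of the family space. *)
Lemma of_configs {X : topologicalType} (f : X -> V) : continuous f -> (forall x, Q (f x)) ->
  exists2 g : X -> W, continuous g & forall x, to_configs (g x) = f x.
Proof.
move=> cf Qf.
have dP x i : oriented_ring_data (rcenter (f x i), Num.sqrt (rsquare (f x i)), rnormal (f x i)).
  by have [h1 _ h3 _] := Qf x; split; rewrite /= ?sqrtr_gt0 ?h1 ?inE //; apply: h3; rewrite !inE.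
exists (fun x i => SigSub (mem_set (dP x i)) : T).
  apply: cont_family => i; apply: continuous_comp_initial.
  have ci := @cont_proj X _ n f i cf.
  apply: (@continuous_pairing _ _ _ (fun x => (rcenter (f x i), Num.sqrt (rsquare (f x i))))).
    by apply: continuous_pairing; [exact: cont_rcenter|apply: cont_sqrt; exact: cont_rsquare].
  exact: cont_rnormal.
move=> x; apply/funext => i; have [h1 _ _ _] := Qf x.
rewrite /to_configs /to_data /ring_center /ring_radius /ring_normal /set_val /=.
rewrite sqr_sqrtr ?(ltW (h1 _ _)) ?inE // /rcenter /rsquare /rnormal.
by case: (f x i) => -[].
Qed.

(** The values are described through any ordered representative, which makes them comparable with
    those of other lifts. *)
Lemma to_oriented {X : topologicalType} (f : X -> V) : continuous f -> (forall x, Q (f x)) ->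
  exists2 F : X -> oriented_ring_configs R n, continuous F &
    forall x (s : W), to_configs s = f x -> set_val (F x) = unorder s.
Proof.
move=> cf Qf; have [g cg gE] := of_configs cf Qf.
have gP x : oriented_ring_configs R n (unorder (g x)) by apply/oriented_configsP; rewrite gE.
exists (fun x => SigSub (mem_set (gP x)) : oriented_ring_configs R n).
  by apply: continuous_comp_initial; exact: (continuous_compose cg (@unorder_continuous n T)).
by move=> x s sf; rewrite /set_val /=; congr unorder; apply: to_configs_inj; rewrite gE.
Qed.

Lemma parallel_orientation_inj : injective (parallel_orientation R n).
Proof.
move=> x y xy; apply: val_inj; have := forget_parallel_orientation x.
by rewrite xy forget_parallel_orientation.
Qed.

Lemma parallel_orientation_normals x (s : W) :
  set_val (parallel_orientation R n x) = unorder s -> A (to_configs s).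
Proof.
move=> e0 i _; have e : unordered_map orient_x (set_val x) = unorder s := e0.
have [C [xC Cp]] : (exists C, set_val x = unorder C /\ True).
  by exists (repr (set_val x)); rewrite unorder_repr.
move: e; rewrite xC unordered_mapE => /unorderP[g ->].
by rewrite /to_configs /rnormal /=.
Qed.

Lemma to_parallel {X : topologicalType} (f : X -> V) : continuous f ->
  (forall x, (Q `&` A) (f x)) ->
  exists2 F : X -> parallel_ring_configs R n, continuous F &
    forall x (s : W), to_configs s = f x -> set_val (parallel_orientation R n (F x)) = unorder s.
Proof.
move=> cf QAf; have [g cg gE] := of_configs cf (fun x => (QAf x).1).
have nE x i : ring_normal (g x i) = e_x.
  have [_ /(_ i)] := QAf x; rewrite -gE; apply; exact: finset.in_setT.
have gP x : parallel_ring_configs R n (unorder (forget_orientation \o g x)).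
  split.
    have : oriented_ring_configs R n (unorder (g x)) by apply/oriented_configsP; rewrite gE; case: (QAf x).
    by rewrite /oriented_ring_configs /= unordered_mapE.
  exists (forget_orientation \o g x) => // i; exists (ring_center (g x i) 0 0).
  rewrite /= planeE; apply/seteqP; split => y; rewrite /oplane /= nE dotpC /dotp -rowE !mxE.
    by move/eqP; rewrite subr_eq0 => /eqP.
  by move=> ->; rewrite subrr.
exists (fun x => SigSub (mem_set (gP x)) : parallel_ring_configs R n).
  apply: continuous_comp_initial.
  have c : continuous (fun x => unordered_map forget_orientation (unorder (g x)) : unordered n _).
    apply: (@continuous_compose _ _ _ (fun x => unorder (g x))); last exact: cts_fun.
    exact: (continuous_compose cg (@unorder_continuous n T)).
  have E : (fun x => unordered_map forget_orientation (unorder (g x)) : unordered n _) =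
      (fun x => unorder (forget_orientation \o g x)).
    by apply/funext => x; rewrite unordered_mapE.
  by rewrite E in c; exact: c.
move=> x s sf; have <- : g x = s by apply: to_configs_inj; rewrite gE.
rewrite -[LHS]/(unordered_map orient_x (unorder (forget_orientation \o g x))) unordered_mapE.
congr unorder; apply/funext => i /=; rewrite orient_xE; apply: val_inj; rewrite /= -(nE x i).
by rewrite /ring_center /ring_radius /ring_normal /set_val /=; case: (val (g x i)) => -[].
Qed.

Local Notation I := (unit_itv R).

Lemma lift_square (G : I * I -> oriented_ring_configs R n) : continuous G ->
  exists2 h : R * R -> W, square_in Q (fun z => to_configs (h z)) &
    forall z, usq z -> set_val (G (clamp z.1, clamp z.2)) = unorder (h z).
Proof.
move=> cG; pose H (z : R * R) := set_val (G (clamp z.1, clamp z.2)).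
have cH : continuous H.
  have cv : continuous (set_val : oriented_ring_configs R n -> _) by exact: initial_continuous.
  apply: (continuous_compose _ cv); apply: (continuous_compose _ cG).
  apply: continuous_pairing; apply: (continuous_compose _ clamp_continuous); cont.
have HP z : oriented_ring_configs R n (H z) by exact: set_valP.
have [|h ch hE] := @unordered_lift R n T _ set_val set_val_oriented_continuous val_inj H cH.
  by move=> z s uz sz; apply: oriented_configs_inj; apply/oriented_configsP; rewrite sz.
exists h; last by move=> z uz; rewrite hE.
split; first exact: cont_to_configs.
by move=> z uz; apply/oriented_configsP; rewrite hE.
Qed.

Lemma configs_good : good R Q A.
Proof. exact: rings_good. Qed.

End oriented_rings.

Section as_path.
Context {R : realType} {T : topologicalType} (x y : T) (q : unit_itv R -> T).
Hypotheses (cq : continuous q) (q0 : q zero = x) (q1 : q one = y).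

(** The proofs are arguments of the constant so that a path structure can be attached to it. *)
Definition as_path of continuous q & q zero = x & q one = y : unit_itv R -> T := q.

HB.instance Definition _ := isContinuous.Build _ _ (as_path cq q0 q1) cq.
HB.instance Definition _ := @isPath.Build _ _ x y (as_path cq q0 q1) q0 q1.

End as_path.

(** * The induced map of fundamental groups *)

Section fundamental_groups.
Context {R : realType} (n : nat).
Local Notation V := {ptws 'I_n -> ring_data R}.
Local Notation all_rings := [set: 'I_n]%SET.
Local Notation Q := (configs R n all_rings finset.set0).
Local Notation A := (parallel_normals R n all_rings).
Local Notation I := (unit_itv R).
Local Notation phi := (parallel_orientation R n).

Let usq_uval (z : I * I) : usq (uval z.1, uval z.2).
Proof. by rewrite /usq /= !uval_ge0 !uval_le1. Qed.

Let cont_uval (K : R * R -> V) : continuous K ->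
  continuous (fun z : I * I => K (uval z.1, uval z.2)).
Proof.
move=> cK; apply: (continuous_compose _ cK); apply: continuous_pairing.
  by apply: (continuous_compose _ uval_continuous); exact: cont_fst (@cont_id _).
by apply: (continuous_compose _ uval_continuous); exact: cont_snd (@cont_id _).
Qed.

Let frame_uval (t : I) : [/\ frame (uval t, uval (zero : I)), frame (uval t, uval (one : I)),
  frame (uval (zero : I), uval t) & frame (uval (one : I), uval t)].
Proof.
have t01 : 0 <= uval t <= 1 by rewrite uval_ge0 uval_le1.
by rewrite uval_zero uval_one; exact: (frameP (@frame R)).2 (fun z Hz => Hz) _ t01.
Qed.

Lemma pi1_map_inj x : injective (pi1_map R phi x).
Proof.
move=> a b; have [p ->] := loop_class_surj a; have [q ->] := loop_class_surj b.
rewrite !pi1_mapE => /loop_classP[H [cH H0 H1 Hz Ho]]; apply/loop_classP.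
have [h [ch hQ] hE] := lift_square cH; have [_ _ c2] := configs_good (R := R) n.
have HE (s t : I) : set_val (H (s, t)) = unorder (h (uval s, uval t)).
  by have := hE _ (usq_uval (s, t)); rewrite /= !uvalK.
have hA (s t : I) y : H (s, t) = phi y -> A (to_configs (h (uval s, uval t))).
  by move=> e; apply: (parallel_orientation_normals (x := y)); rewrite -HE e.
have px : p zero = x by exact: path_zero.
have p1 : p one = x by exact: path_one.
have [|K [[cK KQA] KE]] := c2 (fun z => to_configs (h z)) (conj ch hQ).
  apply/frameP => s s01; rewrite -(clampK s01) -uval_zero -uval_one; split.
  - by apply: (hA _ _ (p (clamp s))); rewrite H0.
  - by apply: (hA _ _ (q (clamp s))); rewrite H1.
  - by apply: (hA _ _ (p zero)); rewrite Hz.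
  - by apply: (hA _ _ (p one)); rewrite Ho.
have [F cF FE] := to_parallel (cont_uval cK) (fun z => KQA _ (usq_uval z)).
(* On the frame the filling has the values of [H], and [phi] is injective, so the ends of the new
   homotopy are the given loops themselves. *)
have Fphi (s t : I) y : frame (uval s, uval t) -> H (s, t) = phi y -> F (s, t) = y.
  move=> fr e; apply: (@parallel_orientation_inj R n); rewrite -e; apply: val_inj.
  have := FE (s, t) (h (uval s, uval t)); rewrite /= KE // => /(_ erefl).
  by rewrite -HE.
exists F; split => // t; have [f1 f2 f3 f4] := frame_uval t.
- by apply: Fphi => //; rewrite H0.
- by apply: Fphi => //; rewrite H1.
- by apply: Fphi => //; rewrite Hz.
- by apply: Fphi => //; rewrite Ho.
Qed.

(** Both ends of the lifted loop are parallel, though possibly ordered differently. [edge_square]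
    with constant vertical sides therefore compresses it with its ends fixed, which keeps the base
    point. *)
Lemma pi1_map_surj x b : exists a, pi1_map R phi x a = b.
Proof.
have [p ->] := loop_class_surj b.
have cp : continuous (fun z : I * I => p z.1).
  by apply: (@continuous_compose _ _ _ fst p (cont_fst (@cont_id _))); exact: cts_fun.
have [h [ch hQ] hE] := lift_square cp; have [_ c1 _] := configs_good (R := R) n.
pose g (s : R) : V := to_configs (h (s, 0)).
have gE (s : I) : set_val (p s) = unorder (h (uval s, 0)).
  by have := hE _ (usq_uval (s, zero)); rewrite /= uvalK uval_zero.
have gA (s : I) : p s = phi x -> A (g (uval s)).
  by move=> e; apply: (parallel_orientation_normals (x := x)); rewrite -gE e.
have g0 : A (g 0) by rewrite -uval_zero; apply: gA; exact: path_zero.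
have g1 : A (g 1) by rewrite -uval_one; apply: gA; exact: path_one.
have gQ : path_in Q g.
  split; first by apply: (@continuous_compose _ _ _ (fun s : R => (s, 0 : R)) _ _ ch); cont.
  by move=> t t01; apply: hQ; rewrite /usq /= t01 unit0.
have cstQ (s : R) : 0 <= s <= 1 -> path_in Q (fun _ : R => g s).
  by move=> s01; split; [exact: cst_continuous|move=> _ _; exact: gQ.2].
have [D [[cD DQ] DE]] := edge_square c1 gQ (cstQ 0 unit0) (cstQ 1 unit1) erefl erefl g0 g1.
have uI (t : I) : 0 <= uval t <= 1 by rewrite uval_ge0 uval_le1.
have [F cF FE] := to_oriented (cont_uval cD) (fun z => DQ _ (usq_uval z)).
have cD1 : continuous (fun t : I => D (uval t, 1)).
  by apply: (@continuous_compose _ _ _ (fun t : I => (uval t, 1 : R)) _ _ cD);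
    apply: continuous_pairing; [exact: uval_continuous|exact: cst_continuous].
have [|q cq qE] := to_parallel cD1.
  move=> t; have [_ ? _ _] := DE _ (uI t); split => //; apply: DQ.
  by rewrite /usq /= uI unit1.
(* An ordered representative of the top side, through which the end of the homotopy [F] is compared
   with the image of [q]. *)
have [w cw wE] := of_configs cD1 (fun t => DQ _ (ltac:(by rewrite /usq /= uI unit1) : usq (uval t, 1))).
have Fq t : F (t, one) = phi (q t).
  apply: val_inj; have := FE (t, one) (w t); rewrite /= uval_one wE => /(_ erefl) e1.
  exact: etrans e1 (esym (qE t (w t) (wE t))).
have Fp (s t : I) r : D (uval s, uval t) = g (uval r) -> F (s, t) = p r.
  move=> e; apply: val_inj; have := FE (s, t) (h (uval r, 0)); rewrite /= e => /(_ erefl).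
  by rewrite -gE.
have F0 t : F (t, zero) = p t.
  by apply: Fp; rewrite uval_zero; have [-> _ _ _] := DE _ (uI t).
have Fz t : F (zero, t) = p zero.
  by apply: Fp; rewrite uval_zero; have [_ _ -> _] := DE _ (uI t).
have Fo t : F (one, t) = p one.
  by apply: Fp; rewrite uval_one; have [_ _ _ ->] := DE _ (uI t).
have q0 : q zero = x by apply: (@parallel_orientation_inj R n); rewrite -Fq Fz path_zero.
have q1 : q one = x by apply: (@parallel_orientation_inj R n); rewrite -Fq Fo path_one.
exists (loop_class (as_path cq q0 q1)); rewrite pi1_mapE; apply/loop_classP/path_homotopic_sym.
by exists F; split => // t; rewrite Fq.
Qed.

End fundamental_groups.

Theorem proposition2p3 (R : realType) (n : nat) (hn : (1 <= n)%N)
    (x : parallel_ring_configs R n) :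
  group_isomorphism (pi1_map R (parallel_orientation R n) x).
Proof.
split; first by move=> a b; exact: gmulfM.
have [f fK] := choice (@pi1_map_surj R n x).
by exists f => // a; apply: (@pi1_map_inj R n x); exact: fK.
Qed.
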